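(* Every even unimodular lattice $L\subseteq\mathbb{R}^{32}$ without roots, i.e. with $\{x\in L: x\cdot x=2\}=\emptyset$, is a local maximum for the $f_\alpha$-potential energy with $\alpha=\pi$ (the Gaussian potential function $r\mapsto e^{-\pi r}$) on the manifold of rank $32$ lattices of point density $1$.
   Context: A lattice $L\subseteq\mathbb{R}^n$ (discrete subgroup of full rank) is unimodular if it equals its dual $L^*=\{y\in\mathbb{R}^n: x\cdot y\in\mathbb{Z}\ \forall x\in L\}$, and even if $x\cdot x$ is an even integer for all $x\in L$. For $\alpha>0$ let $f_\alpha(r)=e^{-\alpha r}$ and $\mathcal{E}(f_\alpha,L)=\sum_{x\in L\setminus\{0\}}e^{-\alpha\|x\|^2}$. The manifold of rank $n$ lattices of point density $1$ (one lattice point per unit volume) is parametrized by positive definite symmetric $n\times n$ matrices $Y$ of determinant $1$: with $L$ fixed (of density $1$), the energy function is $F_{\alpha,L}(Y)=\sum_{x\in L\setminus\{0\}}e^{-\alpha x^{\mathsf T}Yx}$, with $L$ itself corresponding to $Y=I_n$. $L$ is a local maximum for the $f_\alpha$-potential energy if $I_n$ is a local maximum of $F_{\alpha,L}$ on this manifold. *)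

(* Defs.v *)
From mathcomp Require Import all_boot all_order all_algebra.
From mathcomp Require Import all_classical all_reals all_analysis.
Set Implicit Arguments.
Unset Strict Implicit.
Unset Printing Implicit Defensive.
Import Order.TTheory GRing.Theory Num.Theory numFieldNormedType.Exports.

Local Open Scope classical_set_scope.
Local Open Scope ring_scope.

Definition qform (R : realType) (n : nat) (Y : 'M[R]_n) (x : 'cV[R]_n) : R :=
  (x^T *m Y *m x) ord0 ord0.

Definition dotp (R : realType) (n : nat) (x y : 'cV[R]_n) : R :=
  (x^T *m y) ord0 ord0.

(* Full rank: the columns of B are n linearly independent vectors of L; they
   need not generate L. *)
Definition is_lattice (R : realType) (n : nat) (L : set 'cV[R]_n) : Prop :=
  [/\ L 0 /\ (forall x y, L x -> L y -> L (x - y)),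
      forall x, L x -> isolated L x &
      exists B : 'M[R]_n, B \in unitmx /\ forall j, L (col j B)].

Definition dual_lattice (R : realType) (n : nat) (L : set 'cV[R]_n) :
    set 'cV[R]_n :=
  [set y | forall x, L x -> dotp x y \is a Num.int].

Definition unimodular (R : realType) (n : nat) (L : set 'cV[R]_n) : Prop :=
  L = dual_lattice L.

Definition even_lattice (R : realType) (n : nat) (L : set 'cV[R]_n) : Prop :=
  forall x, L x -> exists k : int, dotp x x = (2 * k)%:~R.

Definition lattice_roots (R : realType) (n : nat) (L : set 'cV[R]_n) :
    set 'cV[R]_n :=
  [set x | L x /\ dotp x x = 2].

Definition gaussian (R : realType) (alpha r : R) : R := expR (- (alpha * r)).

(* Summation over a countable set of nonnegative terms, with values in
   [0, +oo]; the argument Y stands for the lattice obtained from L by replacing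
   the standard inner product by the one with Gram matrix Y. *)
Definition gaussian_energy (R : realType) (n : nat) (alpha : R)
    (L : set 'cV[R]_n) (Y : 'M[R]_n) : \bar R :=
  \esum_(x in L `\ 0) (gaussian alpha (qform Y x))%:E.

Definition posdef_det1 (R : realType) (n : nat) : set 'M[R]_n :=
  [set Y | [/\ Y^T = Y, forall x, x != 0 -> 0 < qform Y x & \det Y = 1]].

(* The lattice L is assumed to have density 1 (automatic when it is
   unimodular), so that posdef_det1 parametrizes the lattices of density 1,
   with L at Y = 1. *)
Definition energy_local_max (R : realType) (n : nat) (alpha : R)
    (L : set 'cV[R]_n) : Prop :=
  \forall Y \near within (@posdef_det1 R n) (nbhs (1%:M : 'M[R]_n)),
    (gaussian_energy alpha L Y <= gaussian_energy alpha L 1%:M)%E.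

(* Main.v *)
(** Write [Y = 1 + K] and put [eta x = pi^2 (x^T K x)^2], [kap x = pi |K x|^2],
    [tau = tr (K^2)], [X x = pi |x|^2].  Poisson summation on [L = L^*],
      [t^16 sum_x e^(-t X x) cos (2 pi b.x) = sum_x e^(- pi |x - b|^2 / t)],
    expanded to fourth order in [b] and differentiated any number of times in
    [log t] at [t = 1], gives by parity linear relations between the sums
    [sum_x P x * p (X x) * e^(- X x)], [P] of degree at most 4 and [p] a
    polynomial.  The simplest one, [pi sum_x x^T K x e^(- X x) = tr K / 4 * sum_x e^(- X x)],
    together with [tr K = tau / 2 + O(tau^(3/2))], which is [det Y = 1], turns
    the second-order Taylor expansion of the energy at [Y = 1] into
      [E(Y) - E(1) <= 1/2 sum_x (eta x - tau / 4) e^(- X x) + O(tau^(3/2))].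
    A suitable combination of the other relations, found by linear programming,
    replaces the summand [eta - tau / 4] by [eta A(X) + kap B(X) + tau C(X)] with
    polynomials [A], [B], [C] such that this is [<= 0] at every vector with
    [|x|^2 = 4, 6, 8, ...] and is a negative multiple of [tau] at [x = 0];
    hence [E(Y) - E(1) <= - c tau + O(tau^(3/2))].

    Poisson summation on the line is obtained by Polya's method: the discrete
    Fourier expansion of a power of the cosine becomes, in the limit, the theta
    transformation.  In higher dimension it follows by splitting off one
    coordinate with a Schur complement. *)

Require Import Defs.
From Stdlib Require Import ZArith.
From HB Require Import structures.
From mathcomp Require Import all_boot all_order all_algebra.
From mathcomp Require Import all_classical all_reals all_analysis.
From mathcomp Require Import ring lra ssrZ zify.
Import Order.TTheory GRing.Theory Num.Theory numFieldNormedType.Exports.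
Set Implicit Arguments.
Unset Strict Implicit.
Unset Printing Implicit Defensive.
Local Open Scope classical_set_scope.
Local Open Scope ring_scope.

(** * Unconditional sums of real functions *)

HB.lock Definition rsum (R : realType) (T : choiceType) (f : T -> R) : R :=
  fine (\esum_(x in [set: T]) (Num.max (f x) 0)%:E) -
  fine (\esum_(x in [set: T]) (Num.max (- f x) 0)%:E).

Section RealSums.
Variable R : realType.
Implicit Types T : choiceType.

Definition rsummable T (f : T -> R) : Prop :=
  (\esum_(x in [set: T]) `|f x|%:E < +oo)%E.

Lemma rsummable_le T (f g : T -> R) :
  (forall x, `|f x| <= g x) -> rsummable g -> rsummable f.
Proof.
move=> fg; apply: le_lt_trans; apply: le_esum => x _.
by rewrite lee_fin (le_trans (fg x)) ?ler_norm.
Qed.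

Lemma rsummableD T (f g : T -> R) :
  rsummable f -> rsummable g -> rsummable (fun x => f x + g x).
Proof.
move=> sf sg; apply: le_lt_trans (lte_add_pinfty sf sg).
rewrite -esumD//.
by apply: le_esum => x _; rewrite -EFinD lee_fin ler_normD.
Qed.

Lemma rsummableN T (f : T -> R) : rsummable f -> rsummable (fun x => - f x).
Proof. by rewrite /rsummable; under [X in _ -> (X < _)%E]eq_esum do rewrite normrN. Qed.

Lemma rsummableB T (f g : T -> R) :
  rsummable f -> rsummable g -> rsummable (fun x => f x - g x).
Proof. by move=> sf sg; apply: rsummableD => //; exact: rsummableN. Qed.

Lemma rsummable_norm T (f : T -> R) : rsummable f -> rsummable (fun x => `|f x|).
Proof. by rewrite /rsummable; under [X in _ -> (X < _)%E]eq_esum do rewrite normr_id. Qed.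

Lemma esum_fin T (f : T -> R) : (forall x, 0 <= f x) -> rsummable f ->
  (\esum_(x in [set: T]) (f x)%:E)%E \is a fin_num.
Proof.
move=> f0 sf; rewrite ge0_fin_numE; last by apply: esum_ge0 => x _; rewrite lee_fin.
by apply: le_lt_trans sf; apply: le_esum => x _; rewrite lee_fin ler_norm.
Qed.

Lemma rsum_ge0E T (f : T -> R) : (forall x, 0 <= f x) ->
  rsum f = fine (\esum_(x in [set: T]) (f x)%:E).
Proof.
move=> f0; rewrite rsum.unlock [X in _ - fine X]esum1 ?subr0.
  by congr fine; apply: eq_esum => x _; congr EFin; apply/max_idPl.
by move=> x _; congr EFin; apply/max_idPr; rewrite oppr_le0.
Qed.

Lemma rsum_esum T (f : T -> R) : (forall x, 0 <= f x) -> rsummable f ->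
  (rsum f)%:E = (\esum_(x in [set: T]) (f x)%:E)%E.
Proof. by move=> f0 sf; rewrite rsum_ge0E// fineK// esum_fin. Qed.

Lemma rsum_ge0D T (f g : T -> R) : (forall x, 0 <= f x) -> (forall x, 0 <= g x) ->
  rsummable f -> rsummable g -> rsum (fun x => f x + g x) = rsum f + rsum g.
Proof.
move=> f0 g0 sf sg; apply: EFin_inj; rewrite EFinD !rsum_esum//.
- by rewrite -esumD// => x _; rewrite lee_fin.
- by move=> x; rewrite addr_ge0.
- exact: rsummableD.
Qed.

Let pos T (f : T -> R) x : R := Num.max (f x) 0.
Let neg T (f : T -> R) x : R := Num.max (- f x) 0.

Let rsumE T (f : T -> R) : rsum f = rsum (pos f) - rsum (neg f).
Proof. by rewrite ![in RHS]rsum_ge0E ?rsum.unlock// => x; rewrite le_max lexx orbT. Qed.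

Let pos_ge0 T (f : T -> R) x : 0 <= pos f x. Proof. by rewrite le_max lexx orbT. Qed.
Let neg_ge0 T (f : T -> R) x : 0 <= neg f x. Proof. by rewrite le_max lexx orbT. Qed.

Let posneg T (f : T -> R) x : f x = pos f x - neg f x.
Proof. by rewrite /pos /neg; case: (leP (f x)) => h; case: (leP (- f x)) => h'; lra. Qed.

Let pos_sum T (f : T -> R) : rsummable f -> rsummable (pos f).
Proof.
move=> sf; apply: rsummable_le (rsummable_norm sf) => x.
by rewrite ger0_norm// ge_max normr_ge0 ler_norm.
Qed.
Let neg_sum T (f : T -> R) : rsummable f -> rsummable (neg f).
Proof.
move=> sf; apply: rsummable_le (rsummable_norm sf) => x.
by rewrite ger0_norm// ge_max normr_ge0 -normrN ler_norm.
Qed.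

Lemma rsum_ge0B T (g h : T -> R) : (forall x, 0 <= g x) -> (forall x, 0 <= h x) ->
  rsummable g -> rsummable h -> rsum (fun x => g x - h x) = rsum g - rsum h.
Proof.
move=> g0 h0 sg sh; set f := fun x => _.
have sf : rsummable f by exact: rsummableB.
have : rsum (pos f) + rsum h = rsum (neg f) + rsum g.
  rewrite -!rsum_ge0D//; [|exact: neg_sum|exact: pos_sum].
  congr rsum; apply/funext => x; have := posneg f x; have : f x = g x - h x by [].
  move: (f x) (pos f x) (neg f x) (g x) (h x) => a b c d e h1 h2; lra.
by rewrite (rsumE f); lra.
Qed.

Lemma rsumD T (f g : T -> R) : rsummable f -> rsummable g ->
  rsum (fun x => f x + g x) = rsum f + rsum g.
Proof.
move=> sf sg; rewrite (rsumE f) (rsumE g).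
have -> : (fun x => f x + g x) =
    (fun x => (pos f x + pos g x) - (neg f x + neg g x)).
  by apply/funext => x; rewrite {1}(posneg f) {1}(posneg g); lra.
have [pf nf pg ng] := And4 (pos_sum sf) (neg_sum sf) (pos_sum sg) (neg_sum sg).
rewrite rsum_ge0B.
- by rewrite (rsum_ge0D (pos_ge0 f) (pos_ge0 g) pf pg)
    (rsum_ge0D (neg_ge0 f) (neg_ge0 g) nf ng); lra.
- by move=> x; exact: addr_ge0.
- by move=> x; exact: addr_ge0.
- exact: (rsummableD pf pg).
- exact: (rsummableD nf ng).
Qed.

Lemma rsumN T (f : T -> R) : rsum (fun x => - f x) = - rsum f.
Proof.
rewrite rsum.unlock opprB; congr (_ - fine _).
by apply: eq_esum => x _; rewrite opprK.
Qed.

Lemma rsumB T (f g : T -> R) : rsummable f -> rsummable g ->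
  rsum (fun x => f x - g x) = rsum f - rsum g.
Proof. by move=> sf sg; rewrite rsumD ?rsumN//; exact: rsummableN. Qed.

Lemma rsum_ge0 T (f : T -> R) : (forall x, 0 <= f x) -> 0 <= rsum f.
Proof.
move=> f0; rewrite rsum_ge0E// fine_ge0//; apply: esum_ge0 => x _.
by rewrite lee_fin.
Qed.

Lemma ler_rsum T (f g : T -> R) : rsummable f -> rsummable g ->
  (forall x, f x <= g x) -> rsum f <= rsum g.
Proof.
by move=> sf sg fg; rewrite -subr_ge0 -rsumB// rsum_ge0// => x; rewrite subr_ge0.
Qed.

Lemma ler_norm_rsum T (f : T -> R) : rsummable f ->
  `|rsum f| <= rsum (fun x => `|f x|).
Proof.
move=> sf; have sn := rsummable_norm sf.
rewrite ler_norml lerNl -rsumN; apply/andP; split; apply: ler_rsum => //.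
- exact: rsummableN.
- by move=> x; rewrite -normrN ler_norm.
- by move=> x; exact: ler_norm.
Qed.

Let esumZ T (c : R) (f : T -> R) : 0 < c -> (forall x, 0 <= f x) ->
  (\esum_(x in [set: T]) (c * f x)%:E <= c%:E * \esum_(x in [set: T]) (f x)%:E)%E.
Proof.
move=> c0 f0; apply: ge_ereal_sup => _ [X [finX _] <-].
under eq_fsbigr do rewrite EFinM.
rewrite -ge0_mule_fsumr; last by move=> x; rewrite lee_fin.
rewrite lee_pmul2l ?fin_numElt ?ltNyr ?ltry//.
by apply: ereal_sup_ubound; exists X.
Qed.

Lemma rsummableZ T (c : R) (f : T -> R) : rsummable f -> rsummable (fun x => c * f x).
Proof.
move=> sf; have [->|c0] := eqVneq c 0.
  by rewrite /rsummable esum1 ?ltry// => x _; rewrite mul0r normr0.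
rewrite /rsummable; under eq_esum do rewrite normrM.
apply: le_lt_trans (esumZ _ _) _; rewrite ?normr_gt0//.
by rewrite lte_mul_pinfty ?lee_fin.
Qed.

Let rsumZ_ge0 T (c : R) (f : T -> R) : 0 < c -> (forall x, 0 <= f x) -> rsummable f ->
  rsum (fun x => c * f x) = c * rsum f.
Proof.
move=> c0 f0 sf; have H d (g : T -> R) : 0 < d -> (forall x, 0 <= g x) -> rsummable g ->
    rsum (fun x => d * g x) <= d * rsum g.
  move=> d0 g0 sg; rewrite -lee_fin EFinM !rsum_esum//; first exact: esumZ.
    by move=> x; rewrite mulr_ge0// ltW.
  exact: rsummableZ.
apply/eqP; rewrite eq_le H//=.
have := H c^-1 (fun x => c * f x).
under [X in rsum X <= _]eq_fun do rewrite mulKf ?gt_eqF//.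
rewrite ler_pdivlMl//; apply; rewrite ?invr_gt0//; last exact: rsummableZ.
by move=> x; rewrite mulr_ge0// ltW.
Qed.

Lemma rsumZ T (c : R) (f : T -> R) : rsummable f ->
  rsum (fun x => c * f x) = c * rsum f.
Proof.
move=> sf; have H d : 0 < d -> rsum (fun x => d * f x) = d * rsum f.
  move=> d0; have -> : (fun x => d * f x) = (fun x => d * pos f x - d * neg f x).
    by apply/funext => x; rewrite {1}(posneg f); lra.
  have sp := pos_sum sf; have sn := neg_sum sf.
  rewrite rsumB; [|exact: rsummableZ|exact: rsummableZ].
  by rewrite !rsumZ_ge0// (rsumE f) mulrBr.
have [c0|c0|->] := ltrgt0P c; first exact: H.
  have <- : - rsum (fun x => - c * f x) = c * rsum f by rewrite H ?oppr_gt0//; lra.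
  by rewrite -rsumN; congr rsum; apply/funext => x; lra.
rewrite mul0r rsum_ge0E; last by move=> x; rewrite mul0r.
by rewrite esum1// => x _; rewrite mul0r.
Qed.

Lemma rsummable_eq0 T (f : T -> R) : (forall x, f x = 0) -> rsummable f.
Proof. by move=> f0; rewrite /rsummable esum1 ?ltry// => x _; rewrite f0 normr0. Qed.

Let esum_support T (D : set T) (a : T -> \bar R) : (forall x, ~ D x -> a x = 0%E) ->
  (\esum_(x in [set: T]) a x = \esum_(x in D) a x)%E.
Proof.
move=> a0; rewrite [RHS]esum_mkcond; apply: eq_esum => x _.
by case: ifPn => // /negP xD; apply: a0 => Dx; apply: xD; rewrite inE.
Qed.

Lemma rsummable_fin T (s : seq T) (f : T -> R) :
  (forall x, x \notin s -> f x = 0) -> rsummable f.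
Proof.
move=> f0; rewrite /rsummable (@esum_support _ [set` s]); last first.
  by move=> x /= /negP xs; rewrite f0// normr0.
rewrite esum_fset; [|exact: finite_seq|by move=> x _; rewrite lee_fin].
by rewrite fsumEFin; [rewrite ltry|exact: finite_seq].
Qed.

Lemma rsum_fin T (s : seq T) (f : T -> R) : uniq s ->
  (forall x, x \notin s -> f x = 0) -> rsum f = \sum_(x <- s) f x.
Proof.
move=> us f0; rewrite rsum.unlock.
have H (h : R -> R) : h 0 = 0 -> (forall x, 0 <= h x) ->
    fine (\esum_(x in [set: T]) (h (f x))%:E) = \sum_(x <- s) h (f x).
  move=> h0 hp; rewrite (@esum_support _ [set` s]); last first.
    by move=> x /= /negP xs; rewrite f0// h0.
  rewrite esum_fset; [|exact: finite_seq|by move=> x _; rewrite lee_fin].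
  by rewrite -fsbig_seq// sumEFin.
rewrite (H (fun z => Num.max z 0)) ?(H (fun z => Num.max (- z) 0)).
- rewrite -sumrB; apply: eq_bigr => x _.
  by case: (leP (f x)) => h; case: (leP (- f x)) => h'; lra.
- by rewrite oppr0 maxxx.
- by move=> x; rewrite le_max lexx orbT.
- by rewrite maxxx.
- by move=> x; rewrite le_max lexx orbT.
Qed.

Let esum_reindex_inj T T' (e : T -> T') (a : T' -> \bar R) : injective e ->
  (forall y, ~ range e y -> a y = 0%E) ->
  (\esum_(x in [set: T']) a x = \esum_(x in [set: T]) a (e x))%E.
Proof.
move=> ei a0; rewrite (esum_support a0) esum_image//.
by move=> x y _ _; exact: ei.
Qed.

Lemma rsum_inj T T' (e : T -> T') (f : T' -> R) : injective e ->
  (forall y, ~ range e y -> f y = 0) -> rsum f = rsum (f \o e).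
Proof.
move=> ei f0; rewrite rsum.unlock; congr (fine _ - fine _);
  rewrite (esum_reindex_inj ei)// => y ye; rewrite f0// ?oppr0 ?maxxx//.
Qed.

Let notin_range_bij T T' (e : T -> T') (P : T' -> Prop) : bijective e ->
  forall y, ~ range e y -> P y.
Proof. by move=> [g ge eg] y []; exists (g y). Qed.

Lemma rsum_bij T T' (e : T -> T') (f : T' -> R) : bijective e ->
  rsum f = rsum (f \o e).
Proof.
by move=> be; apply: rsum_inj; [exact: bij_inj|exact: notin_range_bij].
Qed.

Lemma rsummable_bij T T' (e : T -> T') (f : T' -> R) : bijective e ->
  rsummable (f \o e) -> rsummable f.
Proof.
move=> be; rewrite /rsummable (@esum_reindex_inj _ _ e)//; first exact: bij_inj.
exact: notin_range_bij.
Qed.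

Lemma rsummable_inj T T' (e : T -> T') (f : T' -> R) : injective e ->
  rsummable f -> rsummable (f \o e).
Proof.
move=> ei; rewrite /rsummable; apply: le_lt_trans.
pose a (y : T') := `|f y|%:E.
have -> : \esum_(x in [set: T]) `|(f \o e) x|%:E = \esum_(x in [set: T]) a (e x) by [].
rewrite -(@esum_image R T T' setT e a); last by move=> x y _ _; exact: ei.
by rewrite esum_mkcond; apply: le_esum => x _; case: ifP.
Qed.

Let setTX T1 T2 : [set: T1] `*`` (fun=> [set: T2]) = [set: T1 * T2].
Proof. by apply/seteqP; split => // -[]. Qed.

Let fubini_ge0 T1 T2 (f : T1 * T2 -> R) : (forall p, 0 <= f p) ->
  (\esum_(x in [set: T1]) \esum_(y in [set: T2]) (f (x, y))%:E =
   \esum_(p in [set: T1 * T2]) (f p)%:E)%E.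
Proof.
move=> f0; rewrite (@esum_esum _ _ _ setT (fun=> setT) (fun x y => (f (x, y))%:E)).
  by rewrite setTX; apply: eq_esum => -[].
by move=> *; rewrite lee_fin.
Qed.

Lemma rsummable_pair T1 T2 (f : T1 * T2 -> R) :
  (forall x, rsummable (fun y => f (x, y))) ->
  rsummable (fun x => rsum (fun y => `|f (x, y)|)) -> rsummable f.
Proof.
move=> s1 s2; rewrite /rsummable -(fubini_ge0 (f := fun p => `|f p|))//.
move: s2; rewrite /rsummable; congr (_ < _)%E; apply: eq_esum => x _.
rewrite ger0_norm; last exact: rsum_ge0.
by rewrite rsum_esum//; exact: rsummable_norm.
Qed.

Lemma rsummable_pairl T1 T2 (f : T1 * T2 -> R) x : rsummable f ->
  rsummable (fun y => f (x, y)).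
Proof. by move=> sf; apply: (@rsummable_inj _ _ (pair x) f) => // y z []. Qed.

Lemma rsummable_rsum T1 T2 (f : T1 * T2 -> R) : rsummable f ->
  rsummable (fun x => rsum (fun y => f (x, y))).
Proof.
move=> sf; apply: (@rsummable_le _ _ (fun x => rsum (fun y => `|f (x, y)|))).
  by move=> x; apply: ler_norm_rsum; exact: rsummable_pairl.
move: (sf); rewrite /rsummable -(fubini_ge0 (f := fun p => `|f p|))//.
apply: le_lt_trans; apply: le_esum => x _.
rewrite ger0_norm; last exact: rsum_ge0.
by rewrite rsum_esum//; apply: rsummable_norm; exact: rsummable_pairl.
Qed.

Let rsum_pair_ge0 T1 T2 (f : T1 * T2 -> R) : (forall p, 0 <= f p) -> rsummable f ->
  rsum f = rsum (fun x => rsum (fun y => f (x, y))).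
Proof.
move=> f0 sf; apply: EFin_inj; rewrite !rsum_esum//.
- rewrite -fubini_ge0//; apply: eq_esum => x _.
  by rewrite rsum_esum//; exact: rsummable_pairl.
- by move=> x; exact: rsum_ge0.
- exact: rsummable_rsum.
Qed.

Lemma rsum_pair T1 T2 (f : T1 * T2 -> R) : rsummable f ->
  rsum f = rsum (fun x => rsum (fun y => f (x, y))).
Proof.
move=> sf; have sp := pos_sum sf; have sn := neg_sum sf.
rewrite rsumE (rsum_pair_ge0 (pos_ge0 f) sp) (rsum_pair_ge0 (neg_ge0 f) sn).
rewrite -(rsumB (rsummable_rsum sp) (rsummable_rsum sn)).
congr rsum; apply/funext => x.
by rewrite [in RHS]rsumE.
Qed.

Lemma rsum_swap T1 T2 (f : T1 -> T2 -> R) : rsummable (fun p => f p.1 p.2) ->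
  rsum (fun x => rsum (f x)) = rsum (fun y => rsum (f ^~ y)).
Proof.
move=> sf; rewrite -(rsum_pair (f := fun p => f p.1 p.2))//.
have sw : bijective (fun p : T2 * T1 => (p.2, p.1)).
  by exists (fun p : T1 * T2 => (p.2, p.1)) => -[].
rewrite (rsum_bij _ sw) rsum_pair//.
exact: (@rsummable_inj _ _ _ (fun p => f p.1 p.2) (bij_inj sw)).
Qed.

Lemma rsum_approx T (g : T -> R) (e : R) : (forall x, 0 <= g x) -> rsummable g -> 0 < e ->
  exists2 s : seq T, uniq s & rsum g - \sum_(x <- s) g x < e.
Proof.
move=> g0 sg e0; have gfin := esum_fin g0 sg.
have [_ [X [finX _] <-]] := ub_ereal_sup_adherent e0 gfin.
rewrite -[ereal_sup _]/(esum _ _) -rsum_esum// fsumEFin// -EFinB lte_fin => h.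
exists (finmap.enum_fset (fset_set X)); first exact: finmap.fset_uniq.
by move: h; rewrite fsbig_finite//; lra.
Qed.

Lemma cvg_sum_seq (U : Type) (F : set_system U) {FF : Filter F} T (s : seq T)
    (f : U -> T -> R) (l : T -> R) : (forall x, f ^~ x @ F --> l x) ->
  (fun u => \sum_(x <- s) f u x) @ F --> \sum_(x <- s) l x.
Proof.
move=> fl; elim: s => [|x s IH].
  by under eq_fun do rewrite big_nil; rewrite big_nil; exact: cvg_cst.
by under eq_fun do rewrite big_cons; rewrite big_cons; exact: cvgD.
Qed.

Lemma rsum_dominated_cvg (U : Type) (F : set_system U) {FF : Filter F} T
    (f : U -> T -> R) (l g : T -> R) : rsummable g ->
  (forall x, f ^~ x @ F --> l x) ->
  (\forall u \near F, forall x, `|f u x| <= g x) ->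
  (forall x, `|l x| <= g x) ->
  (fun u => rsum (f u)) @ F --> rsum l.
Proof.
move=> sg fl fg lg; apply/cvgrPdist_lt => e e0.
have g0 x : 0 <= g x by exact: le_trans (lg x).
have e40 : 0 < e / 4 by lra.
have [s us hs] := rsum_approx g0 sg e40.
have : \forall u \near F, \sum_(x <- s) `|l x - f u x| < e / 4.
  have : (fun u => \sum_(x <- s) `|l x - f u x|) @ F --> \sum_(x <- s) (0 : R).
    apply: cvg_sum_seq => x; rewrite -(normr0 R) -(subrr (l x)).
    by apply: cvg_norm; apply: cvgB; [exact: cvg_cst|exact: fl].
  rewrite big1// => /cvgrPdist_lt/(_ _ e40); apply: filterS => u.
  by rewrite sub0r normrN ger0_norm// sumr_ge0.
move: fg; apply: filterS2 => u fg hu.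
have sl : rsummable l by exact: rsummable_le lg sg.
have sf : rsummable (f u) by exact: rsummable_le fg sg.
rewrite -rsumB//; apply: le_lt_trans (ler_norm_rsum (rsummableB sl sf)) _.
pose ind x : R := (x \in s)%:R.
pose h x := ind x * `|l x - f u x|.
pose g' x := g x - ind x * g x.
have sh : rsummable h by apply: (@rsummable_fin _ s) => x xs; rewrite /h /ind (negbTE xs) mul0r.
have sig : rsummable (fun x => ind x * g x).
  by apply: (@rsummable_fin _ s) => x xs; rewrite /ind (negbTE xs) mul0r.
have sg' : rsummable g' by exact: rsummableB.
have : rsum (fun x => `|l x - f u x|) <= rsum (fun x => h x + 2 * g' x).
  apply: ler_rsum.
  - by apply: rsummable_norm; exact: rsummableB.
  - by apply: rsummableD => //; exact: rsummableZ.
  - move=> x; rewrite /h /g' /ind; have := fg x; have := lg x.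
    have := ler_normB (l x) (f u x); have := normr_ge0 (l x - f u x).
    by case: (x \in s); rewrite ?mul1r ?mul0r ?subrr ?mulr0 ?addr0 ?add0r ?subr0 //; lra.
rewrite rsumD//; last exact: rsummableZ.
rewrite rsumZ// /g' rsumB// (rsum_fin us (f := h)); last first.
  by move=> x xs; rewrite /h /ind (negbTE xs) mul0r.
rewrite (rsum_fin us (f := fun x => ind x * g x)); last first.
  by move=> x xs; rewrite /ind (negbTE xs) mul0r.
rewrite (eq_big_seq (fun x => `|l x - f u x|)); last first.
  by move=> x xs; rewrite /h /ind xs mul1r.
rewrite [X in _ - X](eq_big_seq g); last by move=> x xs; rewrite /ind xs mul1r.
lra.
Qed.

End RealSums.

(** * Bounds for sine, cosine and pi *)

Section TaylorBounds.
Variable R : realType.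
Implicit Types x : R.

Lemma ge0_derive_ge0 (f df : R -> R) : (forall x, is_derive x 1 f (df x)) ->
  0 <= f 0 -> (forall x, 0 <= x -> 0 <= df x) -> forall x, 0 <= x -> 0 <= f x.
Proof.
move=> fd f0 df0 x; rewrite le_eqVlt => /predU1P[<-//|x0].
have fc : {within `[0, x], continuous f}.
  apply: derivable_within_continuous => y _.
  by have /@ex_derive := fd y.
have [c] := MVT x0 (fun y _ => fd y) fc.
rewrite in_itv /= => /andP[c0 _] e.
rewrite -[f x](subrK (f 0)) e addr_ge0// mulr_ge0//; last by lra.
by apply: df0; exact: ltW.
Qed.

Lemma derive_le (f g df dg : R -> R) : (forall x, 0 <= x -> df x <= dg x) ->
  (forall x, is_derive x 1 f (df x)) -> (forall x, is_derive x 1 g (dg x)) ->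
  f 0 = g 0 -> forall x, 0 <= x -> f x <= g x.
Proof.
move=> dfg fd gd fg0 x x0; rewrite -subr_ge0.
apply: (ge0_derive_ge0 (f := fun x => g x - f x) (df := fun x => dg x - df x)) => //.
  by rewrite fg0 subrr.
by move=> y /dfg; rewrite subr_ge0.
Qed.

Lemma derive_ge (f g df dg : R -> R) : (forall x, 0 <= x -> dg x <= df x) ->
  (forall x, is_derive x 1 f (- df x)) -> (forall x, is_derive x 1 g (- dg x)) ->
  f 0 = g 0 -> forall x, 0 <= x -> f x <= g x.
Proof. by move=> dfg; apply: derive_le => x /dfg; rewrite lerN2. Qed.

Local Ltac taylor_side :=
  first [apply: is_derive_eq; rewrite /GRing.scale /=; field | rewrite ?cos0 ?sin0; field].

Lemma sin_le_id x : 0 <= x -> sin x <= x.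
Proof. by move: x; apply: (derive_le (fun x _ => cos_le1 x)) => *; taylor_side. Qed.

Lemma cos_ge_T2 x : 0 <= x -> 1 - x ^+ 2 / 2 <= cos x.
Proof. by move: x; apply: (derive_ge sin_le_id) => *; taylor_side. Qed.

Lemma sin_ge_T3 x : 0 <= x -> x - x ^+ 3 / 6 <= sin x.
Proof. by move: x; apply: (derive_le cos_ge_T2) => *; taylor_side. Qed.

Lemma cos_le_T4 x : 0 <= x -> cos x <= 1 - x ^+ 2 / 2 + x ^+ 4 / 24.
Proof. by move: x; apply: (derive_ge sin_ge_T3) => *; taylor_side. Qed.

Lemma sin_le_T5 x : 0 <= x -> sin x <= x - x ^+ 3 / 6 + x ^+ 5 / 120.
Proof. by move: x; apply: (derive_le cos_le_T4) => *; taylor_side. Qed.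

Lemma cos_ge_T6 x : 0 <= x -> 1 - x ^+ 2 / 2 + x ^+ 4 / 24 - x ^+ 6 / (6 * 120) <= cos x.
Proof. by move: x; apply: (derive_ge sin_le_T5) => *; taylor_side. Qed.

Lemma sin_ge_T7 x : 0 <= x -> x - x ^+ 3 / 6 + x ^+ 5 / 120 - x ^+ 7 / (42 * 120) <= sin x.
Proof. by move: x; apply: (derive_le cos_ge_T6) => *; taylor_side. Qed.

Lemma sin_pi6 : sin (pi / 6 : R) = 1 / 2.
Proof.
have p0 := @pi_gt0 R; set y : R := pi / 6.
have c0 : 0 < cos y by apply: cos_gt0_pihalf; rewrite /y; lra.
have s0 : 0 < sin y by apply: sin_gt0_pi; rewrite /y; lra.
have : cos (y + (y + y)) = 0 by rewrite -(cos_pihalf R) /y; congr cos; field.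
rewrite cosD cosD sinD => h; have := cos2Dsin2 y.
have : cos y * (cos y ^+ 2 - 3 * sin y ^+ 2) = 0 by rewrite -h; ring.
move=> /eqP; rewrite mulf_eq0 (gt_eqF c0) /= => /eqP e1 e2.
have /eqP : (sin y - 1 / 2) * (sin y + 1 / 2) = 0 by nra.
by rewrite mulf_eq0 => /orP[|] /eqP; lra.
Qed.

Lemma pi_bounds : 333 / 106 < (pi : R) < 377 / 120.
Proof.
have p4 : (pi : R) < 4 by have := @pihalf_lt2 R; lra.
have p2 := @pi_ge2 R; apply/andP; split; rewrite ltNge; apply/negP => h.
  have : sin (pi / 6 : R) <= sin (333 / 636).
    by rewrite leNgt ltr_sin ?in_itv /= -?leNgt; lra.
  apply/negP; rewrite -ltNge sin_pi6; apply: le_lt_trans (sin_le_T5 _) _; lra.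
have : sin (377 / 720) <= sin (pi / 6 : R).
  by rewrite leNgt ltr_sin ?in_itv /= -?leNgt; lra.
apply/negP; rewrite -ltNge sin_pi6; apply: lt_le_trans (sin_ge_T7 _); lra.
Qed.

End TaylorBounds.

Section GaussianInt.
Variable R : realType.

Lemma rsummable_geometric_nat (q : R) : 0 <= q < 1 -> rsummable (fun n : nat => q ^+ n).
Proof.
move=> /andP[q0 q1]; rewrite /rsummable -nneseries_esumT//.
apply: (@le_lt_trans _ _ (1 - q)^-1%:E); last by rewrite ltry.
apply: lime_le; first by apply: is_cvg_nneseries => n _ _; rewrite lee_fin.
apply: nearW => n; rewrite sumEFin lee_fin.
under eq_bigr do rewrite normrX ger0_norm//.
have -> : \sum_(0 <= i < n) q ^+ i = (1 - q ^+ n) / (1 - q).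
  apply: (mulIf (x := 1 - q)); first by lra.
  rewrite mulfVK ?subr_eq0; last by lra.
  by rewrite mulrC big_mkord -opprB -[1 - q ^+ n]opprB subrX1 mulNr.
by rewrite ler_piMl ?invr_ge0 ?subr_ge0 ?(ltW q1)// gerBl exprn_ge0.
Qed.

Lemma rsummable_geometric_int (q : R) : 0 <= q < 1 -> rsummable (fun n : int => q ^+ `|n|%N).
Proof.
move=> q01; have sq := rsummable_geometric_nat q01.
pose e (p : nat + nat) : int := match p with inl n => Posz n | inr n => Negz n end.
have be : bijective e.
  by exists (fun z => match z with Posz n => inl n | Negz n => inr n end); case.
apply: (rsummable_bij be).
rewrite /rsummable (esumID (range inl))//.
rewrite !setTI; apply: lte_add_pinfty.
  by rewrite esum_image// => x y _ _ [].
have -> : ~` range inl = range inr :> set (nat + nat).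
  apply/seteqP; split => [[n|n] //= h|_ [n _ <-] [m _]//]; last by exists n.
  by case: h; exists n.
rewrite esum_image//; last by move=> x y _ _ [].
have [q0 q1] := andP q01.
apply: le_lt_trans sq; apply: le_esum => n _ /=.
by rewrite lee_fin exprS normrM ler_piMl ?normr_ge0// ger0_norm// ltW.
Qed.

Lemma sqr_shift_ge (a x : R) : x ^+ 2 / 2 - a ^+ 2 <= (x + a) ^+ 2.
Proof. by have := sqr_ge0 (x + 2 * a); rewrite !expr2; lra. Qed.

Lemma absz_le_sqr (n : int) : `|n|%N%:R <= n%:~R ^+ 2 :> R.
Proof.
have -> : n%:~R ^+ 2 = `|n|%N%:R ^+ 2 :> R.
  by rewrite natr_absz intr_norm real_normK ?num_real.
by rewrite -natrX ler_nat; case: `|n|%N => // k; rewrite expnS expn1 leq_pmulr.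
Qed.

Definition gterm (c a : R) (n : int) : R := expR (- (c * (n%:~R + a) ^+ 2)).

Lemma gterm_le c a n : 0 < c ->
  gterm c a n <= expR (c * a ^+ 2) * expR (- (c / 2)) ^+ `|n|%N.
Proof.
move=> c0; rewrite -expRM_natr -expRD ler_expR.
have := sqr_shift_ge a n%:~R; have := absz_le_sqr n.
set u := `|n|%N%:R; set v := n%:~R => h1 h2.
have h3 : c * (u / 2 - a ^+ 2) <= c * (v + a) ^+ 2 by rewrite ler_pM2l//; lra.
lra.
Qed.

Lemma rsummable_gterm c a : 0 < c -> rsummable (gterm c a).
Proof.
move=> c0; apply: (@rsummable_le _ _ _
    (fun n => expR (c * a ^+ 2) * expR (- (c / 2)) ^+ `|n|%N)).
  by move=> n; rewrite ger0_norm ?expR_ge0// gterm_le.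
apply: rsummableZ; apply: rsummable_geometric_int.
by rewrite expR_ge0 expR_lt1; lra.
Qed.

Lemma bij_addz (k : int) : bijective (fun n : int => n + k).
Proof. by exists (fun n => n - k) => n; rewrite ?addrK ?subrK. Qed.

Lemma rsum_gterm_bounded c : 0 < c -> exists M : R, forall a, rsum (gterm c a) <= M.
Proof.
move=> c0; pose g (n : int) := expR c * expR (- (c / 2)) ^+ `|n|%N.
have sg : rsummable g.
  by apply: rsummableZ; apply: rsummable_geometric_int; rewrite expR_ge0 expR_lt1; lra.
exists (rsum g) => a; rewrite (rsum_bij _ (bij_addz (- Num.floor a))).
have := floor_itv a; set r := a - (Num.floor a)%:~R => /andP[h1 h2].
have -> : gterm c a \o (fun n => n + - Num.floor a) = gterm c r.
  by apply/funext => n; rewrite /gterm /= rmorphD rmorphN /= /r; congr (expR (- (c * _ ^+ 2))); ring.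
apply: ler_rsum => //; first exact: rsummable_gterm.
move=> n; apply: le_trans (gterm_le _ _ c0) _.
rewrite ler_wpM2r ?exprn_ge0 ?expR_ge0// ler_expR.
rewrite -[leRHS]mulr1 ler_pM2l// expr_le1 ?subr_ge0//.
by rewrite /r; move: h2; rewrite intrD; lra.
Qed.

End GaussianInt.

(** * Poisson summation on the line *)

Section Polya.
Variable R : realType.
Local Notation pi := (@pi R).

Lemma cosD2pi_int (x : R) (n : int) : cos (x + 2 * pi * n%:~R) = cos x.
Proof.
have H (y : R) (k : nat) : cos (y + 2 * pi * k%:R) = cos y.
  have -> : 2 * pi * k%:R = (pi *+ 2) *+ k by rewrite mulr_natr mulr2n mulrDl mul1r.
  exact: (periodicn (@cosD2pi R)).
case: n => k; first exact: H.
by rewrite -(H _ k.+1) NegzE rmorphN /=; congr cos; ring.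
Qed.

Lemma cos_pow_expand n (t u : R) : (2 * cos t) ^+ n * cos u =
  \sum_(i < n.+1) 'C(n, i)%:R * cos ((2 * i%:R - n%:R) * t + u).
Proof.
elim: n u => [|n IH] u.
  by rewrite big_ord_recl big_ord0 /= bin0 expr0 mulr0 subrr mul0r add0r addr0.
have -> : (2 * cos t) ^+ n.+1 * cos u =
    (2 * cos t) ^+ n * cos (u + t) + (2 * cos t) ^+ n * cos (u - t).
  by rewrite cosD cosB exprS; ring.
rewrite !IH; set c := fun i : nat => cos ((2 * i%:R - n.+1%:R) * t + u).
have -> : \sum_(i < n.+1) 'C(n, i)%:R * cos ((2 * i%:R - n%:R) * t + (u + t)) =
    \sum_(i < n.+1) 'C(n, i)%:R * c i.+1.
  by apply: eq_bigr => i _; congr (_ * cos _); rewrite -!natr1; ring.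
have -> : \sum_(i < n.+1) 'C(n, i)%:R * cos ((2 * i%:R - n%:R) * t + (u - t)) =
    \sum_(i < n.+1) 'C(n, i)%:R * c i.
  by apply: eq_bigr => i _; congr (_ * cos _); rewrite -!natr1; ring.
rewrite [in RHS]big_ord_recl /= -/(c 0%N).
have -> : \sum_(i < n.+1) 'C(n, i)%:R * c i =
    c 0%N + \sum_(i < n.+1) 'C(n, i.+1)%:R * c i.+1.
  rewrite big_ord_recl bin0 mul1r; congr (_ + _).
  by rewrite [in RHS]big_ord_recr /= bin_small// mul0r addr0.
rewrite bin0 mul1r addrCA -big_split /=; congr (_ + _).
by apply: eq_bigr => i _; rewrite -mulrDl -natrD binS addnC.
Qed.

Lemma cos_sum_filter (l : nat) (q : int) (u : R) : (0 < l)%N ->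
  \sum_(j < l) cos (2 * pi * q%:~R * j%:R / l%:R + u) =
  if (l %| q)%Z then l%:R * cos u else 0.
Proof.
move=> l0; have l0' : l%:R != 0 :> R by rewrite pnatr_eq0 -lt0n.
set d := (q %/ l)%Z; set r := (q %% l)%Z.
have qE : q%:~R = d%:~R * l%:R + r%:~R :> R.
  by rewrite {1}(divz_eq q l) intrD intrM.
have -> : \sum_(j < l) cos (2 * pi * q%:~R * j%:R / l%:R + u) =
    \sum_(j < l) cos (2 * pi * r%:~R * j%:R / l%:R + u).
  apply: eq_bigr => j _; rewrite -[RHS](cosD2pi_int _ (d * j)) intrM qE.
  by congr cos; field.
case: ifPn => [/dvdz_mod0P r0|/dvdz_mod0P/eqP r0].
  under eq_bigr do rewrite [r]r0 mulr0 !mul0r add0r.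
  by rewrite sumr_const card_ord mulr_natl.
have r_gt0 : 0 < r by rewrite lt_def r0 modz_ge0// -lt0n.
have r_lt : r < l by apply: ltz_pmod.
set x := pi * r%:~R / l%:R.
have sx : 0 < sin x.
  apply: sin_gt0_pi; rewrite /x divr_gt0 ?mulr_gt0 ?pi_gt0 ?ltr0z ?ltr0n//=.
  by rewrite -mulrA gtr_pMr ?pi_gt0// ltr_pdivrMr ?ltr0n// mul1r -[l%:R]/(l%:~R) ltr_int.
pose s (j : nat) := sin ((2 * j%:R - 1) * x + u).
apply: (mulfI (x := 2 * sin x)); first by rewrite mulf_neq0 ?gt_eqF.
rewrite mulr0 mulr_sumr.
have -> : \sum_(j < l) 2 * sin x * cos (2 * pi * r%:~R * j%:R / l%:R + u) =
    \sum_(0 <= j < l) (s j.+1 - s j).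
  rewrite big_mkord; apply: eq_bigr => j _.
  have -> : 2 * pi * r%:~R * j%:R / l%:R + u = 2 * j%:R * x + u by rewrite /x; field.
  rewrite /s -[j.+1%:R]natr1.
  have -> : (2 * (j%:R + 1) - 1) * x + u = (2 * j%:R * x + u) + x by ring.
  have -> : (2 * j%:R - 1) * x + u = (2 * j%:R * x + u) - x by ring.
  by rewrite sinD sinB; ring.
rewrite telescope_sumr// /s.
have -> : (2 * l%:R - 1) * x + u = (2 * 0%:R - 1) * x + u + 2 * pi * r%:~R.
  by rewrite /x; field.
by rewrite -[X in X - _]cosBpihalf addrAC cosD2pi_int cosBpihalf subrr.
Qed.

Definition binz (m : nat) (k : int) : R := 'C(m.*2, m + `|k|)%:R.

Lemma polya_identity (m L : nat) (p : int) (a f : R) : let l := L.*2.+1 in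
  4 ^+ m * \sum_(i < l) cos (pi * (i%:R - L%:R + a) / l%:R) ^+ m.*2 *
     cos (2 * pi * (p%:~R / l%:R * (i%:R - L%:R + a) + f)) =
  l%:R * rsum (fun r : int => binz m (r * l%:Z - p) * cos (2 * pi * (r%:~R * a + f))).
Proof.
move=> l; have l0 : (0 < l)%N by [].
have l0' : l%:R != 0 :> R by rewrite pnatr_eq0.
pose F (k : int) : R := binz m k *
  (if (l %| (k + p))%Z then cos (2 * pi * (((k + p) %/ l)%Z%:~R * a + f)) else 0).
pose s : seq int := [seq (h%:Z - m%:Z) | h <- iota 0 m.*2.+1].
have us : uniq s by rewrite map_inj_uniq ?iota_uniq// => x y /addIr [].
have Fs (k : int) : k \notin s -> F k = 0.
  move=> ks; rewrite /F /binz bin_small ?mul0r// -addnn ltn_add2l ltnNge.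
  apply: contra ks => km; apply/mapP; exists (absz (k + m%:Z)).
    by rewrite mem_iota /= add0n ltnS -addnn; lia.
  lia.
have -> : rsum (fun r : int => binz m (r * l%:Z - p) * cos (2 * pi * (r%:~R * a + f))) = rsum F.
  rewrite (@rsum_inj _ _ _ (fun r : int => r * l%:Z - p) F).
  - congr rsum; apply/funext => r /=; rewrite /F subrK dvdz_mull//.
    by rewrite mulzK// eqz_nat.
  - by move=> x y /addIr /mulIf; apply; rewrite eqz_nat.
  - move=> y ny; rewrite /F; case: ifPn => [/divzK e|_]; last by rewrite mulr0.
    by exfalso; apply: ny; exists ((y + p) %/ l)%Z => //; rewrite e addrK.
rewrite (rsum_fin us Fs) big_map -[iota _ _]/(index_iota 0 m.*2.+1) big_mkord.
have -> : 4 ^+ m * \sum_(i < l) cos (pi * (i%:R - L%:R + a) / l%:R) ^+ m.*2 *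
     cos (2 * pi * (p%:~R / l%:R * (i%:R - L%:R + a) + f)) =
   \sum_(i < l) \sum_(h < m.*2.+1) 'C(m.*2, h)%:R *
     cos (2 * pi * (h%:Z - m%:Z + p)%:~R * i%:R / l%:R +
       2 * pi * ((h%:Z - m%:Z + p)%:~R / l%:R * (a - L%:R) + f)).
  rewrite mulr_sumr; apply: eq_bigr => i _.
  have -> : 4 ^+ m = 2 ^+ m.*2 :> R by rewrite -muln2 mulnC exprM; congr (_ ^+ _); rewrite -natrX.
  rewrite mulrA -exprMn cos_pow_expand; apply: eq_bigr => h _.
  have -> : m.*2%:R = m%:R + m%:R :> R by rewrite -addnn natrD.
  by congr (_ * cos _); rewrite !intrD rmorphN /=; field.
rewrite exchange_big /= mulr_sumr; apply: eq_bigr => h _.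
rewrite -mulr_sumr cos_sum_filter// mulrCA; congr (_ * _); last first.
  case: ifPn => [/dvdzP[e ->]|_]; last by rewrite mulr0.
  congr (_ * _); rewrite mulzK ?eqz_nat// intrM.
  have NL : (- L%:Z)%:~R = - L%:R :> R by rewrite rmorphN.
  by rewrite -[RHS](cosD2pi_int _ (e * - L%:Z)) intrM NL; congr cos; field.
rewrite /binz; congr (_%:R).
have : (h <= m.*2)%N by rewrite -ltnS.
case: h => h /= _ hm; have [le|lt] := leqP m h.
  by congr ('C(_, _)); rewrite -[LHS](subnKC le); congr (_ + _)%N; lia.
by rewrite -bin_sub//; congr ('C(_, _)); rewrite -addnn; lia.
Qed.

End Polya.

Section CentralBinomial.
Variable R : realType.

Definition bratio (m k : nat) : R := 'C(m.*2, m + k)%:R / 'C(m.*2, m)%:R.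

Lemma bratioE m k : (k <= m)%N ->
  bratio m k = \prod_(i < k) ((m%:R - i%:R) / (m%:R + k%:R - i%:R)).
Proof.
move=> km; rewrite prodf_div.
have -> : \prod_(i < k) (m%:R - i%:R) = (m ^_ k)%:R :> R.
  rewrite ffact_prod natr_prod; apply: eq_bigr => i _.
  by rewrite natrB// (leq_trans (ltnW (ltn_ord i))).
have -> : \prod_(i < k) (m%:R + k%:R - i%:R) = ((m + k) ^_ k)%:R :> R.
  rewrite ffact_prod natr_prod; apply: eq_bigr => i _.
  by rewrite natrB ?natrD// (leq_trans (ltnW (ltn_ord i)))// leq_addl.
have e1 : ('C(m.*2, m + k) * ((m + k)`! * (m - k)`!) = 'C(m.*2, m) * (m`! * m`!))%N.
  have -> : (m - k = m.*2 - (m + k))%N by lia.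
  rewrite bin_fact; last by lia.
  have mm : (m <= m.*2)%N by lia.
  by rewrite -(bin_fact mm); congr (_ * (_ * _`!))%N; lia.
have e2 := ffact_fact km; have := ffact_fact (leq_addl m k); rewrite addnK => e3.
have h1 : ('C(m.*2, m))%:R != 0 :> R by rewrite pnatr_eq0 -lt0n bin_gt0 -addnn leq_addr.
have h2 : ((m + k) ^_ k)%:R != 0 :> R by rewrite pnatr_eq0 -lt0n ffact_gt0 leq_addl.
apply/eqP; rewrite eqr_div// -!natrM eqr_nat; apply/eqP.
have f0 := fact_gt0 m; have f1 := fact_gt0 (m - k).
apply/eqP; rewrite -(eqn_pmul2r (n1 := _) (m := m`! * (m - k)`!)) ?muln_gt0 ?f0//; apply/eqP.
rewrite [LHS](_ : _ = 'C(m.*2, m + k) * (((m + k) ^_ k * m`!) * (m - k)`!))%N; last by ring.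
rewrite e3 e1 -e2; ring.
Qed.

Lemma bratio_ge0 m k : 0 <= bratio m k.
Proof. by rewrite divr_ge0. Qed.

Lemma bratio_le m k : bratio m k <= expR (- (k%:R ^+ 2 / (m%:R + k%:R))).
Proof.
have [km|mk] := leqP k m; last first.
  by rewrite /bratio bin_small ?mul0r ?expR_ge0// -addnn ltn_add2l.
have [->|k0] := posnP k.
  by rewrite bratioE// big_ord0 expr0n /= mul0r oppr0 expR0.
have mk0 : 0 < m%:R + k%:R :> R by rewrite ltr_wpDl// ltr0n.
have cE (x : R) : x ^+ k = \prod_(i < k) x by rewrite prodr_const card_ord.
rewrite bratioE// expr2 -mulrA -mulrN expRM_natl cE.
apply: ler_prod => i _.
have ik : i%:R < k%:R :> R by rewrite ltr_nat.
have im : i%:R < m%:R :> R by rewrite ltr_nat (leq_trans (ltn_ord i)).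
have i0 : 0 <= i%:R :> R by [].
apply/andP; split; first by apply: divr_ge0; lra.
apply: le_trans (expR_ge1Dx _).
rewrite ler_pdivrMr; last by lra.
have -> : 1 + - (k%:R / (m%:R + k%:R)) = m%:R / (m%:R + k%:R) :> R by field; lra.
rewrite -mulrA mulrC -subr_ge0.
have -> : (m%:R + k%:R)^-1 * (m%:R + k%:R - i%:R) * m%:R - (m%:R - i%:R) =
  i%:R * k%:R / (m%:R + k%:R) :> R by field; lra.
by apply: divr_ge0; [exact: mulr_ge0|exact: ltW].
Qed.

Lemma bratio_ge m k : (k <= m)%N ->
  expR (- (k%:R ^+ 2 / (m%:R - k%:R + 1))) <= bratio m k.
Proof.
move=> km; have km' : k%:R <= m%:R :> R by rewrite ler_nat.
have cE (x : R) : x ^+ k = \prod_(i < k) x by rewrite prodr_const card_ord.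
rewrite bratioE// expr2 -mulrA -mulrN expRM_natl cE.
apply: ler_prod => i _; rewrite expR_ge0 /=.
have ik : i%:R + 1 <= k%:R :> R by rewrite natr1 ler_nat.
have i0 : 0 <= i%:R :> R by [].
rewrite expRN -[leRHS]invrK invf_div lef_pV2 ?posrE ?expR_gt0 ?divr_gt0//; try by lra.
apply: le_trans (expR_ge1Dx _).
have -> : (m%:R + k%:R - i%:R) / (m%:R - i%:R) = 1 + k%:R / (m%:R - i%:R) :> R.
  by field; lra.
rewrite lerD2l ler_pM2l; last by lra.
by rewrite lef_pV2 ?posrE; lra.
Qed.

Definition cbin (m : nat) : R := 'C(m.*2, m)%:R / 4 ^+ m.

Lemma cbin_ge0 m : 0 <= cbin m.
Proof. by rewrite divr_ge0 ?exprn_ge0. Qed.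

Lemma cbinS m : cbin m.+1 = cbin m * ((2 * m%:R + 1) / (2 * m%:R + 2)).
Proof.
have m0 : 0 <= m%:R :> R by [].
have h : ('C(m.+1.*2, m.+1) * m.+1 = 2 * (m.*2.+1) * 'C(m.*2, m))%N.
  rewrite doubleS binS.
  have -> : 'C(m.*2.+1, m) = 'C(m.*2.+1, m.+1).
    by rewrite -bin_sub; [congr 'C(_, _); lia|lia].
  have := mul_bin_diag m.*2.+1 m; rewrite /= => e.
  by rewrite mulnDl mulnC -e; ring.
have h' : 'C(m.+1.*2, m.+1)%:R * (m%:R + 1) = 2 * (2 * m%:R + 1) * 'C(m.*2, m)%:R :> R.
  have e : m.*2.+1%:R = 2 * m%:R + 1 :> R by rewrite -natr1 -muln2 natrM mulrC.
  by rewrite natr1 -natrM h !natrM e.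
rewrite /cbin exprS; apply: (mulIf (x := m%:R + 1)); first by lra.
rewrite mulrAC h'; field.
by rewrite expf_neq0//=; lra.
Qed.

Lemma cbin_sqr_cvg : exists w : R, (fun m : nat => m%:R * cbin m ^+ 2) @ \oo --> w.
Proof.
pose u (m : nat) := m%:R * cbin m ^+ 2.
have nd : nondecreasing_seq u.
  apply/nondecreasing_seqP => m; rewrite /u cbinS -natr1.
  have m0 : 0 <= m%:R :> R by [].
  set q := (2 * m%:R + 1) / _.
  have key : m%:R <= (m%:R + 1) * q ^+ 2.
    rewrite /q expr_div_n mulrA ler_pdivlMr; last by rewrite exprn_gt0//; lra.
    by rewrite !expr2; nra.
  have := ler_wpM2r (sqr_ge0 (cbin m)) key; lra.
have ub m : (2 * m%:R + 1) * cbin m ^+ 2 <= 1.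
  elim: m => [|m IH]; first by rewrite /cbin bin0 expr0 divr1 expr1n mulr1 mulr0 add0r.
  apply: le_trans IH; rewrite cbinS -natr1.
  have m0 : 0 <= m%:R :> R by [].
  set q := (2 * m%:R + 1) / _.
  have key : (2 * (m%:R + 1) + 1) * q ^+ 2 <= 2 * m%:R + 1.
    rewrite /q expr_div_n mulrA ler_pdivrMr; last by rewrite exprn_gt0//; lra.
    by rewrite !expr2; nra.
  have := ler_wpM2r (sqr_ge0 (cbin m)) key; lra.
have : cvgn u.
  apply: nondecreasing_is_cvgn => //; exists 1 => _ [m _ <-].
  apply: le_trans (ub m); rewrite /u ler_wpM2r ?sqr_ge0//.
  have m0 : 0 <= m%:R :> R by [].
  lra.
by exists (limn u).
Qed.

End CentralBinomial.

Lemma cvg_expR (R : realType) (U : Type) (F : set_system U) {FF : Filter F} (f : U -> R) (x : R) :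
  f @ F --> x -> (fun u => expR (f u)) @ F --> expR x.
Proof. by move=> fx; apply: continuous_cvg fx; exact: continuous_expR. Qed.

Lemma div_scale_sqr (F : realFieldType) (c A Y : F) : 0 < c -> 0 < A ->
  Y * c ^+ 2 / (A * c ^+ 2 + 1) = Y / (A + c^-1 * c^-1).
Proof.
move=> c0 A0; have q : 0 < A * (c * c) + 1 by rewrite ltr_wpDl// mulr_ge0 ?mulr_ge0// ltW.
by field; rewrite !gt_eqF.
Qed.

Section PolyaLimit.
Variable R : realType.
Local Notation pi := (@pi R).
Variables (s b : R).
Hypothesis s0 : 0 < s.

Let l (L : nat) : R := L.*2.+1%:R.
Let m (L : nat) : nat := Num.trunc (s * l L ^+ 2).
Let p (L : nat) : int := Num.floor (b * l L).
Let mu L : R := (m L)%:R / l L ^+ 2.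
Let y r L : R := r%:~R - (p L)%:~R / l L.

Let l_gt0 L : 0 < l L. Proof. by rewrite ltr0n. Qed.
Let l_ge1 L : 1 <= l L. Proof. by rewrite ler1n. Qed.
Let linv_ge0 L : 0 <= (l L)^-1. Proof. by rewrite invr_ge0. Qed.
Hint Resolve l_gt0 l_ge1 linv_ge0 : core.

Let linv_cvg : (fun L => (l L)^-1) @ \oo --> (0 : R).
Proof.
apply: (@squeeze_cvgr _ _ _ _ (fun=> 0) (@harmonic R)).
- apply: nearW => L; rewrite linv_ge0 /= lef_pV2 ?posrE ?ltr0n//.
  by rewrite ler_nat ltnS -addnn leq_addr.
- exact: cvg_cst.
- exact: cvg_harmonic.
Qed.

Let mu_itv L : s - (l L)^-1 <= mu L <= s.
Proof.
have sl0 : 0 <= s * l L ^+ 2 by rewrite mulr_ge0 ?ltW ?exprn_gt0.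
have /andP[h1 h2] := trunc_itv sl0; have l2 : 0 < l L ^+ 2 by rewrite exprn_gt0.
rewrite /mu ler_pdivrMr// h1 andbT ler_pdivlMr// mulrBl.
have : (l L)^-1 * l L ^+ 2 = l L by rewrite expr2 mulKf ?gt_eqF.
move: h2; rewrite -natr1 => h2 ->; have := l_ge1 L; rewrite -/(m L) in h2; lra.
Qed.

Let mu_cvg : mu @ \oo --> s.
Proof.
apply: (@squeeze_cvgr _ _ _ _ (fun L => s - (l L)^-1) (fun=> s)).
- by apply: nearW => L; exact: mu_itv.
- by rewrite -[X in _ --> X]subr0; apply: cvgB; [exact: cvg_cst|exact: linv_cvg].
- exact: cvg_cst.
Qed.

Let p_itv L : b - (l L)^-1 <= (p L)%:~R / l L <= b.
Proof.
have /andP[h1 h2] := floor_itv (b * l L).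
rewrite ler_pdivrMr// h1 andbT ler_pdivlMr// mulrBl mulVf ?gt_eqF//.
by move: h2; rewrite intrD -/(p L); lra.
Qed.

Let p_cvg : (fun L => (p L)%:~R / l L) @ \oo --> b.
Proof.
apply: (@squeeze_cvgr _ _ _ _ (fun L => b - (l L)^-1) (fun=> b)).
- by apply: nearW => L; exact: p_itv.
- by rewrite -[X in _ --> X]subr0; apply: cvgB; [exact: cvg_cst|exact: linv_cvg].
- exact: cvg_cst.
Qed.

Let near_mu (e : R) : e < s -> \forall L \near \oo, e < mu L.
Proof. by move=> es; exact: (cvgr_gt s mu_cvg). Qed.

Lemma cos_pow_bounds (x : R) (n : nat) : x ^+ 2 < 1 ->
  expR (- (n%:R * x ^+ 2 / (1 - x ^+ 2))) <= cos x ^+ n.*2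
    <= expR (n%:R * (- x ^+ 2 + x ^+ 4 / 3)).
Proof.
wlog x0 : x / 0 <= x.
  move=> H x1; have [/H|/ltW x0] := leP 0 x; first exact.
  have e4 : (- x) ^+ 4 = x ^+ 4 by ring.
  by have := H (- x); rewrite cosN e4 sqrrN; apply=> //; lra.
move=> x1; have x2 : x < 1 by rewrite -(@ltr_pXn2r _ 2) ?nnegrE ?expr1n.
rewrite -muln2 mulnC exprM cos2sin2.
have h1 := sin_le_id x0; have h2 := sin_ge_T3 x0.
have h3 : 0 <= x - x ^+ 3 / 6 by rewrite !exprS expr0; nra.
have s0' : 0 <= sin x by exact: le_trans h2.
have h4 : sin x ^+ 2 <= x ^+ 2 by rewrite lerXn2r ?nnegrE.
have h5 : x ^+ 2 - x ^+ 4 / 3 <= sin x ^+ 2.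
  apply: (@le_trans _ _ ((x - x ^+ 3 / 6) ^+ 2)); last by rewrite lerXn2r ?nnegrE.
  rewrite -subr_ge0 [X in 0 <= X](_ : _ = (x ^+ 3 / 6) ^+ 2); last by field.
  exact: sqr_ge0.
apply/andP; split.
  rewrite -mulrA -mulrN expRM_natl lerXn2r ?nnegrE ?nnegrE ?expR_ge0//.
  rewrite -[leRHS]invrK expRN lef_pV2 ?posrE ?invr_gt0 ?expR_gt0//; last by lra.
  apply: le_trans (expR_ge1Dx _).
  have -> : 1 + x ^+ 2 / (1 - x ^+ 2) = (1 - x ^+ 2)^-1 by field; lra.
  by rewrite lef_pV2 ?posrE; lra.
rewrite expRM_natl lerXn2r ?nnegrE ?expR_ge0//.
by apply: le_trans (expR_ge1Dx _); lra.
Qed.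

Let cos_term (u : R) : (fun L => cos (u / l L) ^+ (m L).*2) @ \oo --> expR (- (s * u ^+ 2)).
Proof.
pose x2 L := u ^+ 2 * ((l L)^-1 * (l L)^-1).
have x2E L : (u / l L) ^+ 2 = x2 L by rewrite /x2 exprMn -expr2.
have x2_cvg : x2 @ \oo --> (0 : R).
  rewrite -[X in _ --> X](mulr0 (u ^+ 2)) -[X in _ * X](mulr0 (0 : R)).
  by apply: cvgM; [exact: cvg_cst|apply: cvgM].
have mE L : (m L)%:R * (u / l L) ^+ 2 = mu L * u ^+ 2.
  by rewrite /mu; field; rewrite gt_eqF.
apply: (@squeeze_cvgr _ _ _ _ (fun L => expR (- (mu L * u ^+ 2 / (1 - x2 L))))
   (fun L => expR (- (mu L * u ^+ 2) + mu L * u ^+ 2 * x2 L / 3))).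
- near=> L; have hx : (u / l L) ^+ 2 < 1.
    by rewrite x2E; near: L; exact: (cvgr_lt 0 x2_cvg).
  have := cos_pow_bounds (m L) hx.
  rewrite mE -x2E.
  have -> : (m L)%:R * (- (u / l L) ^+ 2 + (u / l L) ^+ 4 / 3) =
    - ((m L)%:R * (u / l L) ^+ 2) + (m L)%:R * (u / l L) ^+ 2 * (u / l L) ^+ 2 / 3.
    by ring.
  by rewrite mE.
- apply: cvg_expR; apply: cvgN.
  rewrite -[X in _ --> X]divr1 -[X in _ / X](subr0 (1 : R)).
  apply: cvgM; first by apply: cvgM; [exact: mu_cvg|exact: cvg_cst].
  apply: cvgV; first by rewrite subr0 oner_neq0.
  by apply: cvgB; [exact: cvg_cst|exact: x2_cvg].
- apply: cvg_expR; rewrite -[X in _ --> X]addr0.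
  have mc : (fun L => mu L * u ^+ 2) @ \oo --> s * u ^+ 2.
    by apply: cvgM; [exact: mu_cvg|exact: cvg_cst].
  apply: cvgD; first exact: cvgN.
  rewrite -(mul0r (3^-1 : R)); apply: cvgM; last exact: cvg_cst.
  by rewrite -(mulr0 (s * u ^+ 2)); apply: cvgM.
Unshelve. all: by end_near. Qed.

Let mE L : (m L)%:R = mu L * l L ^+ 2.
Proof. by rewrite /mu mulfVK// gt_eqF// exprn_gt0. Qed.

Let kabs (r : int) L : (absz (r * L.*2.+1%:Z - p L)%R)%:R = `|y r L| * l L.
Proof.
rewrite natr_absz intr_norm -[X in _ = _ * X](gtr0_norm (l_gt0 L)) -normrM; congr `| _ |.
by rewrite rmorphB rmorphM /= /y mulrBl mulfVK ?gt_eqF.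
Qed.

Let y_cvg r : y r @ \oo --> r%:~R - b.
Proof. by apply: cvgB; [exact: cvg_cst|exact: p_cvg]. Qed.

Let bin_term (r : int) : (fun L => bratio R (m L) (absz (r * L.*2.+1%:Z - p L)%R))
  @ \oo --> expR (- ((r%:~R - b) ^+ 2 / s)).
Proof.
pose z L := `|y r L| * (l L)^-1.
have z_cvg : z @ \oo --> (0 : R).
  by rewrite -(mulr0 `|r%:~R - b|); apply: cvgM => //; apply: cvg_norm; exact: y_cvg.
have ysq : (fun L => y r L ^+ 2) @ \oo --> (r%:~R - b) ^+ 2.
  rewrite expr2; under eq_fun do rewrite expr2.
  by apply: cvgM; exact: y_cvg.
apply: (@squeeze_cvgr _ _ _ _
   (fun L => expR (- (y r L ^+ 2 / (mu L - z L + (l L)^-1 * (l L)^-1))))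
   (fun L => expR (- (y r L ^+ 2 / (mu L + z L))))).
- near=> L.
  have mz : 0 < mu L - z L.
    near: L; apply: (@cvgr_gt _ _ _ _ (fun L => mu L - z L) s) => //.
    by rewrite -[X in _ --> X]subr0; apply: cvgB.
  have z0 : 0 <= z L by rewrite mulr_ge0.
  have l2 : 0 < l L ^+ 2 by rewrite exprn_gt0.
  have lL := l_gt0 L.
  set k := absz _; have kE := kabs r L; rewrite -/k in kE.
  have kzE : k%:R = z L * l L ^+ 2 by rewrite kE /z expr2 mulrA mulfVK ?gt_eqF.
  have ksq : k%:R ^+ 2 = y r L ^+ 2 * l L ^+ 2 by rewrite kE exprMn real_normK ?num_real.
  have km : (k <= m L)%N.
    by rewrite -(ler_nat R) kzE mE ler_pM2r//; lra.
  have := bratio_le R (m L) k; have := bratio_ge R km.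
  rewrite mE kzE in ksq *.
  rewrite -mulrBl -mulrDl ksq.
  have -> : y r L ^+ 2 * l L ^+ 2 / ((mu L + z L) * l L ^+ 2) = y r L ^+ 2 / (mu L + z L).
    by field; rewrite !gt_eqF//; lra.
  have -> : y r L ^+ 2 * l L ^+ 2 / ((mu L - z L) * l L ^+ 2 + 1) =
      y r L ^+ 2 / (mu L - z L + (l L)^-1 * (l L)^-1).
    by apply: div_scale_sqr.
  by move=> -> ->.
- apply: cvg_expR; apply: cvgN; apply: cvgM => //.
  apply: cvgV; first by rewrite gt_eqF.
  rewrite -[X in _ --> X]addr0 -[X in _ --> X + _](subr0 s) -[X in _ --> _ + X](mulr0 (0 : R)).
  by apply: cvgD; [exact: cvgB|exact: cvgM].
- apply: cvg_expR; apply: cvgN; apply: cvgM => //.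
  apply: cvgV; first by rewrite gt_eqF.
  by rewrite -[X in _ --> X]addr0; apply: cvgD.
Unshelve. all: by end_near. Qed.

Lemma cos_le_expR (x : R) : `|x| <= pi / 2 -> 0 <= cos x <= expR (- (x ^+ 2 / 3)).
Proof.
move=> xpi; have p4 := @pihalf_lt2 R; rewrite cos_ge0_pihalf /=; last by rewrite -ler_norml.
rewrite -cos_norm -[x ^+ 2]real_normK ?num_real//.
set z := `|x| in xpi *; have z0 : 0 <= z := normr_ge0 x.
apply: le_trans (cos_le_T4 z0) _; apply: le_trans (expR_ge1Dx _).
have z2 : z <= 2 by lra.
have : z ^+ 2 <= 4 by rewrite expr2; nra.
have := sqr_ge0 z; have -> : z ^+ 4 = z ^+ 2 * z ^+ 2 by ring.
by set w := z ^+ 2 => w0 w4; nra.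
Qed.

Section Shift.
Variables (a f : R).
Hypothesis a_le : `|a| <= 1 / 2.

Let tA (L : nat) (j : int) : R := if (absz j <= L)%N then
  cos (pi * (j%:~R + a) / l L) ^+ (m L).*2 *
  cos (2 * pi * ((p L)%:~R / l L * (j%:~R + a) + f)) else 0.
Let tB (L : nat) (r : int) : R :=
  bratio R (m L) (absz (r * L.*2.+1%:Z - p L)%R) * cos (2 * pi * (r%:~R * a + f)).

Let tAB L : rsum (tA L) = l L * cbin R (m L) * rsum (tB L).
Proof.
pose e (i : int) : int := i - L%:Z.
pose sq : seq int := [seq (i%:Z - L%:Z) | i <- iota 0 L.*2.+1].
have us : uniq sq by rewrite map_inj_uniq ?iota_uniq// => x x' /addIr [].
rewrite (@rsum_fin _ _ sq (tA L) us); last first.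
  move=> j js; rewrite /tA; case: ifPn => // jL; exfalso; move: js; apply/negP/negPn.
  by apply/mapP; exists (absz (j + L%:Z)); [rewrite mem_iota /= add0n ltnS|]; lia.
rewrite big_map -[iota _ _]/(index_iota 0 L.*2.+1) big_mkord.
have c0 : 'C((m L).*2, m L)%:R != 0 :> R.
  by rewrite pnatr_eq0 -lt0n bin_gt0 -addnn leq_addr.
have := polya_identity (m L) L (p L) a f; cbv zeta.
have -> : rsum (fun r : int => binz R (m L) (r * L.*2.+1%:Z - p L) *
    cos (2 * pi * (r%:~R * a + f))) = 'C((m L).*2, m L)%:R * rsum (tB L).
  rewrite -rsumZ.
    by congr rsum; apply/funext => r; rewrite /tB /binz /bratio mulrA mulrCA divff// mulr1.
  apply: (@rsummable_le _ _ _ (fun r => bratio R (m L) (absz (r * L.*2.+1%:Z - p L)%R))).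
    by move=> r; rewrite /tB normrM ger0_norm ?bratio_ge0// ler_piMr ?bratio_ge0// cos_max.
  have -> : (fun r => bratio R (m L) (absz (r * L.*2.+1%:Z - p L)%R)) =
     (fun k => bratio R (m L) (absz k)) \o (fun r => (r * L.*2.+1%:Z - p L)%R) by [].
  apply: rsummable_inj; first by move=> x x' /addIr /mulIf; apply; rewrite eqz_nat.
  apply: (@rsummable_fin _ _ [seq (i%:Z - (m L)%:Z) | i <- iota 0 (m L).*2.+1]) => k kn.
  rewrite /bratio bin_small ?mul0r// -addnn ltn_add2l ltnNge.
  apply: contra kn => km; apply/mapP.
  by exists (absz (k + (m L)%:Z)); [rewrite mem_iota /= add0n ltnS|]; lia.
rewrite /cbin => h; apply: (mulfI (x := 4 ^+ m L)); first by rewrite expf_neq0.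
rewrite (_ : 4 ^+ m L * (_ * _ * _) = l L * ('C((m L).*2, m L)%:R * rsum (tB L))); last first.
  by field; rewrite expf_neq0.
rewrite -h; congr (_ * _); apply: eq_bigr => i _; rewrite /tA.
have -> : (absz (i%:Z - L%:Z)%R <= L)%N by have := ltn_ord i; lia.
by rewrite rmorphB.
Qed.

Let tA_cvg : (fun L => rsum (tA L)) @ \oo -->
  rsum (fun j : int => expR (- (s * (pi * (j%:~R + a)) ^+ 2)) * cos (2 * pi * (b * (j%:~R + a) + f))).
Proof.
apply: (@rsum_dominated_cvg _ _ _ _ _ _ _ (gterm s a)).
- exact: rsummable_gterm.
- move=> j; set c := fun L => cos (pi * (j%:~R + a) / l L) ^+ (m L).*2 *
    cos (2 * pi * ((p L)%:~R / l L * (j%:~R + a) + f)).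
  have : c @ \oo --> expR (- (s * (pi * (j%:~R + a)) ^+ 2)) * cos (2 * pi * (b * (j%:~R + a) + f)).
    apply: cvgM; first exact: cos_term.
    apply: continuous_cvg; first exact: continuous_cos.
    apply: cvgM; first exact: cvg_cst.
    apply: cvgD; last exact: cvg_cst.
    by apply: cvgM; [exact: p_cvg|exact: cvg_cst].
  apply: cvg_trans; apply: near_eq_cvg; near=> L; rewrite /tA /c.
  have -> // : (absz j <= L)%N by near: L; exact: nbhs_infty_ge.
- near=> L => j; rewrite /tA; case: ifPn => [jL|_]; last by rewrite normr0 expR_ge0.
  rewrite normrM; apply: le_trans (_ : _ <= `|cos (pi * (j%:~R + a) / l L) ^+ (m L).*2|) _.
    by rewrite ler_piMr// cos_max.
  have lL := l_gt0 L; have p0 := @pi_gt0 R; have p2 := @pi_ge2 R.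
  set x := pi * (j%:~R + a) / l L.
  have lE : l L = 2 * L%:R + 1 by rewrite /l -natr1 -muln2 natrM mulrC.
  have jL' : `|j%:~R| <= L%:R :> R by rewrite -intr_norm -natr_absz ler_nat.
  have xpi : `|x| <= pi / 2.
    rewrite /x normrM normfV normrM (gtr0_norm p0) (gtr0_norm lL).
    rewrite ler_pdivrMr//; have := ler_normD j%:~R a.
    rewrite -mulrA ler_pM2l// lE => h; apply: (le_trans h); apply: (le_trans (lerD jL' a_le)); lra.
  have /andP[c0 c1] := cos_le_expR xpi.
  rewrite ger0_norm ?exprn_ge0// /gterm.
  apply: (@le_trans _ _ (expR (- (x ^+ 2 / 3)) ^+ (m L).*2)).
    by rewrite lerXn2r ?nnegrE ?expR_ge0.
  rewrite -expRM_natl ler_expR mulrN lerN2.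
  have hm : s / 2 < mu L by near: L; apply: near_mu; have := s0; lra.
  have -> : (m L).*2%:R * (x ^+ 2 / 3) = 2 / 3 * mu L * pi ^+ 2 * (j%:~R + a) ^+ 2.
    by rewrite /x /mu -muln2 natrM; field; rewrite gt_eqF.
  apply: ler_wpM2r; first exact: sqr_ge0.
  have : 4 <= pi ^+ 2 by rewrite expr2; nra.
  move=> h; have : s / 2 * 4 <= mu L * pi ^+ 2 by apply: ler_pM => //; have := s0; lra.
  have := s0; lra.
- move=> j; rewrite normrM ger0_norm ?expR_ge0// /gterm.
  apply: (@le_trans _ _ (expR (- (s * (pi * (j%:~R + a)) ^+ 2)))).
    by rewrite ler_piMr ?expR_ge0// cos_max.
  rewrite ler_expR lerN2 ler_pM2l// exprMn ler_peMl ?sqr_ge0//.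
  by have := @pi_ge2 R; rewrite expr2; nra.
Unshelve. all: by end_near. Qed.

Let tB_cvg : (fun L => rsum (tB L)) @ \oo -->
  rsum (fun r : int => expR (- ((r%:~R - b) ^+ 2 / s)) * cos (2 * pi * (r%:~R * a + f))).
Proof.
pose B := `|b| + 1; pose C := expR (B ^+ 2 / (2 * s)).
have g_le (v t : R) (r : int) : 0 < v -> v <= s -> `|t| <= B ->
    expR (- ((r%:~R - t) ^+ 2 / (2 * v))) <= C * gterm (4 * s)^-1 0 r.
  move=> v0 vs tB'; rewrite /C /gterm -expRD ler_expR addr0.
  have t2 : t ^+ 2 <= B ^+ 2 by rewrite -[t ^+ 2]real_normK ?num_real// lerXn2r ?nnegrE// addr_ge0.
  have h1 := sqr_shift_ge (- t) (r%:~R : R); rewrite sqrrN in h1.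
  have h2 : (r%:~R - t) ^+ 2 / (2 * s) <= (r%:~R - t) ^+ 2 / (2 * v).
    by rewrite ler_wpM2l ?sqr_ge0// lef_pV2 ?posrE ?mulr_gt0// ler_pM2l.
  rewrite lerNl opprD opprK; apply: le_trans h2.
  rewrite ler_pdivlMr; last by rewrite mulr_gt0.
  rewrite mulrDl mulNr divfK; last by rewrite mulf_neq0// gt_eqF.
  have -> : (4 * s)^-1 * r%:~R ^+ 2 * (2 * s) = r%:~R ^+ 2 / 2 by field; rewrite gt_eqF.
  lra.
have sg : rsummable (fun r => C * gterm (4 * s)^-1 0 r).
  by apply: rsummableZ; apply: rsummable_gterm; rewrite invr_gt0 mulr_gt0.
apply: (@rsum_dominated_cvg _ _ _ _ _ _ _ (fun r => C * gterm (4 * s)^-1 0 r)) => //.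
- by move=> r; apply: cvgM; [exact: bin_term|exact: cvg_cst].
- near=> L => r; rewrite /tB normrM ger0_norm ?bratio_ge0//.
  set k := absz _; apply: (@le_trans _ _ (bratio R (m L) k)).
    by rewrite ler_piMr ?bratio_ge0// cos_max.
  have [km|mk] := leqP k (m L); last first.
    rewrite /bratio bin_small ?mul0r; last by rewrite -addnn ltn_add2l.
    by rewrite mulr_ge0 ?expR_ge0.
  apply: le_trans (bratio_le R (m L) k) _.
  have mu0 : 0 < mu L by near: L; exact: near_mu.
  have /andP[_ mus] := mu_itv L.
  have lL := l_gt0 L; have /andP[b1 b2] := p_itv L.
  have l1 : (l L)^-1 <= 1 by rewrite invf_le1.
  have tb : `|(p L)%:~R / l L| <= B.
    by rewrite ler_norml /B; have := ler_norm b; have := ler_norm (- b); rewrite normrN => n1 n2; apply/andP; split; [apply: le_trans b1|apply: (le_trans b2)]; move: l1; move: (l L)^-1 => t; lra.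
  apply: le_trans (g_le _ _ r mu0 mus tb); rewrite -/(y r L) ler_expR lerN2.
  have m0 : 0 < (m L)%:R :> R by rewrite mE mulr_gt0 ?exprn_gt0.
  have -> : y r L ^+ 2 / (2 * mu L) = k%:R ^+ 2 / (2 * (m L)%:R).
    rewrite kabs exprMn real_normK ?num_real// mE; field.
    by rewrite !gt_eqF.
  rewrite ler_wpM2l ?sqr_ge0// lef_pV2 ?posrE; last 2 first.
  - by rewrite mulr_gt0.
  - by rewrite ltr_wpDr.
  have : k%:R <= (m L)%:R :> R by rewrite ler_nat.
  lra.
- move=> r; rewrite normrM ger0_norm ?expR_ge0//.
  apply: (@le_trans _ _ (expR (- ((r%:~R - b) ^+ 2 / (2 * s))))).
    apply: (@le_trans _ _ (expR (- ((r%:~R - b) ^+ 2 / s)))).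
      by rewrite ler_piMr ?expR_ge0// cos_max.
    rewrite ler_expR lerN2 ler_wpM2l ?sqr_ge0// lef_pV2 ?posrE ?mulr_gt0//; have := s0; lra.
  by apply: g_le => //; rewrite /B lerDl.
Unshelve. all: by end_near. Qed.

Lemma theta_pre (w : R) : (fun m : nat => m%:R * cbin R m ^+ 2) @ \oo --> w ->
  rsum (fun j : int => expR (- (s * (pi * (j%:~R + a)) ^+ 2)) * cos (2 * pi * (b * (j%:~R + a) + f)))
  = Num.sqrt (w / s) *
    rsum (fun r : int => expR (- ((r%:~R - b) ^+ 2 / s)) * cos (2 * pi * (r%:~R * a + f))).
Proof.
move=> wcvg; have kE L : 0 < mu L ->
    l L * cbin R (m L) = Num.sqrt ((m L)%:R * cbin R (m L) ^+ 2 / mu L).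
  move=> mu0; have lL := l_gt0 L; have c0 := cbin_ge0 R (m L).
  rewrite -[LHS](ger0_norm (mulr_ge0 (ltW lL) c0)) -sqrtr_sqr; congr Num.sqrt.
  by rewrite mE; field; rewrite gt_eqF.
have m_oo : m @ \oo --> \oo.
  apply/cvgnyPge => N; near=> L; rewrite -(ler_nat R).
  have mu2 : s / 2 < mu L by near: L; apply: near_mu; have := s0; lra.
  have lL : N%:R / (s / 2) <= l L.
    have : N%:R / (s / 2) <= L%:R :> R by near: L; exact: nbhs_infty_ger.
    by move/le_trans; apply; rewrite ler_nat -addnn -addnS leq_addr.
  rewrite mE; move: lL; rewrite ler_pdivrMr; last by have := s0; lra.
  have := l_ge1 L; set c := l L => c1 h; apply: (le_trans h); have := s0; rewrite expr2; nra.
have : (fun L => l L * cbin R (m L)) @ \oo --> Num.sqrt (w / s).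
  have : (fun L => Num.sqrt ((m L)%:R * cbin R (m L) ^+ 2 / mu L)) @ \oo --> Num.sqrt (w / s).
    apply: continuous_cvg; first exact: sqrt_continuous.
    apply: cvgM; last by apply: cvgV => //; rewrite gt_eqF.
    exact: (cvg_comp _ _ m_oo wcvg).
  apply: cvg_trans; apply: near_eq_cvg; near=> L; rewrite kE//.
  by near: L; exact: near_mu.
move=> k_cvg; have h : (fun L => rsum (tA L)) @ \oo --> Num.sqrt (w / s) *
    rsum (fun r : int => expR (- ((r%:~R - b) ^+ 2 / s)) * cos (2 * pi * (r%:~R * a + f))).
  by under eq_fun do rewrite tAB; apply: cvgM.
exact: (cvg_unique _ tA_cvg h).
Unshelve. all: by end_near. Qed.

End Shift.
End PolyaLimit.

(** * Poisson summation for quadratic forms *)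

Section Poisson1.
Variable R : realType.
Local Notation pi := (@pi R).

Lemma poisson1 (c a b f : R) : 0 < c ->
  rsum (fun j : int => expR (- (pi * c * (j%:~R + a) ^+ 2)) * cos (2 * pi * (b * (j%:~R + a) + f)))
  = (Num.sqrt c)^-1 *
    rsum (fun r : int => expR (- (pi * (r%:~R - b) ^+ 2 / c)) * cos (2 * pi * (r%:~R * a + f))).
Proof.
move=> c0; have p0 := @pi_gt0 R; have [w wcvg] := cbin_sqr_cvg R.
have H c' b' a' f' : 0 < c' -> `|a'| <= 1 / 2 ->
  rsum (fun j : int => expR (- (pi * c' * (j%:~R + a') ^+ 2)) * cos (2 * pi * (b' * (j%:~R + a') + f')))
  = Num.sqrt (w * pi / c') *
    rsum (fun r : int => expR (- (pi * (r%:~R - b') ^+ 2 / c')) * cos (2 * pi * (r%:~R * a' + f'))).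
  move=> c'0 a_le; have := theta_pre b' (divr_gt0 c'0 p0) f' a_le wcvg.
  have c'N : c' != 0 by rewrite gt_eqF.
  have pN : pi != 0 by rewrite gt_eqF.
  have -> : w / (c' / pi) = w * pi / c' by rewrite invf_div mulrA.
  move=> h; apply: (etrans _ (etrans h _)).
    by congr rsum; apply/funext => r; congr (expR (- _) * _); move: (pi) pN => P pN; field.
  congr (_ * rsum _); apply/funext => r; congr (expR (- _) * _).
  by rewrite invf_div; field.
have w1 : Num.sqrt (w * pi) = 1.
  have := H 1 0 0 0 ltr01; rewrite normr0 divr1 divr_ge0// => /(_ isT).
  set X := rsum _; have -> : rsum (fun r : int => expR (- (pi * (r%:~R - 0) ^+ 2 / 1)) * cos (2 * pi * (r%:~R * 0 + 0))) = X.
    by congr rsum; apply/funext => r; rewrite !(subr0, addr0, mulr0, mul0r, divr1, mulr1).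
  have X0 : 0 < X.
    have -> : X = rsum (gterm pi 0).
      by congr rsum; apply/funext => r; rewrite mul0r add0r mulr0 cos0 !mulr1.
    have sg := rsummable_gterm (0 : R) p0.
    apply: (@lt_le_trans _ _ (rsum (fun j : int => if j == 0 then 1 else 0 : R))).
      rewrite (@rsum_fin _ _ [:: 0])//.
        by rewrite big_seq1 eqxx.
      by move=> x; rewrite inE => /negbTE ->.
    apply: ler_rsum => //.
      by apply: (@rsummable_fin _ _ [:: 0]) => x; rewrite inE => /negbTE ->.
    move=> j; case: eqP => [->|_]; last exact: expR_ge0.
    by rewrite /gterm addr0 expr0n /= mulr0 oppr0 expR0.
  by move=> h; apply: (mulIf (x := X)); rewrite ?gt_eqF// mul1r -h.
set k := Num.floor (a + 1 / 2); pose a' := a - k%:~R.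
have a'_le : `|a'| <= 1 / 2.
  have := floor_itv (a + 1 / 2); rewrite -/k intrD => /andP[h1 h2].
  by rewrite /a' ler_norml; apply/andP; split; lra.
have wp : 0 <= w * pi by rewrite leNgt; apply/negP => /ltW /ler0_sqrtr; rewrite w1 => /eqP; rewrite oner_eq0.
have := H c b a' f c0 a'_le.
rewrite sqrtrM// w1 mul1r sqrtrV ?ltW// => h.
rewrite (rsum_bij _ (bij_addz (- k))); apply: (etrans _ (etrans h _)); last first.
  congr (_ * rsum _); apply/funext => r; congr (_ * _).
  by rewrite -[RHS](cosD2pi_int _ (r * - k)) intrM rmorphN /= /a'; congr cos; ring.
congr rsum; apply/funext => r /=; rewrite rmorphD rmorphN /= /a'.
by congr (expR (- (_ * _ ^+ 2)) * cos (_ * (_ * _ + _))); ring.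
Qed.

End Poisson1.

Section PosDef.
Variable R : realType.

Definition posdef (n : nat) (A : 'M[R]_n) : Prop :=
  A^T = A /\ forall x, x != 0 -> 0 < qform A x.

Definition zr (n : nat) (x : 'cV[int]_n) : 'cV[R]_n := map_mx intr x.

Lemma dotpC n (x y : 'cV[R]_n) : dotp x y = dotp y x.
Proof. by rewrite /dotp -[x^T *m y]trmxK trmx_mul trmxK [LHS]mxE. Qed.

Lemma dotpDl n (x y z : 'cV[R]_n) : dotp (x + y) z = dotp x z + dotp y z.
Proof. by rewrite /dotp raddfD /= mulmxDl mxE. Qed.

Lemma dotpDr n (x y z : 'cV[R]_n) : dotp x (y + z) = dotp x y + dotp x z.
Proof. by rewrite dotpC dotpDl !(dotpC x). Qed.

Lemma dotpZl n (k : R) (x y : 'cV[R]_n) : dotp (k *: x) y = k * dotp x y.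
Proof. by rewrite /dotp linearZ /= -scalemxAl mxE. Qed.

Lemma dotpZr n (k : R) (x y : 'cV[R]_n) : dotp x (k *: y) = k * dotp x y.
Proof. by rewrite dotpC dotpZl dotpC. Qed.

Lemma dotpNr n (x y : 'cV[R]_n) : dotp x (- y) = - dotp x y.
Proof. by rewrite -scaleN1r dotpZr mulN1r. Qed.

Lemma qformE n (A : 'M[R]_n) x : qform A x = dotp x (A *m x).
Proof. by rewrite /qform /dotp mulmxA. Qed.

Lemma dotp_col n (x0 y0 : R) (x y : 'cV[R]_n) :
  dotp (col_mx x0%:M x : 'cV_(1 + n)) (col_mx y0%:M y) = x0 * y0 + dotp x y.
Proof.
rewrite /dotp tr_col_mx mul_row_col mxE; congr (_ + _).
by rewrite tr_scalar_mx -scalar_mxM mxE eqxx.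
Qed.

Lemma dotpE n (x y : 'cV[R]_n) : dotp x y = \sum_i x i ord0 * y i ord0.
Proof. by rewrite /dotp mxE; apply: eq_bigr => i _; rewrite mxE. Qed.

Lemma col_mx_split n (x : 'cV[R]_(1 + n)) :
  x = col_mx (usubmx x ord0 ord0)%:M (dsubmx x).
Proof. by rewrite -mx11_scalar vsubmxK. Qed.

Section Schur.
Variables (n : nat) (A : 'M[R]_(1 + n)).
Hypothesis pA : posdef A.

Let c : R := ulsubmx A ord0 ord0.
Let l : 'cV[R]_n := dlsubmx A.
Definition schur : 'M[R]_n := drsubmx A - c^-1 *: (l *m l^T).

Lemma schur_mulmx (x0 : R) (x : 'cV[R]_n) :
  A *m col_mx x0%:M x = col_mx (c * x0 + dotp l x)%:M (x0 *: l + drsubmx A *m x).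
Proof.
have ur : ursubmx A = l^T by rewrite /l trmx_dlsub pA.1.
rewrite -{1}(submxK A) mul_block_col ur; congr col_mx.
  rewrite [ulsubmx A]mx11_scalar -scalar_mxM [l^T *m x]mx11_scalar.
  by rewrite -raddfD.
by rewrite mul_mx_scalar.
Qed.

Lemma schur_mul (x : 'cV[R]_n) : schur *m x = drsubmx A *m x - (dotp l x / c) *: l.
Proof.
rewrite /schur mulmxBl -scalemxAl -mulmxA [l^T *m x]mx11_scalar mul_mx_scalar scalerA.
by rewrite mulrC.
Qed.

Lemma schur_c_gt0 : 0 < c.
Proof.
have /pA.2 : (col_mx 1%:M 0 : 'cV[R]_(1 + n)) != 0.
  apply/eqP => /matrixP /(_ (lshift n ord0) ord0).
  by rewrite col_mxEu !mxE eqxx => /eqP; rewrite oner_eq0.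
rewrite qformE schur_mulmx mulr1 dotp_col !mul1r /dotp mulmx0 trmx0 mul0mx !mxE addr0.
by rewrite addr0.
Qed.

Lemma qform_schur (x0 : R) (x : 'cV[R]_n) :
  qform A (col_mx x0%:M x) = c * (x0 + dotp l x / c) ^+ 2 + qform schur x.
Proof.
have c0 := schur_c_gt0.
rewrite !qformE schur_mulmx schur_mul dotp_col !dotpDr dotpNr !dotpZr (dotpC x l).
by field; rewrite gt_eqF.
Qed.

Lemma posdef_schur : posdef schur.
Proof.
split.
  by rewrite /schur raddfB /= linearZ /= trmx_mul trmxK trmx_drsub pA.1.
move=> x x0; have /pA.2 : (col_mx (- (dotp l x / c))%:M x : 'cV[R]_(1 + n)) != 0.
  apply: contraNneq x0 => /(congr1 (@dsubmx _ _ _ _)).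
  by rewrite col_mxKd => ->; rewrite linear0.
by rewrite qform_schur addNr expr0n /= mulr0 add0r.
Qed.

Lemma det_schur : \det A = c * \det schur.
Proof.
have c0 := schur_c_gt0.
have ur : ursubmx A = l^T by rewrite /l trmx_dlsub pA.1.
have -> : A = block_mx 1%:M 0 (c^-1 *: l) 1%:M *m block_mx c%:M l^T 0 schur.
  rewrite mulmx_block !mul1mx !mul0mx !addr0 mul_mx_scalar.
  rewrite scalerA divff ?gt_eqF// scale1r -scalemxAl addrC subrK.
  by rewrite -ur -mx11_scalar submxK.
by rewrite det_mulmx det_lblock det_ublock !det1 det_scalar1 mul1r mul1r.
Qed.

Lemma qform_inv_schur (w0 : R) (w : 'cV[R]_n) : A \in unitmx -> schur \in unitmx ->
  qform (invmx A) (col_mx w0%:M w) =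
    w0 ^+ 2 / c + qform (invmx schur) (w - (w0 / c) *: l).
Proof.
move=> uA uS; have c0 := schur_c_gt0.
set W := col_mx _ _; have [z0 [z zE]] : exists z0 z, W = A *m col_mx z0%:M z.
  by exists (usubmx (invmx A *m W) ord0 ord0), (dsubmx (invmx A *m W)); rewrite -col_mx_split mulKVmx.
have -> : qform (invmx A) W = qform A (col_mx z0%:M z).
  by rewrite !qformE zE mulKmx// dotpC.
move: zE; rewrite schur_mulmx => /eq_col_mx[/matrixP/(_ ord0 ord0)]; rewrite !mxE !mulr1n => -> ->.
rewrite qform_schur; congr (_ + _); first by field; rewrite gt_eqF.
have -> : z0 *: l + drsubmx A *m z - ((c * z0 + dotp l z) / c) *: l = schur *m z.
  rewrite schur_mul; have -> : (c * z0 + dotp l z) / c = z0 + dotp l z / c by field; rewrite gt_eqF.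
  by rewrite scalerDl opprD addrA (addrC (z0 *: l)) addrK.
by rewrite !qformE mulKmx// dotpC.
Qed.

End Schur.

Lemma posdef_det_gt0 n (A : 'M[R]_n) : posdef A -> 0 < \det A.
Proof.
elim: n A => [|n IH] A pA; first by rewrite det_mx00.
rewrite (@det_schur n A pA) mulr_gt0 ?(@schur_c_gt0 n A pA)//.
exact: IH (@posdef_schur n A pA).
Qed.

Lemma posdef_unit n (A : 'M[R]_n) : posdef A -> A \in unitmx.
Proof. by move=> /posdef_det_gt0 d; rewrite unitmxE unitfE gt_eqF. Qed.

Lemma posdef_inv n (A : 'M[R]_n) : posdef A -> posdef (invmx A).
Proof.
move=> pA; have uA := posdef_unit pA; split; first by rewrite trmx_inv pA.1.
move=> x x0; have -> : qform (invmx A) x = qform A (invmx A *m x).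
  by rewrite !qformE mulKVmx// dotpC.
apply: pA.2; apply: contraNneq x0 => h.
by rewrite -(mulKVmx uA x) h mulmx0.
Qed.

End PosDef.

Lemma rsummable_mul (R : realType) (T1 T2 : choiceType) (g : T1 -> R) (h : T2 -> R) :
  rsummable g -> rsummable h -> rsummable (fun p => g p.1 * h p.2).
Proof.
move=> sg sh; apply: rsummable_pair => [x|]; first exact: (rsummableZ (g x) sh).
have -> : (fun x => rsum (fun y => `|g (x, y).1 * h (x, y).2|)) =
    (fun x => rsum (fun y => `|h y|) * `|g x|).
  apply/funext => x; rewrite mulrC -rsumZ; last exact: (rsummable_norm sh).
  by congr rsum; apply/funext => y; rewrite normrM.
exact: (rsummableZ _ (rsummable_norm sg)).
Qed.

Lemma rsummable_expR_cos (R : realType) (T : choiceType) (f g : T -> R) :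
  rsummable (fun x => expR (f x)) -> rsummable (fun x => expR (f x) * cos (g x)).
Proof.
apply: rsummable_le => x.
by rewrite normrM ger0_norm ?expR_ge0// ler_piMr ?expR_ge0// cos_max.
Qed.

Section Poisson.
Variable R : realType.
Local Notation pi := (@pi R).

Definition gauss n (A : 'M[R]_n) (a : 'cV[R]_n) (x : 'cV[int]_n) : R :=
  expR (- (pi * qform A (zr R x + a))).

Definition cons_cV n (p : 'cV[int]_n * int) : 'cV[int]_(1 + n) := col_mx p.2%:M p.1.

Lemma cons_cV_bij n : bijective (@cons_cV n).
Proof.
exists (fun v : 'cV_(1 + n) => (dsubmx v, usubmx v ord0 ord0)).
  by move=> [x k]; rewrite /cons_cV col_mxKd col_mxKu mxE eqxx.
by move=> v; rewrite /cons_cV /= -mx11_scalar vsubmxK.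
Qed.

Lemma zr_cons n (p : 'cV[int]_n * int) : zr R (cons_cV p) = col_mx (p.2%:~R)%:M (zr R p.1).
Proof. by rewrite /zr /cons_cV map_col_mx map_scalar_mx. Qed.

Lemma zr_cons_add n (p : 'cV[int]_n * int) (a : 'cV[R]_(1 + n)) :
  zr R (cons_cV p) + a =
    col_mx (p.2%:~R + usubmx a ord0 ord0)%:M (zr R p.1 + dsubmx a).
Proof. by rewrite zr_cons {1}(col_mx_split a) add_col_mx -raddfD. Qed.

Lemma cV0_eq (T : Type) (x y : 'cV[T]_0) : x = y.
Proof. by apply/matrixP => -[]. Qed.

Lemma qform0 (A : 'M[R]_0) x : qform A x = 0.
Proof. by rewrite qformE dotpE big_ord0. Qed.

Lemma rsummable_gauss n (A : 'M[R]_n) (a : 'cV[R]_n) : posdef A -> rsummable (gauss A a).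
Proof.
elim: n A a => [|n IH] A a pA.
  by apply: (@rsummable_fin _ _ [:: 0]) => x; rewrite inE (cV0_eq x 0) eqxx.
apply: (rsummable_bij (@cons_cV_bij n)).
pose c := @ulsubmx _ 1 n 1 n A ord0 ord0; pose l := @dlsubmx _ 1 n 1 n A.
pose S := schur (A : 'M[R]_(1 + n)).
have c0 : 0 < c := @schur_c_gt0 _ n A pA.
have pS : posdef S := @posdef_schur _ n A pA.
have p0 := @pi_gt0 R; have pc0 : 0 < pi * c by rewrite mulr_gt0.
have [M hM] := rsum_gterm_bounded pc0.
pose al x : R := usubmx (a : 'cV_(1 + n)) ord0 ord0 +
  dotp l (zr R x + dsubmx (a : 'cV_(1 + n))) / c.
pose a' := @dsubmx _ 1 n 1 a.
have E x k : gauss A a (cons_cV (x, k)) = gauss S a' x * gterm (pi * c) (al x) k.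
  rewrite /gauss /gterm -expRD (zr_cons_add (x, k) a) (@qform_schur _ n A pA) /=.
  by congr expR; rewrite /al -/c -/l -/S -/a'; ring.
apply: rsummable_pair => [x|].
  rewrite /comp; under [X in rsummable X]eq_fun do rewrite E.
  by apply: rsummableZ; exact: rsummable_gterm.
apply: (@rsummable_le _ _ _ (fun x => M * gauss S a' x)); last exact: rsummableZ (IH _ _ pS).
move=> x; rewrite ger0_norm; last by apply: rsum_ge0.
have -> : (fun k => `|(gauss A a \o @cons_cV n) (x, k)|) =
    (fun k => gauss S a' x * gterm (pi * c) (al x) k).
  by apply/funext => k /=; rewrite E ger0_norm// mulr_ge0 ?expR_ge0.
rewrite rsumZ; last exact: rsummable_gterm.
by rewrite mulrC ler_wpM2r ?expR_ge0.
Qed.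

Lemma poisson n (A : 'M[R]_n) (a b : 'cV[R]_n) (f : R) : posdef A ->
  rsum (fun x => expR (- (pi * qform A (zr R x + a))) *
    cos (2 * pi * (dotp b (zr R x + a) + f))) =
  (Num.sqrt (\det A))^-1 *
  rsum (fun y => expR (- (pi * qform (invmx A) (zr R y - b))) *
    cos (2 * pi * (dotp (zr R y) a + f))).
Proof.
elim: n A a b f => [|n IH] A a b f pA.
  rewrite det_mx00 sqrtr1 invr1 mul1r; congr rsum; apply/funext => x.
  by rewrite !qform0 !dotpE !big_ord0.
have uA := posdef_unit pA.
pose c := @ulsubmx _ 1 n 1 n A ord0 ord0; pose l : 'cV_n := @dlsubmx _ 1 n 1 n A.
pose S := schur (A : 'M[R]_(1 + n)).
have c0 : 0 < c := @schur_c_gt0 _ n A pA.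
have pS : posdef S := @posdef_schur _ n A pA.
have uS := posdef_unit pS.
pose a0 := usubmx (a : 'cV_(1 + n)) ord0 ord0; pose a' : 'cV_n := @dsubmx _ 1 n 1 a.
pose b0 := usubmx (b : 'cV_(1 + n)) ord0 ord0; pose b' : 'cV_n := @dsubmx _ 1 n 1 b.
have p0 := @pi_gt0 R; have pc0 : 0 < pi / c by rewrite divr_gt0.
pose b'' (k : int) := b' + ((k%:~R - b0) / c) *: l.
pose f'' (k : int) := f + k%:~R * a0.
have gE (k : int) : expR (- (pi * (k%:~R - b0) ^+ 2 / c)) = gterm (pi / c) (- b0) k.
  by rewrite /gterm mulrAC.
pose G (x : 'cV[int]_n) (k : int) := expR (- (pi * qform S (zr R x + a'))) *
   (expR (- (pi * (k%:~R - b0) ^+ 2 / c)) * cos (2 * pi * (dotp (b'' k) (zr R x + a') + f'' k))).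
have sG : rsummable (fun p => G p.1 p.2).
  apply: (@rsummable_le _ _ _ (fun p => gauss S a' p.1 * gterm (pi / c) (- b0) p.2)).
    move=> [x k] /=; rewrite /G normrM (ger0_norm (expR_ge0 _)) normrM (ger0_norm (expR_ge0 _)) mulrA.
    apply: le_trans (_ : _ <= gauss S a' x * expR (- (pi * (k%:~R - b0) ^+ 2 / c))) _.
      by rewrite ler_piMr ?mulr_ge0 ?expR_ge0// cos_max.
    by rewrite gE.
  by apply: rsummable_mul; [exact: rsummable_gauss|exact: rsummable_gterm].
have sH (psi : int -> R) :
    rsummable (fun k : int => expR (- (pi * (k%:~R - b0) ^+ 2 / c)) * cos (psi k)).
  apply: (@rsummable_le _ _ _ (gterm (pi / c) (- b0))); last exact: rsummable_gterm.
  move=> k; rewrite normrM (ger0_norm (expR_ge0 _)) gE.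
  by rewrite ler_piMr ?expR_ge0// cos_max.
have detE : (Num.sqrt (\det A))^-1 = (Num.sqrt c)^-1 * (Num.sqrt (\det S))^-1.
  by rewrite (@det_schur _ n A pA) sqrtrM ?ltW// invfM.
have L1 : rsum (fun x => expR (- (pi * qform A (zr R x + a))) *
    cos (2 * pi * (dotp b (zr R x + a) + f))) =
    (Num.sqrt c)^-1 * rsum (fun x => rsum (G x)).
  rewrite (rsum_bij _ (@cons_cV_bij n)) rsum_pair; last first.
    apply: (rsummable_inj (bij_inj (@cons_cV_bij n))).
    by apply: rsummable_expR_cos; exact: rsummable_gauss.
  rewrite -rsumZ; last exact: (rsummable_rsum sG).
  congr rsum; apply/funext => x.
  set u := zr R x + a'; pose al := a0 + dotp l u / c.
  pose ph := dotp b' u + f - b0 * dotp l u / c.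
  have := poisson1 al b0 ph c0 => P1.
  transitivity (expR (- (pi * qform S u)) * rsum (fun k : int => expR (- (pi * c * (k%:~R + al) ^+ 2)) *
      cos (2 * pi * (b0 * (k%:~R + al) + ph)))).
    rewrite -rsumZ; last first.
      apply: rsummable_expR_cos; apply: (@rsummable_gterm _ (pi * c) al).
      by rewrite mulr_gt0.
    congr rsum; apply/funext => k /=.
    rewrite (zr_cons_add (x, k) a) (@qform_schur _ n A pA) /= -/a0 -/a' -/u -/c -/l -/S.
    rewrite {1}(col_mx_split b) dotp_col -/b0 -/b' mulrA -expRD.
    congr (expR _ * cos (_ * _)); first by rewrite /al; ring.
    by rewrite /ph /al; ring.
  rewrite P1 mulrCA -(rsumZ _ (sH (fun k => 2 * pi * (k%:~R * al + ph)))).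
  congr (_ * rsum _); apply/funext => k; rewrite /G -/u; congr (_ * (_ * cos (_ * _))).
  by rewrite /al /ph /b'' /f'' dotpDl dotpZl; ring.
rewrite L1 rsum_swap// detE -mulrA; congr (_ * _).
have spA := posdef_inv pA.
rewrite [X in _ = _ * X](rsum_bij _ (e := fun p : int * 'cV[int]_n => cons_cV (p.2, p.1))); last first.
  have [g g1 g2] := @cons_cV_bij n.
  exists (fun v => ((g v).2, (g v).1)); first by move=> [k x] /=; rewrite g1.
  by move=> v /=; rewrite -surjective_pairing g2.
have inj2 : injective (fun p : int * 'cV[int]_n => cons_cV (p.2, p.1)).
  by move=> [k x] [k' x'] /(bij_inj (@cons_cV_bij n)) [-> ->].
set F := (X in rsum (X \o _)).
have sF : rsummable (F \o (fun p : int * 'cV[int]_n => cons_cV (p.2, p.1))).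
  apply: (rsummable_inj inj2).
  by apply: rsummable_expR_cos; exact: (@rsummable_gauss _ (invmx A) (- b)).
rewrite (rsum_pair sF) -rsumZ; last exact: (rsummable_rsum sF).
congr rsum; apply/funext => k.
transitivity (expR (- (pi * (k%:~R - b0) ^+ 2 / c)) *
   rsum (fun x => expR (- (pi * qform S (zr R x + a'))) *
      cos (2 * pi * (dotp (b'' k) (zr R x + a') + f'' k)))).
  rewrite -rsumZ; last first.
    apply: (@rsummable_le _ _ _ (gauss S a')); last exact: rsummable_gauss.
    by move=> x; rewrite normrM ger0_norm ?expR_ge0// ler_piMr ?expR_ge0// cos_max.
  by congr rsum; apply/funext => x; rewrite /G mulrCA.
rewrite IH// mulrCA; congr (_ * _); rewrite -rsumZ; last first.
  apply: (@rsummable_le _ _ _ (gauss (invmx S) (- b'' k))).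
    by move=> x; rewrite normrM ger0_norm ?expR_ge0// ler_piMr ?expR_ge0// cos_max.
  exact: rsummable_gauss (posdef_inv pS).
congr rsum; apply/funext => y; rewrite /F /=.
have -> : zr R (cons_cV (y, k)) - b = col_mx (k%:~R - b0)%:M (zr R y - b').
  by rewrite (zr_cons_add (y, k) (- b)) !raddfN /= mxE.
rewrite (@qform_inv_schur _ n A pA _ _ uA uS) -/c -/l -/S.
rewrite (zr_cons (y, k)) {1}(col_mx_split a) dotp_col -/a0 -/a' mulrA -expRD.
congr (expR _ * cos (_ * _)).
  by rewrite /b'' opprD addrA; ring.
by rewrite /f''; ring.
Qed.

End Poisson.

(** * Bases of unimodular lattices *)

Section LatticeBasis.
Variables (R : realType) (n : nat) (L : set 'cV[R]_n).

Lemma lattice_mulz : is_lattice L -> forall (x : 'cV[R]_n) (k : int), L x -> L (k%:~R *: x).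
Proof.
move=> [[L0 LB] _ _] x k Lx.
have LN y : L y -> L (- y) by move=> Ly; rewrite -sub0r; exact: LB.
have LD y z : L y -> L z -> L (y + z) by move=> Ly Lz; rewrite -[z]opprK; apply: LB => //; exact: LN.
have Ln (m : nat) : L (m%:R *: x).
  by elim: m => [|m IH]; [rewrite scale0r|rewrite -natr1 scalerDl scale1r; exact: LD].
case: k => m; first exact: Ln.
by rewrite NegzE rmorphN /= scaleNr; apply: LN; exact: Ln.
Qed.

Lemma lattice_mulmx (B : 'M[R]_n) : is_lattice L -> (forall j, L (col j B)) ->
  forall z, L (B *m zr R z).
Proof.
move=> hL BL z; have [[L0 LB] _ _] := hL.
have LN y : L y -> L (- y) by move=> Ly; rewrite -sub0r; exact: LB.
have LD x y : L x -> L y -> L (x + y) by move=> Ly Lz; rewrite -[y]opprK; apply: LB => //; exact: LN.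
have -> : B *m zr R z = \sum_j (z j ord0)%:~R *: col j B.
  apply/matrixP => i k; rewrite (ord1 k) mxE summxE; apply: eq_bigr => j _.
  by rewrite !mxE mulrC.
by elim/big_ind: _ => // j _; apply: lattice_mulz.
Qed.

Lemma det_replace_col (j : 'I_n) (c : 'cV[R]_n) :
  \det (\matrix_(i, k) (if k == j then c i ord0 else (i == k)%:R)) = c j ord0.
Proof.
rewrite (expand_det_row _ j) (bigD1 j)//= big1 ?addr0; last first.
  by move=> k kj; rewrite mxE (negbTE kj) eq_sym (negbTE kj) mul0r.
rewrite mxE eqxx /cofactor -signr_odd addnn odd_double expr0 mul1r.
set M := row' _ _; have -> : M = 1%:M.
  by apply/matrixP => i k; rewrite !mxE eq_sym (negbTE (neq_lift _ _)) (inj_eq lift_inj).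
by rewrite det1 mulr1.
Qed.

Lemma gram_int (B : 'M[R]_n) : unimodular L -> (forall j, L (col j B)) ->
  exists N : 'M[int]_n, B^T *m B = map_mx intr N.
Proof.
move=> uL BL; have H i j : (B^T *m B) i j \is a Num.int.
  have Li := BL i; have := BL j; rewrite uL => /(_ _ Li).
  rewrite dotpE mxE; congr (_ \is a _); apply: eq_bigr => k _.
  by rewrite !mxE.
exists (\matrix_(i, j) Num.floor ((B^T *m B) i j)); apply/matrixP => i j.
by rewrite !mxE; apply/esym; move: (H i j); rewrite mxE => /intrP[k ->]; rewrite intrKfloor.
Qed.

(* A basis of R^n inside L with minimal det^2, which is a positive integer by
   unimodularity, generates L: a fractional coordinate of a vector of L would
   allow a replacement that decreases the determinant. *)
Lemma lattice_basis : is_lattice L -> unimodular L ->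
  exists2 B : 'M[R]_n, B \in unitmx & L = range (fun z => B *m zr R z).
Proof.
move=> hL uL; have [_ _ [B0 [B0u B0L]]] := hL.
pose P (k : nat) := `[< exists B : 'M[R]_n, [/\ B \in unitmx, forall j, L (col j B) &
   (\det B) ^+ 2 = k%:R] >].
have exP (B : 'M[R]_n) : B \in unitmx -> (forall j, L (col j B)) ->
    exists2 k, P k & (\det B) ^+ 2 = k%:R.
  move=> Bu BL; have [N NE] := gram_int uL BL.
  have e : \det B ^+ 2 = (\det N)%:~R by rewrite -det_map_mx -NE det_mulmx det_tr.
  exists (absz (\det N)); last by rewrite natr_absz ger0_norm// -(ler_int R) -e sqr_ge0.
  apply/asboolP; exists B; split=> //.
  by rewrite natr_absz ger0_norm// -(ler_int R) -e sqr_ge0.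
have exk : exists k, P k by have [k Pk _] := exP _ B0u B0L; exists k.
case: (ex_minnP exk) => k /asboolP[B [Bu BL Bk]] kmin.
exists B => //; apply/seteqP; split => [x Lx|_ [z _ <-]]; last exact: lattice_mulmx.
have [c xE] : exists c, x = B *m c by exists (invmx B *m x); rewrite mulKVmx.
suff ci j : c j ord0 \is a Num.int.
  exists (\col_i Num.floor (c i ord0)) => //; rewrite xE; congr (_ *m _).
  apply/matrixP => i h; rewrite (ord1 h) !mxE.
  by move: (ci i) => /intrP[q ->]; rewrite intrKfloor.
apply: contrapT => /negP cj.
set r := c j ord0 - (Num.floor (c j ord0))%:~R.
have /andP[f1 f2] := floor_itv (c j ord0).
have r0 : 0 < r.
  rewrite subr_gt0 lt_neqAle f1 andbT; apply: contra cj => /eqP <-.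
  by rewrite intr_int.
have r1 : r < 1 by rewrite /r; move: f2; rewrite intrD; lra.
pose c' : 'cV[R]_n := c - (Num.floor (c j ord0))%:~R *: delta_mx j ord0.
pose E : 'M[R]_n := \matrix_(i, h) (if h == j then c' i ord0 else (i == h)%:R).
have dE : \det E = r by rewrite det_replace_col !mxE !eqxx mulr1.
have colBE h : col h (B *m E) = if h == j then x - (Num.floor (c j ord0))%:~R *: col j B else col h B.
  rewrite colE -mulmxA -colE; case: eqP => [->|/eqP hj].
    have -> : col j E = c' by apply/matrixP => i h'; rewrite (ord1 h') !mxE eqxx.
    by rewrite mulmxBr -xE -scalemxAr -colE.
  have -> : col h E = delta_mx h ord0.
    by apply/matrixP => i h'; rewrite (ord1 h') !mxE (negbTE hj) eqxx andbT.
  by rewrite -colE.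
have [B'u B'L] : B *m E \in unitmx /\ forall h, L (col h (B *m E)).
  split; first by rewrite unitmx_mul Bu unitmxE dE unitfE gt_eqF.
  move=> h; rewrite colBE; case: eqP => // _; have [[_ LB] _ _] := hL; apply: LB => //.
  exact: lattice_mulz.
have [k' Pk' k'E] := exP _ B'u B'L; have := kmin _ Pk'.
rewrite -(ler_nat R) -k'E -Bk det_mulmx dE exprMn leNgt.
have d2 : 0 < \det B ^+ 2 by rewrite exprn_even_gt0//= -unitfE -unitmxE.
by rewrite gtr_pMr// expr_lt1// ?r1// ltW.
Qed.

Lemma unimodular_gram (B : 'M[R]_n) : unimodular L -> B \in unitmx ->
  L = range (fun z => B *m zr R z) ->
  exists N M : 'M[int]_n, [/\ B^T *m B = map_mx intr N, N *m M = 1%:M, M *m N = 1%:M &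
    (\det B) ^+ 2 = 1].
Proof.
move=> uL Bu LE; have BL j : L (col j B).
  rewrite LE; exists (delta_mx j ord0) => //; rewrite colE; congr (_ *m _).
  by apply/matrixP => i k; rewrite !mxE; case: (_ && _).
have [N NE] := gram_int uL BL.
have uBt : B^T \in unitmx by rewrite unitmx_tr.
have CL j : L (col j (invmx B^T)).
  rewrite uL => x; rewrite LE => -[z _ <-].
  rewrite dotpE.
  have -> : \sum_i (B *m zr R z) i ord0 * col j (invmx B^T) i ord0 = (z j ord0)%:~R.
    transitivity (((zr R z)^T *m (B^T *m invmx B^T)) ord0 j).
      rewrite mulmxA -trmx_mul mxE; apply: eq_bigr => i _.
      by rewrite [in RHS]mxE [col _ _ _ _]mxE.
    by rewrite mulmxV// mulmx1 !mxE.
  exact: intr_int.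
have [M ME] : exists M : 'M[int]_n, invmx B^T = B *m map_mx intr M.
  have H j : exists z : 'cV[int]_n, B *m zr R z = col j (invmx B^T).
    by have := CL j; rewrite LE => -[z _ <-]; exists z.
  have [f fE] := choice H; exists (\matrix_(i, j) f j i ord0).
  apply/matrixP => i j; have := congr1 (fun v : 'cV[R]_n => v i ord0) (fE j).
  rewrite [in RHS]mxE => <-; rewrite !mxE; apply: eq_bigr => k _.
  by rewrite !mxE.
have NM : N *m M = 1%:M.
  have : map_mx intr (N *m M) = map_mx intr 1%:M :> 'M[R]_n.
    by rewrite map_mxM -NE -mulmxA -ME mulmxV// map_mx1.
  move=> /matrixP h; apply/matrixP => i j; have := h i j.
  by rewrite mxE [in RHS]mxE => /intr_inj.
have MN := mulmx1C NM.
exists N, M; split=> //.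
have d1 : \det N * \det M = 1 by rewrite -det_mulmx NM det1.
have e : \det B ^+ 2 = (\det N)%:~R by rewrite -det_map_mx -NE det_mulmx det_tr.
have dN0 : 0 <= \det N by rewrite -(ler_int R) -e sqr_ge0.
have : \det N \is a GRing.unit by apply/unitrPr; exists (\det M).
rewrite qualifE /= => /orP[/eqP dN|/eqP dN]; last by move: dN0; rewrite dN.
by rewrite e dN.
Qed.

End LatticeBasis.

(** * Relations between theta series with polynomial coefficients *)

Section Derivation.
Variable R : realType.

Lemma rsum_derive (T : choiceType) (f f' : R -> T -> R) (s0 : R) (g : T -> R) :
  (forall s, rsummable (f s)) ->
  (forall (z : T) (s : R), is_derive s 1 (fun s => f s z) (f' s z)) ->
  rsummable g -> (forall (s : R) (z : T), `|s - s0| <= 1 -> `|f' s z| <= g z) ->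
  is_derive s0 1 (fun s => rsum (f s)) (rsum (f' s0)).
Proof.
move=> sf fd sg fg.
pose q (h : R) (z : T) : R := h^-1 * (f (h + s0) z - f s0 z).
have quot z : q ^~ z @ 0^' --> f' s0 z.
  have [dv <-] := fd z s0; rewrite /derive.
  move: dv; rewrite /derivable; set F := (X in cvg (X @ _)) => dv.
  have -> : q ^~ z = F.
    by apply/funext => h; rewrite /F /q /= /shift /= /GRing.scale /= mulr1.
  exact: dv.
have lim : (fun h => rsum (q h)) @ 0^' --> rsum (f' s0).
  apply: (@rsum_dominated_cvg _ _ _ _ _ _ _ g) => //; last first.
    by move=> z; apply: fg; rewrite subrr normr0.
  near=> h => z; have h0 : h != 0 by near: h; exact: nbhs_dnbhs_neq.
  have h1 : `|h| <= 1.
    near: h; apply: dnbhs0_le => //.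
  have fc a b : {within `[a, b], continuous (fun s => f s z)}.
    apply: derivable_within_continuous => y _.
    by have /@ex_derive := fd z y.
  rewrite /q normrM normfV.
  have [c hc ->] : exists2 c, `|c - s0| <= 1 & f (h + s0) z - f s0 z = f' c z * h.
    have [hp|hn] := ltP 0 h.
      have ab : s0 < h + s0 by lra.
      have [c] := MVT ab (fun y _ => fd z y) (fc _ _).
      rewrite in_itv /= => /andP[c1 c2] e; exists c; last by rewrite e; congr (_ * _); ring.
      by move: h1; rewrite gtr0_norm// => h1; rewrite ger0_norm; lra.
    have hn' : h < 0 by rewrite lt_neqAle h0.
    have ab : h + s0 < s0 by lra.
    have [c] := MVT ab (fun y _ => fd z y) (fc _ _).
    rewrite in_itv /= => /andP[c1 c2] e; exists c; last by rewrite -opprB e; ring.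
    by move: h1; rewrite ltr0_norm// => h1; rewrite ler0_norm; lra.
  rewrite normrM mulrC mulfK ?normr_eq0//; exact: fg.
have qE h : rsum (q h) = h^-1 * (rsum (f (h + s0)) - rsum (f s0)).
  by rewrite -rsumB// -rsumZ//; exact: rsummableB.
have E : (fun h : R => h^-1 *: (((fun s => rsum (f s)) \o shift s0) (h *: (1 : R)) - rsum (f s0))) =
    (fun h => rsum (q h)).
  by apply/funext => h; rewrite qE /= /shift /= /GRing.scale /= mulr1.
apply: DeriveDef.
  by rewrite /derivable E; apply/cvg_ex; exists (rsum (f' s0)).
by rewrite /derive E; exact: cvg_lim.
Unshelve. all: by end_near. Qed.

Lemma expR_ge_Xn (x : R) (k : nat) : 0 <= x -> x ^+ k <= k`!%:R * expR x.
Proof.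
move=> x0; case: k => [|k].
  by rewrite fact0 mul1r expr0 -[leLHS]expR0 ler_expR.
have := expR_ge1Dxn k x0 => h; rewrite mulrC -ler_pdivrMr; last by rewrite ltr0n fact_gt0.
by apply: le_trans h; rewrite lerDr.
Qed.

Lemma Xn_le_expR (x c : R) (k : nat) : 0 <= x -> 0 < c ->
  x ^+ k <= k`!%:R / c ^+ k * expR (c * x).
Proof.
move=> x0 c0; have := @expR_ge_Xn (c * x) k (mulr_ge0 (ltW c0) x0).
by rewrite exprMn mulrAC ler_pdivlMr ?exprn_gt0// mulrC.
Qed.

Lemma horner_le_expR (p : {poly R}) : exists2 C : R, 0 <= C &
  forall y, 0 <= y -> `|p.[y]| <= C * expR (y / 2).
Proof.
exists (\sum_(i < size p) `|p`_i| * (i`!%:R / (1 / 2) ^+ i)).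
  by apply: sumr_ge0 => i _; rewrite mulr_ge0// divr_ge0// exprn_ge0.
move=> y y0; rewrite horner_coef; apply: le_trans (ler_norm_sum _ _ _) _.
rewrite mulr_suml; apply: ler_sum => i _; rewrite normrM -mulrA ler_wpM2l//.
rewrite normrX (ger0_norm y0).
by have := @Xn_le_expR y (1 / 2) i y0; rewrite (mulrC (1 / 2)) mulrA mulr1; apply.
Qed.

Definition Dpoly (k : R) (p : {poly R}) : {poly R} := k *: p + 'X * p^`() - 'X * p.

Definition psi (T : choiceType) (X w : T -> R) (k : R) (p : {poly R}) (s : R) : R :=
  rsum (fun z => w z * (p.[X z * expR s] * expR (k * s - X z * expR s))).

Section Psi.
Variables (T : choiceType) (X w : T -> R).
Hypothesis X0 : forall z, 0 <= X z.
Hypothesis sw : forall c, 0 < c -> rsummable (fun z => w z * expR (- (c * X z))).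

Let bound (k : R) (p : {poly R}) (s0 : R) : exists2 c, 0 < c & exists C, forall s z,
  `|s - s0| <= 1 ->
  `|w z * (p.[X z * expR s] * expR (k * s - X z * expR s))| <= C * `|w z * expR (- (c * X z))|.
Proof.
have [C C0 hC] := horner_le_expR p.
exists (expR (s0 - 1) / 2); first by rewrite divr_gt0 ?expR_gt0.
exists (C * expR (`|k| * (`|s0| + 1))) => s z hs.
have y0 : 0 <= X z * expR s by rewrite mulr_ge0 ?expR_ge0.
rewrite (normrM (w z)) [leRHS]mulrC (normrM (w z)) -[leRHS]mulrA ler_wpM2l//.
rewrite normrM (ger0_norm (expR_ge0 _)) (ger0_norm (expR_ge0 _)).
apply: (@le_trans _ _ (C * expR (X z * expR s / 2) * expR (k * s - X z * expR s))).
  by rewrite ler_wpM2r ?expR_ge0// hC.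
rewrite mulrCA -mulrA ler_wpM2l// -expRD -expRD ler_expR.
have ks : k * s <= `|k| * (`|s0| + 1).
  apply: le_trans (ler_norm _) _; rewrite normrM ler_wpM2l//.
  have := ler_normD (s - s0) s0; rewrite subrK; lra.
have es : expR (s0 - 1) <= expR s.
  by rewrite ler_expR; move: hs; rewrite ler_norml => /andP[]; lra.
have := ler_wpM2l (X0 z) es; lra.
Qed.

Lemma psi_summable k p s :
  rsummable (fun z => w z * (p.[X z * expR s] * expR (k * s - X z * expR s))).
Proof.
have [c c0 [C hC]] := bound k p s.
apply: (rsummable_le (g := fun z => C * `|w z * expR (- (c * X z))|)).
  by move=> z; apply: hC; rewrite subrr normr0.
by apply: rsummableZ; apply: rsummable_norm; exact: sw.
Qed.

Lemma psi_derive k p (s : R) : is_derive s 1 (psi X w k p) (psi X w k (Dpoly k p) s).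
Proof.
have [c c0 [C hC]] := bound k (Dpoly k p) s.
apply: (rsum_derive (f := fun s z => w z * (p.[X z * expR s] * expR (k * s - X z * expR s)))
  (f' := fun s z => w z * ((Dpoly k p).[X z * expR s] * expR (k * s - X z * expR s)))
  (g := fun z => C * `|w z * expR (- (c * X z))|)).
- by move=> t; exact: psi_summable.
- move=> z t.
  have d1 : is_derive t 1 (fun s : R => X z * expR s) (X z * expR t).
    by apply: is_derive_eq; rewrite /GRing.scale /=; ring.
  have d2 : is_derive t 1 (fun s : R => p.[X z * expR s]) (p^`().[X z * expR t] * (X z * expR t)).
    have := @is_derive1_comp _ (horner p) (fun s : R => X z * expR s) t _ _ _ d1.
    by rewrite /comp; apply; exact: is_derive_poly.
  have d3 : is_derive t 1 (fun s : R => expR (k * s - X z * expR s))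
     ((k - X z * expR t) * expR (k * t - X z * expR t)).
    by apply: is_derive_eq; rewrite /GRing.scale /=; ring.
  have -> : (Dpoly k p).[X z * expR t] =
      k * p.[X z * expR t] + (X z * expR t) * p^`().[X z * expR t] - X z * expR t * p.[X z * expR t].
    by rewrite /Dpoly !hornerE.
  apply: is_derive_eq; rewrite /GRing.scale /=; ring.
- by apply: rsummableZ; apply: rsummable_norm; exact: sw.
- exact: hC.
Qed.

End Psi.

Lemma parity_derive (F : nat -> R -> R) (b : bool) :
  (forall j (s : R), is_derive s 1 (F j) (F j.+1 s)) ->
  (forall s, F 0%N (- s) = (-1) ^+ b * F 0%N s) ->
  forall j s, F j (- s) = (-1) ^+ (j + b) * F j s.
Proof.
move=> Fd F0; elim=> [|j IH] s; first by rewrite F0.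
have d1 : is_derive s 1 (fun s => F j (- s)) (- F j.+1 (- s)).
  have d0 : is_derive s 1 (fun s : R => - s) (- 1) by apply: is_derive_eq.
  have := @is_derive1_comp _ (F j) (fun s : R => - s) s _ _ (Fd _ _) d0.
  by rewrite mulrN1.
have d2 : is_derive s 1 (fun s => F j (- s)) ((-1) ^+ (j + b) * F j.+1 s).
  have -> : (fun s => F j (- s)) = (fun s => (-1) ^+ (j + b) * F j s).
    by apply/funext => t; exact: IH.
  by have d3 := Fd j s; apply: is_derive_eq.
have [_ e1] := d1; have [_ e2] := d2; move: e1; rewrite e2 => e.
by rewrite addSn exprS mulN1r mulNr e opprK.
Qed.

Lemma parity_derive0 (F : nat -> R -> R) (b : bool) :
  (forall j (s : R), is_derive s 1 (F j) (F j.+1 s)) ->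
  (forall s, F 0%N (- s) = (-1) ^+ b * F 0%N s) ->
  forall j, odd (j + b) -> F j 0 = 0.
Proof.
move=> Fd F0 j jb; have := parity_derive Fd F0 j 0.
by rewrite oppr0 -signr_odd jb expr1; lra.
Qed.

End Derivation.

Section ExpTaylor.
Variable R : realType.

Definition exp_poly (n : nat) (u : R) : R := \sum_(i < n) u ^+ i / i`!%:R.

Lemma is_derive_Xn n (u : R) : is_derive u 1 (fun x : R => x ^+ n) (n%:R * u ^+ n.-1).
Proof.
apply: DeriveDef; first exact: exprn_derivable.
by rewrite exp_derive /GRing.scale /= mulr1.
Qed.

Lemma is_derive_exp_poly n (u : R) : is_derive u 1 (exp_poly n.+1) (exp_poly n u).
Proof.
elim: n => [|n IH].
  have -> : exp_poly 1 = cst 1.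
    by apply/funext => v; rewrite /exp_poly big_ord1 expr0 fact0 divr1.
  by rewrite /exp_poly big_ord0; exact: is_derive_cst.
have -> : exp_poly n.+2 = (fun v => exp_poly n.+1 v + v ^+ n.+1 / n.+1`!%:R).
  by apply/funext => v; rewrite /exp_poly big_ord_recr.
have -> : exp_poly n.+1 u = exp_poly n u + u ^+ n / n`!%:R by rewrite /exp_poly big_ord_recr.
apply: is_deriveD.
have -> : u ^+ n / n`!%:R = n.+1%:R * u ^+ n * (n.+1`!%:R)^-1 :> R.
  by rewrite factS natrM invfM mulrACA divff ?mul1r// pnatr_eq0.
move: (n.+1`!%:R)^-1 => F.
have dX := is_derive_Xn n.+1 u.
by apply: is_derive_eq; rewrite /GRing.scale /=; ring.
Qed.

Lemma exp_poly0 n : exp_poly n.+1 0 = 1.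
Proof.
rewrite /exp_poly big_ord_recl big1 ?addr0; first by rewrite expr0 fact0 divr1.
by move=> i _; rewrite expr0n mul0r.
Qed.

Lemma exp_poly3 (u : R) : exp_poly 3 u = 1 + u + u ^+ 2 / 2.
Proof.
rewrite /exp_poly !big_ord_recr big_ord0 /= (_ : 0`! = 1)%N// (_ : 1`! = 1)%N// (_ : 2`! = 2)%N//.
by field.
Qed.

Lemma expR_taylor_pos n (u : R) : 0 <= u ->
  0 <= expR u - exp_poly n u <= u ^+ n * expR u.
Proof.
elim: n u => [|n IH] u u0; first by rewrite /exp_poly big_ord0 subr0 expr0 mul1r expR_ge0 lexx.
apply/andP; split; move: u u0.
  move=> u u0; rewrite subr_ge0; move: u u0.
  apply: (derive_le _ (is_derive_exp_poly n)); last by rewrite exp_poly0 expR0.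
  by move=> x /IH /andP[]; rewrite subr_ge0.
move=> u u0; rewrite -subr_ge0; move: u u0.
have fd (u : R) : is_derive u 1 (fun u => u ^+ n.+1 * expR u - (expR u - exp_poly n.+1 u))
    (n.+1%:R * u ^+ n * expR u + u ^+ n.+1 * expR u - (expR u - exp_poly n u)).
  have dp := is_derive_exp_poly n u; apply: is_deriveB.
  have dX := is_derive_Xn n.+1 u.
  by apply: is_derive_eq; rewrite /GRing.scale /=; ring.
apply: (ge0_derive_ge0 fd).
  by rewrite exp_poly0 expR0 expr0n /= mul0r subrr subr0.
move=> x x0; have /andP[_ h] := IH x x0.
have h1 : 0 <= x ^+ n * expR x by rewrite mulr_ge0 ?exprn_ge0 ?expR_ge0.
have h2 : 0 <= x ^+ n.+1 * expR x by rewrite mulr_ge0 ?exprn_ge0 ?expR_ge0.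
have h3 : 0 <= n%:R * (x ^+ n * expR x) by rewrite mulr_ge0.
rewrite -natr1; lra.
Qed.

Lemma expR_taylor_neg n (u : R) : 0 <= u ->
  0 <= (-1) ^+ n * (expR (- u) - exp_poly n (- u)) <= u ^+ n.
Proof.
elim: n u => [|n IH] u u0.
  by rewrite /exp_poly big_ord0 subr0 expr0 mul1r expR_ge0 expR_le1 oppr_le0.
have fd (v : R) : is_derive v 1 (fun u => (-1) ^+ n.+1 * (expR (- u) - exp_poly n.+1 (- u)))
    ((-1) ^+ n * (expR (- v) - exp_poly n (- v))).
  have d0 : is_derive v 1 (fun s : R => - s) (- 1) by apply: is_derive_eq.
  have d1 : is_derive v 1 (fun s => exp_poly n.+1 (- s)) (- exp_poly n (- v)).
    have := @is_derive1_comp _ (exp_poly n.+1) (fun s : R => - s) v _ _ (is_derive_exp_poly n _) d0.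
    by rewrite mulrN1.
  have d2 : is_derive v 1 (fun s => expR (- s)) (- expR (- v)).
    have := @is_derive1_comp _ (@expR R) (fun s : R => - s) v _ _ (is_derive_expR _) d0.
    by rewrite mulrN1.
  by apply: is_derive_eq; rewrite /GRing.scale /= exprS; ring.
apply/andP; split; move: u u0.
  apply: (ge0_derive_ge0 fd); first by rewrite oppr0 exp_poly0 expR0 subrr mulr0.
  by move=> x /IH /andP[].
move=> u u0; rewrite -subr_ge0; move: u u0.
have fd' (v : R) : is_derive v 1 (fun u => u ^+ n.+1 - (-1) ^+ n.+1 * (expR (- u) - exp_poly n.+1 (- u)))
    (n.+1%:R * v ^+ n - ((-1) ^+ n * (expR (- v) - exp_poly n (- v)))).
  have := fd v => fdv; apply: is_deriveB.
  exact: is_derive_Xn.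
apply: (ge0_derive_ge0 fd').
  by rewrite oppr0 exp_poly0 expR0 subrr mulr0 expr0n /= subr0.
move=> x x0; have /andP[_ h] := IH x x0.
have h3 : 0 <= n%:R * x ^+ n by rewrite mulr_ge0 ?exprn_ge0.
rewrite -natr1; lra.
Qed.

Lemma expR_taylor n (u : R) : `|expR u - exp_poly n u| <= `|u| ^+ n * expR `|u|.
Proof.
have [u0|/ltW u0] := leP 0 u.
  by have /andP[h1 h2] := expR_taylor_pos n u0; rewrite (ger0_norm u0) ger0_norm.
have u0' : 0 <= - u by rewrite oppr_ge0.
have /andP[] := expR_taylor_neg n u0'; rewrite opprK => h1 h2.
rewrite (ler0_norm u0); have -> : `|expR u - exp_poly n u| = (-1) ^+ n * (expR u - exp_poly n u).
  by rewrite -[RHS]ger0_norm// normrM normrX normrN1 expr1n mul1r.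
apply: (le_trans h2); rewrite ler_peMr ?exprn_ge0//.
by rewrite -[leLHS]expR0 ler_expR.
Qed.

Lemma cos_taylor (x : R) : `|cos x - (1 - x ^+ 2 / 2 + x ^+ 4 / 24)| <= x ^+ 6.
Proof.
wlog x0 : x / 0 <= x.
  move=> H; have [/H//|/ltW x0] := leP 0 x.
  have := H (- x); rewrite cosN oppr_ge0 => /(_ x0).
  have -> : (- x) ^+ 2 = x ^+ 2 by ring.
  have -> : (- x) ^+ 4 = x ^+ 4 by ring.
  by have -> : (- x) ^+ 6 = x ^+ 6 by ring.
have h1 := cos_le_T4 x0; have h2 := cos_ge_T6 x0.
have h3 : 0 <= x ^+ 6 by rewrite exprn_ge0.
have h4 : x ^+ 6 / (6 * 120) <= x ^+ 6.
  by rewrite ler_pdivrMr ?mulr_gt0// ler_peMr//; lra.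
by rewrite ler_norml; apply/andP; split; lra.
Qed.

End ExpTaylor.

Section Matching.
Variable R : realType.

Lemma small_eq0 (c M : R) : (forall x, 0 < x -> x <= 1 -> `|c| <= x * M) -> c = 0.
Proof.
move=> H; apply/eqP; rewrite -normr_le0; apply/ler_addgt0Pr => e e0; rewrite add0r.
have M1 : 0 < `|M| + 1 + e by rewrite addr_gt0 ?ltr_wpDl.
have x0 : 0 < e / (`|M| + 1 + e) by rewrite divr_gt0.
apply: le_trans (H _ x0 _) _.
  by rewrite ler_pdivrMr// mul1r; have := normr_ge0 M; lra.
rewrite mulrAC ler_pdivrMr// ler_pM2l//; have := ler_norm M; lra.
Qed.

Lemma quadratic_eq0 (c0 c1 c2 C : R) :
  (forall x, 0 < x -> x <= 1 -> `|c0 + c1 * x + c2 * x ^+ 2| <= C * x ^+ 3) ->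
  [/\ c0 = 0, c1 = 0 & c2 = 0].
Proof.
move=> H; have C0 : 0 <= C.
  have := H 1 ltr01 (lexx _); rewrite !expr1n !mulr1; apply: le_trans; exact: normr_ge0.
have e0 : c0 = 0.
  apply: (@small_eq0 _ (C + `|c1| + `|c2|)) => x x0 x1.
  have -> : c0 = (c0 + c1 * x + c2 * x ^+ 2) - c1 * x - c2 * x ^+ 2 by ring.
  have x2 : x ^+ 2 <= x by rewrite expr2 ler_piMl// ltW.
  have x3 : x ^+ 3 <= x by rewrite exprSr ler_piMl ?exprn_ile1 ?(ltW x0)//.
  apply: le_trans (ler_normB _ _) _; apply: le_trans (lerD (ler_normB _ _) (lexx _)) _.
  rewrite (normrM c1) (normrM c2) normrX (gtr0_norm x0).
  have := H x x0 x1; have := ler_wpM2l C0 x3; have := ler_wpM2l (normr_ge0 c2) x2; lra.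
have e1 : c1 = 0.
  apply: (@small_eq0 _ (C + `|c2|)) => x x0 x1.
  have := H x x0 x1; rewrite e0 add0r.
  have -> : c1 * x + c2 * x ^+ 2 = x * (c1 + c2 * x) by ring.
  have -> : C * x ^+ 3 = x * (C * x ^+ 2) by ring.
  rewrite normrM (gtr0_norm x0) ler_pM2l// => h.
  have x2 : x ^+ 2 <= x by rewrite expr2 ler_piMl// ltW.
  have -> : c1 = (c1 + c2 * x) - c2 * x by ring.
  apply: le_trans (ler_normB _ _) _; rewrite normrM (gtr0_norm x0).
  have := ler_wpM2l C0 x2; lra.
split=> //; apply: (@small_eq0 _ C) => x x0 x1.
have := H x x0 x1; rewrite e0 e1 mul0r !add0r (normrM c2) normrX (gtr0_norm x0).
have -> : C * x ^+ 3 = (x * C) * x ^+ 2 by ring.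
by rewrite ler_pM2r// exprn_gt0.
Qed.

Lemma match_expansions (u0 u1 u2 v0 v1 v2 w CU CV : R) : 0 <= w ->
  (forall x, 0 < x -> x <= 1 -> exists eU eV, [/\ `|eU| <= CU * x ^+ 3,
     `|eV| <= CV * x ^+ 3 &
     u0 + u1 * x + u2 * x ^+ 2 + eU = expR (- (w * x)) * (v0 + v1 * x + v2 * x ^+ 2 + eV)]) ->
  [/\ u0 = v0, u1 = v1 - w * v0 & u2 = v2 - w * v1 + w ^+ 2 / 2 * v0].
Proof.
move=> w0 H.
pose D := w * `|v2| + w ^+ 2 * `|v1| + w ^+ 2 * `|v2| + w ^+ 3 * (`|v0| + `|v1| + `|v2|).
have [|e0 e1 e2] := @quadratic_eq0 (u0 - v0) (u1 - v1 + w * v0)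
   (u2 - v2 + w * v1 - w ^+ 2 / 2 * v0) (CU + CV + D); last by split; lra.
move=> x x0 x1; have [eU [eV [hU hV E]]] := H x x0 x1.
have wx0 : 0 <= w * x by rewrite mulr_ge0// ltW.
have /andP[] := expR_taylor_neg 3 wx0.
rewrite exp_poly3 => h1 h2.
pose ee := expR (- (w * x)) - (1 - w * x + (w * x) ^+ 2 / 2).
have hee : `|ee| <= w ^+ 3 * x ^+ 3.
  rewrite -exprMn -[(-1) ^+ 3]signr_odd /= expr1 sqrrN in h1 h2 *.
  by rewrite ler0_norm /ee; lra.
have E2 : u0 - v0 + (u1 - v1 + w * v0) * x + (u2 - v2 + w * v1 - w ^+ 2 / 2 * v0) * x ^+ 2
  = - eU + (- (w * v2) * x ^+ 3 + w ^+ 2 * v1 / 2 * x ^+ 3 + w ^+ 2 * v2 / 2 * x * x ^+ 3)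
    + ee * (v0 + v1 * x + v2 * x ^+ 2) + expR (- (w * x)) * eV.
  have -> : eU = expR (- (w * x)) * (v0 + v1 * x + v2 * x ^+ 2 + eV) - (u0 + u1 * x + u2 * x ^+ 2).
    by rewrite -E; ring.
  by rewrite /ee; field.
have x30 : 0 <= x ^+ 3 by rewrite exprn_ge0// ltW.
have xx : x ^+ 2 <= 1 by rewrite expr_le1// ltW.
rewrite E2; apply: le_trans (ler_normD _ _) _.
apply: le_trans (lerD (ler_normD _ _) (lexx _)) _.
apply: le_trans (lerD (lerD (ler_normD _ _) (lexx _)) (lexx _)) _.
have b4 : `|expR (- (w * x)) * eV| <= CV * x ^+ 3.
  rewrite normrM (ger0_norm (expR_ge0 _)); apply: le_trans hV.
  by rewrite ler_piMl// expR_le1 oppr_le0.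
have b3 : `|ee * (v0 + v1 * x + v2 * x ^+ 2)| <= w ^+ 3 * x ^+ 3 * (`|v0| + `|v1| + `|v2|).
  rewrite normrM ler_pM//; apply: le_trans (ler_normD _ _) _.
  apply: le_trans (lerD (ler_normD _ _) (lexx _)) _.
  rewrite (normrM v1) (normrM v2) normrX (gtr0_norm x0) lerD// ?lerD//.
    by rewrite ler_piMr.
  by rewrite ler_piMr.
have w2 : 0 <= w ^+ 2 by rewrite exprn_ge0.
have b2 : `|- (w * v2) * x ^+ 3 + w ^+ 2 * v1 / 2 * x ^+ 3 + w ^+ 2 * v2 / 2 * x * x ^+ 3|
    <= (w * `|v2| + w ^+ 2 * `|v1| + w ^+ 2 * `|v2|) * x ^+ 3.
  have -> : - (w * v2) * x ^+ 3 + w ^+ 2 * v1 / 2 * x ^+ 3 + w ^+ 2 * v2 / 2 * x * x ^+ 3 =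
     (- (w * v2) + w ^+ 2 * v1 / 2 + w ^+ 2 * v2 / 2 * x) * x ^+ 3 by ring.
  rewrite normrM (ger0_norm x30) ler_wpM2r//.
  apply: le_trans (ler_normD _ _) _; apply: le_trans (lerD (ler_normD _ _) (lexx _)) _.
  have half0 : 0 <= 2^-1 :> R by rewrite invr_ge0.
  have -> : `|- (w * v2)| = w * `|v2| by rewrite normrN normrM ger0_norm.
  have wE v : `|w ^+ 2 * v / 2| = w ^+ 2 * `|v| / 2.
    by rewrite normrM (ger0_norm half0) normrM (ger0_norm w2).
  rewrite (normrM _ x) !wE (gtr0_norm x0).
  have n1 : 0 <= w ^+ 2 * `|v1| by rewrite mulr_ge0.
  have n2 : 0 <= w ^+ 2 * `|v2| by rewrite mulr_ge0.
  have n3 : w ^+ 2 * `|v2| / 2 * x <= w ^+ 2 * `|v2| / 2 by rewrite ler_piMr// divr_ge0.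
  lra.
rewrite normrN /D; lra.
Qed.

End Matching.

Lemma rsum_sum (R : realType) (T : choiceType) (I : Type) (r : seq I) (F : I -> T -> R) :
  (forall i, rsummable (F i)) ->
  rsummable (fun z => \sum_(i <- r) F i z) /\
  rsum (fun z => \sum_(i <- r) F i z) = \sum_(i <- r) rsum (F i).
Proof.
move=> sF; elim: r => [|i r [s1 e1]].
  have -> : (fun z => \sum_(i <- [::]) F i z) = fun=> 0 by apply/funext => z; rewrite big_nil.
  split; first exact: rsummable_eq0.
  by rewrite big_nil rsum_ge0E// esum1.
have -> : (fun z => \sum_(j <- i :: r) F j z) = (fun z => F i z + \sum_(j <- r) F j z).
  by apply/funext => z; rewrite big_cons.
by split; [exact: rsummableD|rewrite rsumD// e1 big_cons].
Qed.

Section ThetaRelations.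
Variables (R : realType) (T : choiceType) (X y : T -> R) (g G : R) (h : nat) (sg : T -> T).
Local Notation pi := (@pi R).
Hypothesis X0 : forall z, 0 <= X z.
Hypothesis sX : forall c, 0 < c -> rsummable (fun z => expR (- (c * X z))).
Hypothesis G0 : 0 < G.
Hypothesis yX : forall z, y z ^+ 2 <= G * X z.
Hypothesis g0 : 0 <= g.
Hypothesis sg_bij : bijective sg.
Hypothesis X_sg : forall z, X (sg z) = X z.
Hypothesis y_sg : forall z, y (sg z) = - y z.
Hypothesis inversion : forall t b, 0 < t ->
  t ^+ h * rsum (fun z => expR (- (t * X z)) * cos (2 * pi * b * y z)) =
  rsum (fun z => expR (- (X z / t) + 2 * pi * b * y z / t - pi * b ^+ 2 * g / t)).

Lemma moment_summable k c : 0 < c -> rsummable (fun z => y z ^+ k * expR (- (c * X z))).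
Proof.
move=> c0; pose c' := c / (2 * G).
have c'0 : 0 < c' by rewrite divr_gt0// mulr_gt0.
apply: (@rsummable_le _ _ _
  (fun z => k`!%:R / c' ^+ k * expR c' * expR (- (c / 2 * X z)))); last first.
  by apply: rsummableZ; apply: sX; rewrite divr_gt0.
move=> z; rewrite normrM (ger0_norm (expR_ge0 _)) normrX.
have GX : 0 <= G * X z by rewrite mulr_ge0// ltW.
have yz : `|y z| <= 1 + G * X z.
  have := yX z; rewrite -real_normK ?num_real// => H.
  have := sqr_ge0 (`|y z| - 1); rewrite !expr2 in H *; lra.
have yk : `|y z| ^+ k <= (1 + G * X z) ^+ k by rewrite lerXn2r ?nnegrE// addr_ge0.
have := @Xn_le_expR _ (1 + G * X z) c' k (addr_ge0 ler01 GX) c'0 => hk.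
apply: le_trans (ler_wpM2r (expR_ge0 _) (le_trans yk hk)) _.
rewrite -!mulrA -!expRD; do 2![rewrite ler_wpM2l ?invr_ge0 ?exprn_ge0 ?(ltW c'0)//].
have G0' : G != 0 by rewrite gt_eqF.
have e : c' * (1 + G * X z) = c' + c / 2 * X z by rewrite /c'; field.
by rewrite ler_expR; move: e; rewrite /c'; lra.
Qed.

Let A k t := rsum (fun z => y z ^+ k * expR (- (t * X z))).

Let A_odd k t : odd k -> A k t = 0.
Proof.
move=> ok; have : A k t = - A k t.
  rewrite {1}/A (rsum_bij _ sg_bij) -rsumN; congr rsum; apply/funext => z /=.
  by rewrite X_sg y_sg exprNn -signr_odd ok expr1 mulN1r mulNr.
by lra.
Qed.

Let moments t : 0 < t -> [/\ t ^+ h * A 0 t = A 0 t^-1,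
  - (2 * pi ^+ 2 * t ^+ h * A 2 t) = 2 * pi ^+ 2 / t ^+ 2 * A 2 t^-1 - pi * g / t * A 0 t^-1 &
  2 / 3 * pi ^+ 4 * t ^+ h * A 4 t = 2 / 3 * pi ^+ 4 / t ^+ 4 * A 4 t^-1
    - pi * g / t * (2 * pi ^+ 2 / t ^+ 2 * A 2 t^-1) + (pi * g / t) ^+ 2 / 2 * A 0 t^-1].
Proof.
move=> t0; have ti0 : 0 < t^-1 by rewrite invr_gt0.
have p0 := @pi_gt0 R; have tN : t != 0 by rewrite gt_eqF.
have w0 : 0 <= pi * g / t.
  by apply: divr_ge0; [apply: mulr_ge0 => //; exact: pi_ge0|exact: ltW].
pose CU := t ^+ h * ((2 * pi) ^+ 6 * A 6 t).
pose CV := (2 * pi / t) ^+ 6 * expR (2 * pi ^+ 2 * G / t) * A 6 (t^-1 / 2).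
apply: (@match_expansions R (t ^+ h * A 0 t) (- (2 * pi ^+ 2 * t ^+ h * A 2 t))
  (2 / 3 * pi ^+ 4 * t ^+ h * A 4 t) (A 0 t^-1) (2 * pi ^+ 2 / t ^+ 2 * A 2 t^-1)
  (2 / 3 * pi ^+ 4 / t ^+ 4 * A 4 t^-1) (pi * g / t) CU CV w0).
move=> x x0 x1; pose b := Num.sqrt x.
have b2 : b ^+ 2 = x by rewrite sqr_sqrtr// ltW.
pose ru z := cos (2 * pi * b * y z) - (1 - (2 * pi * b * y z) ^+ 2 / 2 + (2 * pi * b * y z) ^+ 4 / 24).
have [a aE] : exists a, a = 2 * pi * b / t by exists (2 * pi * b / t).
pose rv z := expR (a * y z) - exp_poly 6 (a * y z).
have ru_le z : `|expR (- (t * X z)) * ru z| <= ((2 * pi) ^+ 6 * x ^+ 3) * (y z ^+ 6 * expR (- (t * X z))).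
  rewrite normrM (ger0_norm (expR_ge0 _)).
  have -> : (2 * pi) ^+ 6 * x ^+ 3 * (y z ^+ 6 * expR (- (t * X z))) =
    expR (- (t * X z)) * (2 * pi * b * y z) ^+ 6 by rewrite -b2; ring.
  by rewrite ler_wpM2l ?expR_ge0// cos_taylor.
have ay_le z : `|a * y z| <= t^-1 / 2 * X z + 2 * pi ^+ 2 * G / t.
    have q0 : 0 < 2 * G * t by rewrite !mulr_gt0.
    have s1 : `|a * y z| <= (y z ^+ 2 + (a * (G * t)) ^+ 2) / (2 * G * t).
      rewrite ler_pdivlMr// -[y z ^+ 2]real_normK ?num_real// -[(a * _) ^+ 2]real_normK ?num_real//.
      rewrite !normrM (gtr0_norm G0) (gtr0_norm t0).
      by have := sqr_ge0 (`|y z| - `|a| * (G * t)); rewrite !expr2; lra.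
    have GN : G != 0 by rewrite gt_eqF.
    have s2 : (y z ^+ 2 + (a * (G * t)) ^+ 2) / (2 * G * t) <=
       (G * X z + (a * (G * t)) ^+ 2) / (2 * G * t).
      by rewrite ler_pM2r ?invr_gt0// lerD2r.
    have s3 : (G * X z + (a * (G * t)) ^+ 2) / (2 * G * t) = t^-1 / 2 * X z + 2 * pi ^+ 2 * G / t * x.
      by rewrite -b2 aE; move: (pi) => P; field; rewrite GN tN.
    have s4 : 2 * pi ^+ 2 * G / t * x <= 2 * pi ^+ 2 * G / t.
      by rewrite ler_piMr// divr_ge0 ?(ltW t0)// !mulr_ge0 ?exprn_ge0 ?ltW.
    by move: s1 s2 s4; rewrite s3; lra.
have rv_le z : `|expR (- (t^-1 * X z)) * rv z| <=
    ((2 * pi / t) ^+ 6 * x ^+ 3 * expR (2 * pi ^+ 2 * G / t)) * (y z ^+ 6 * expR (- (t^-1 / 2 * X z))).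
  rewrite normrM (ger0_norm (expR_ge0 _)).
  have ha : `|a * y z| ^+ 6 = (2 * pi / t) ^+ 6 * x ^+ 3 * y z ^+ 6.
    rewrite -normrX ger0_norm; last by rewrite exprn_even_ge0.
    by rewrite aE -b2; field.
  have hy := ay_le z.
  apply: le_trans (ler_wpM2l (expR_ge0 _) (expR_taylor 6 (a * y z))) _.
  have -> : (2 * pi / t) ^+ 6 * x ^+ 3 * expR (2 * pi ^+ 2 * G / t) * (y z ^+ 6 * expR (- (t^-1 / 2 * X z)))
     = `|a * y z| ^+ 6 * (expR (2 * pi ^+ 2 * G / t) * expR (- (t^-1 / 2 * X z))) by rewrite ha; ring.
  rewrite mulrCA ler_wpM2l ?exprn_ge0// -!expRD ler_expR; lra.
have s6 := moment_summable 6 t0; have s6' : rsummable (fun z => y z ^+ 6 * expR (- (t^-1 / 2 * X z))).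
  by apply: moment_summable; rewrite divr_gt0.
have sru : rsummable (fun z => expR (- (t * X z)) * ru z).
  by apply: rsummable_le ru_le _; exact: rsummableZ.
have srv : rsummable (fun z => expR (- (t^-1 * X z)) * rv z).
  by apply: rsummable_le rv_le _; exact: rsummableZ.
exists (t ^+ h * rsum (fun z => expR (- (t * X z)) * ru z)).
exists (rsum (fun z => expR (- (t^-1 * X z)) * rv z)); split.
- rewrite normrM ger0_norm ?exprn_ge0 ?(ltW t0)// /CU -mulrA ler_wpM2l ?exprn_ge0 ?(ltW t0)//.
  apply: le_trans (ler_norm_rsum sru) _.
  rewrite -mulrA [A 6 t * _]mulrC mulrA -rsumZ//.
  by apply: ler_rsum => //; [exact: rsummable_norm|exact: rsummableZ].
- rewrite /CV; apply: le_trans (ler_norm_rsum srv) _.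
  have -> : (2 * pi / t) ^+ 6 * expR (2 * pi ^+ 2 * G / t) * A 6 (t^-1 / 2) * x ^+ 3 =
    (2 * pi / t) ^+ 6 * x ^+ 3 * expR (2 * pi ^+ 2 * G / t) * A 6 (t^-1 / 2) by ring.
  rewrite -rsumZ//.
  by apply: ler_rsum => //; [exact: rsummable_norm|exact: rsummableZ].
have sm k := moment_summable k t0; have sm' k := moment_summable k ti0.
have -> : t ^+ h * A 0 t + - (2 * pi ^+ 2 * t ^+ h * A 2 t) * x + 2 / 3 * pi ^+ 4 * t ^+ h * A 4 t * x ^+ 2
   + t ^+ h * rsum (fun z => expR (- (t * X z)) * ru z) =
   t ^+ h * rsum (fun z => expR (- (t * X z)) * cos (2 * pi * b * y z)).
  have -> : (fun z => expR (- (t * X z)) * cos (2 * pi * b * y z)) =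
     (fun z => y z ^+ 0 * expR (- (t * X z)) + - (2 * pi ^+ 2 * x) * (y z ^+ 2 * expR (- (t * X z)))
       + 2 / 3 * pi ^+ 4 * x ^+ 2 * (y z ^+ 4 * expR (- (t * X z))) + expR (- (t * X z)) * ru z).
    by apply/funext => z; rewrite /ru -b2; field.
  have q1 := rsummableZ (- (2 * pi ^+ 2 * x)) (sm 2%N).
  have q2 := rsummableZ (2 / 3 * pi ^+ 4 * x ^+ 2) (sm 4%N).
  rewrite (rsumD (rsummableD (rsummableD (sm 0%N) q1) q2) sru).
  rewrite (rsumD (rsummableD (sm 0%N) q1) q2) (rsumD (sm 0%N) q1).
  rewrite (rsumZ _ (sm 2%N)) (rsumZ _ (sm 4%N)).
  have AE k : rsum (fun z => y z ^+ k * expR (- (t * X z))) = A k t by [].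
  by rewrite !AE; ring.
rewrite inversion//.
have -> : rsum (fun z => expR (- (X z / t) + 2 * pi * b * y z / t - pi * b ^+ 2 * g / t)) =
   expR (- (pi * g / t * x)) * rsum (fun z => expR (- (t^-1 * X z)) * expR (a * y z)).
  rewrite -rsumZ.
    congr rsum; apply/funext => z; rewrite -!expRD; congr expR; rewrite aE -b2; field.
    by rewrite tN.
  apply: (@rsummable_le _ _ _ (fun z => expR (2 * pi ^+ 2 * G / t) * expR (- (t^-1 / 2 * X z)))).
    move=> z; rewrite -expRD ger0_norm ?expR_ge0// -expRD ler_expR.
    have := ay_le z; have := ler_norm (a * y z); lra.
  by apply: rsummableZ; apply: sX; rewrite divr_gt0.
congr (_ * _); pose F (i : 'I_6) z := a ^+ i / i`!%:R * (y z ^+ i * expR (- (t^-1 * X z))).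
have sF i : rsummable (F i) by apply: rsummableZ.
have [sF' eF'] := rsum_sum (index_enum 'I_6) sF.
have -> : (fun z => expR (- (t^-1 * X z)) * expR (a * y z)) =
    (fun z => \sum_(i < 6) F i z + expR (- (t^-1 * X z)) * rv z).
  apply/funext => z; have -> : \sum_(i < 6) F i z = expR (- (t^-1 * X z)) * exp_poly 6 (a * y z).
    by rewrite /exp_poly mulr_sumr; apply: eq_bigr => i _; rewrite /F exprMn; ring.
  by rewrite /rv -mulrDr addrC subrK.
rewrite (rsumD sF' srv) eF'; congr (_ + _).
have FE (i : 'I_6) : rsum (F i) = a ^+ i / i`!%:R * A i t^-1 by rewrite rsumZ.
rewrite (eq_bigr _ (fun i _ => FE i)) !big_ord_recr big_ord0 /=.
rewrite (A_odd _ (k := 1))// (A_odd _ (k := 3))// (A_odd _ (k := 5))//.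
rewrite (_ : 0`! = 1)%N// (_ : 2`! = 2)%N// (_ : 4`! = 24)%N//.
have -> : a ^+ 2 = 4 * pi ^+ 2 / t ^+ 2 * x by rewrite aE -b2; field.
have -> : a ^+ 4 = 16 * pi ^+ 4 / t ^+ 4 * x ^+ 2 by rewrite aE -b2; field.
by rewrite !mulr0; field.
Qed.

Local Notation k0 := (h%:R / 2 : R).

Let psiE k s : psi X (fun z => y z ^+ k) (k0 + k%:R / 2) 1 s =
  expR (s / 2) ^+ (h + k) * A k (expR s).
Proof.
rewrite /psi /A -rsumZ; last by apply: moment_summable; exact: expR_gt0.
congr rsum; apply/funext => z; rewrite hornerC mul1r mulrCA; congr (_ * _).
by rewrite -expRM_natl -expRD; congr expR; rewrite natrD; field.
Qed.

Definition rpoly (k : R) (j : nat) : {poly R} := iter j (Dpoly k) 1.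

Definition psij k j s := psi X (fun z => y z ^+ k) (k0 + k%:R / 2) (rpoly (k0 + k%:R / 2) j) s.

Let psij_derive k j (s : R) : is_derive s 1 (psij k j) (psij k j.+1 s).
Proof. exact: (psi_derive X0 (@moment_summable k) _ (rpoly _ j) s). Qed.

Let inv_rel s : [/\ psij 0 0 (- s) = psij 0 0 s,
  2 * pi ^+ 2 * (psij 2 0 (- s) + psij 2 0 s) = pi * g * psij 0 0 s &
  2 / 3 * pi ^+ 4 * (psij 4 0 s - psij 4 0 (- s)) =
    pi ^+ 2 * g ^+ 2 / 2 * psij 0 0 s - 2 * pi ^+ 3 * g * psij 2 0 (- s)].
Proof.
rewrite /psij /rpoly /= !psiE.
have a0 : expR (s / 2) != 0 by rewrite gt_eqF ?expR_gt0.
have -> : expR (- s / 2) = (expR (s / 2))^-1 by rewrite mulNr expRN.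
have -> : expR (- s) = (expR s)^-1 by rewrite expRN.
have [] := moments (expR_gt0 s).
have -> : expR s = expR (s / 2) ^+ 2 by rewrite -expRM_natl; congr expR; field.
rewrite addn0 !exprD; move: (expR (s / 2)) a0 => a a0.
have -> : (a ^+ 2) ^+ h = (a ^+ h) ^+ 2 by rewrite -!exprM mulnC.
have q0 : a ^+ h != 0 by rewrite expf_neq0.
rewrite !exprVn; move: (a ^+ h) q0 => q q0.
move: (A 0 (a ^+ 2)) (A 0 (a ^+ 2)^-1) (A 2 (a ^+ 2)) (A 2 (a ^+ 2)^-1) (A 4 (a ^+ 2)) (A 4 (a ^+ 2)^-1) (pi).
move=> A0 A0' A2 A2' A4 A4' P m0 m2 m4.
split; apply/eqP; rewrite -subr_eq0.
- have -> : q^-1 * A0' - q * A0 = q^-1 * (A0' - q ^+ 2 * A0) by field.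
  by rewrite m0 subrr mulr0.
- have -> : 2 * P ^+ 2 * (q^-1 / a ^+ 2 * A2' + q * a ^+ 2 * A2) - P * g * (q * A0) =
    a ^+ 2 / q * (2 * P ^+ 2 / (a ^+ 2) ^+ 2 * A2' - P * g / a ^+ 2 * A0'
      - - (2 * P ^+ 2 * q ^+ 2 * A2)) + P * g / q * (A0' - q ^+ 2 * A0).
    by field; rewrite q0 a0.
  by rewrite m0 m2 !subrr !mulr0 addr0.
have -> : 2 / 3 * P ^+ 4 * (q * a ^+ 4 * A4 - q^-1 / a ^+ 4 * A4') -
   (P ^+ 2 * g ^+ 2 / 2 * (q * A0) - 2 * P ^+ 3 * g * (q^-1 / a ^+ 2 * A2')) =
   a ^+ 4 / q * (2 / 3 * P ^+ 4 * q ^+ 2 * A4 - (2 / 3 * P ^+ 4 / (a ^+ 2) ^+ 4 * A4'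
    - P * g / a ^+ 2 * (2 * P ^+ 2 / (a ^+ 2) ^+ 2 * A2') + (P * g / a ^+ 2) ^+ 2 / 2 * A0'))
   + P ^+ 2 * g ^+ 2 / (2 * q) * (A0' - q ^+ 2 * A0).
  by field; rewrite q0 a0.
by rewrite m0 -m4 !subrr !mulr0 addr0.
Qed.

Lemma theta_rel0 j : odd j -> psij 0 j 0 = 0.
Proof.
move=> oj; apply: (@parity_derive0 _ (psij 0) false); last by rewrite addn0.
  exact: psij_derive.
by move=> s; have [-> _ _] := inv_rel s; rewrite expr0 mul1r.
Qed.

Lemma theta_rel2 j : ~~ odd j -> 2 * pi ^+ 2 * psij 2 j 0 - pi * g / 2 * psij 0 j 0 = 0.
Proof.
move=> oj; pose F j s := 2 * pi ^+ 2 * psij 2 j s - pi * g / 2 * psij 0 j s.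
apply: (@parity_derive0 _ F true); last by rewrite addn1.
  move=> i s; have d2 := psij_derive 2 i s; have d0 := psij_derive 0 i s.
  by rewrite /F; apply: is_derive_eq.
move=> s; have [h0 h2 _] := inv_rel s; rewrite /F h0 expr1; lra.
Qed.

Lemma theta_rel4 j : odd j ->
  2 / 3 * pi ^+ 4 * psij 4 j 0 - pi ^+ 3 * g * psij 2 j 0 + pi ^+ 2 * g ^+ 2 / 4 * psij 0 j 0 = 0.
Proof.
move=> oj; pose F j s := 2 / 3 * pi ^+ 4 * psij 4 j s - pi ^+ 3 * g * psij 2 j s
  + pi ^+ 2 * g ^+ 2 / 4 * psij 0 j s.
apply: (@parity_derive0 _ F false); last by rewrite addn0.
  move=> i s; have d4 := psij_derive 4 i s; have d2 := psij_derive 2 i s.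
  have d0 := psij_derive 0 i s.
  by rewrite /F; apply: is_derive_eq.
move=> s; have [h0 h2 h4] := inv_rel s; rewrite /F h0 expr0 mul1r.
move: (psij 0 0 s) (psij 2 0 s) (psij 2 0 (- s)) (psij 4 0 s) (psij 4 0 (- s)) (pi) h2 h4.
move=> a b b' c c' P h2 h4; apply/eqP; rewrite -subr_eq0.
have -> : 2 / 3 * P ^+ 4 * c' - P ^+ 3 * g * b' + P ^+ 2 * g ^+ 2 / 4 * a
    - (2 / 3 * P ^+ 4 * c - P ^+ 3 * g * b + P ^+ 2 * g ^+ 2 / 4 * a) =
  (P ^+ 2 * g ^+ 2 / 2 * a - 2 * P ^+ 3 * g * b' - 2 / 3 * P ^+ 4 * (c - c'))
  + P * g / 2 * (2 * P ^+ 2 * (b' + b) - P * g * a) by field.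
by rewrite h2 h4 !subrr mulr0 addr0.
Qed.

End ThetaRelations.

Section DotProduct.
Variables (R : realType) (n : nat).
Implicit Types (x v : 'cV[R]_n) (K : 'M[R]_n).

Lemma dotp_ge0 x : 0 <= dotp x x.
Proof. by rewrite dotpE sumr_ge0// => i _; rewrite -expr2 sqr_ge0. Qed.

Lemma dotp_eq0 x : (dotp x x == 0) = (x == 0).
Proof.
apply/idP/idP => [|/eqP ->]; last by rewrite dotpE big1// => i _; rewrite mxE mul0r.
rewrite dotpE psumr_eq0 => [/allP h|i _]; last by rewrite -expr2 sqr_ge0.
apply/eqP/matrixP => i j; rewrite (ord1 j) mxE.
by have := h i (mem_index_enum i); rewrite -expr2 sqrf_eq0 => /eqP.
Qed.

Lemma dotpNl x v : dotp (- x) v = - dotp x v.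
Proof. by rewrite dotpC dotpNr dotpC. Qed.

Lemma dotp_CS x v : dotp x v ^+ 2 <= dotp x x * dotp v v.
Proof.
have [/eqP v0|v0] := boolP (dotp v v == 0).
  move: (v0) => /eqP; rewrite dotp_eq0 => /eqP ->.
  have -> : dotp x 0 = 0 by rewrite dotpE big1// => i _; rewrite mxE mulr0.
  by rewrite expr0n /= mulr_ge0 ?dotp_ge0.
have vp : 0 < dotp v v by rewrite lt_def v0 dotp_ge0.
have := dotp_ge0 (dotp v v *: x - dotp x v *: v).
rewrite !(dotpDl, dotpDr, dotpNl, dotpNr, dotpZl, dotpZr) (dotpC v x).
set a := dotp v v in vp v0 *; set b := dotp x v; set c := dotp x x => H.
have : 0 <= a * (c * a - b ^+ 2) by move: H; rewrite !expr2; lra.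
by rewrite pmulr_rge0// subr_ge0.
Qed.

Lemma dotp_mulmx K x v : dotp x (K *m v) = dotp (K^T *m x) v.
Proof. by rewrite /dotp trmx_mul trmxK mulmxA. Qed.

Lemma mxtrace_rank1 v w : \tr (v *m w^T) = dotp w v.
Proof. by rewrite mxtrace_mulC /mxtrace big_ord1. Qed.

Lemma mul_rank1 v w x : (v *m w^T) *m x = dotp w x *: v.
Proof. by rewrite -mulmxA [w^T *m x]mx11_scalar mul_mx_scalar. Qed.

Lemma rank1_polar (k : R) v w :
  (k / 4) *: ((v + w) *m (v + w)^T) - (k / 4) *: ((v - w) *m (v - w)^T)
  = (k / 2) *: (v *m w^T + w *m v^T).
Proof. by apply/matrixP => i j; rewrite !mxE !big_ord1 !mxE; field. Qed.

Lemma sym_rank1 K : K^T = K -> exists (I : finType) (c : I -> R) (w : I -> 'cV[R]_n),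
  K = \sum_p c p *: (w p *m (w p)^T).
Proof.
move=> sK; pose e (i : 'I_n) : 'cV[R]_n := delta_mx i ord0.
exists ('I_n * 'I_n * bool)%type,
  (fun p : 'I_n * 'I_n * bool => K p.1.1 p.1.2 / 4 * (-1) ^+ nat_of_bool p.2),
  (fun p : 'I_n * 'I_n * bool => e p.1.1 + (-1) ^+ nat_of_bool p.2 *: e p.1.2).
have ee i j : e i *m (e j)^T = delta_mx i j by rewrite /e trmx_delta mul_delta_mx.
rewrite -(pair_big xpredT xpredT (fun (ij : 'I_n * 'I_n) (b : bool) => (K ij.1 ij.2 / 4 * (-1) ^+ b) *:
  ((e ij.1 + (-1) ^+ b *: e ij.2) *m (e ij.1 + (-1) ^+ b *: e ij.2)^T))) /=.
rewrite -(pair_big xpredT xpredT (fun i j => \sum_(b : bool) (K i j / 4 * (-1) ^+ b) *: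
  ((e i + (-1) ^+ b *: e j) *m (e i + (-1) ^+ b *: e j)^T))) /=.
have H i j : \sum_(b : bool) (K i j / 4 * (-1) ^+ b) *:
  ((e i + (-1) ^+ b *: e j) *m (e i + (-1) ^+ b *: e j)^T) = (K i j / 2) *: (delta_mx i j + delta_mx j i).
  rewrite big_bool /= expr0 expr1 mulrN1 mulr1 scale1r scaleN1r scaleNr addrC.
  by rewrite rank1_polar !ee.
transitivity (\sum_i \sum_j ((K i j / 2) *: delta_mx i j + (K i j / 2) *: delta_mx j i : 'M[R]_n));
  last by apply: eq_bigr => i _; apply: eq_bigr => j _; rewrite H scalerDr.
rewrite (eq_bigr _ (fun i _ => big_split _ _ _ _ _)) big_split /= [X in _ + X]exchange_big /=.
rewrite {1}[K]matrix_sum_delta -big_split /=; apply: eq_bigr => i _.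
rewrite -big_split /=; apply: eq_bigr => j _.
have -> : K j i = K i j by rewrite -{1}sK mxE.
by rewrite -scalerDl; congr (_ *: _); field.
Qed.

Section Rank1Sum.
Variables (I : finType) (c : I -> R) (w : I -> 'cV[R]_n).
Let K := \sum_p c p *: (w p *m (w p)^T).

Lemma rank1_mulmx x : K *m x = \sum_p (c p * dotp (w p) x) *: w p.
Proof.
by rewrite mulmx_suml; apply: eq_bigr => p _; rewrite -scalemxAl mul_rank1 scalerA.
Qed.

Lemma dotp_suml (J : finType) (F : J -> 'cV[R]_n) x : dotp (\sum_p F p) x = \sum_p dotp (F p) x.
Proof.
rewrite /dotp raddf_sum mulmx_suml summxE; apply: eq_bigr => p _; by [].
Qed.

Lemma rank1_qform x : qform K x = \sum_p c p * dotp (w p) x ^+ 2.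
Proof.
rewrite qformE rank1_mulmx dotpC dotp_suml; apply: eq_bigr => p _.
by rewrite dotpZl; ring.
Qed.

Lemma rank1_tr : \tr K = \sum_p c p * dotp (w p) (w p).
Proof. by rewrite raddf_sum; apply: eq_bigr => p _; rewrite /= mxtraceZ mxtrace_rank1. Qed.

Lemma rank1_norm x : dotp (K *m x) (K *m x) =
  \sum_p \sum_q c p * c q * (dotp (w p) (w q) * dotp (w p) x * dotp (w q) x).
Proof.
rewrite rank1_mulmx dotp_suml; apply: eq_bigr => p _.
rewrite dotpC dotp_suml; apply: eq_bigr => q _; rewrite dotpZl dotpZr (dotpC (w q) (w p)); ring.
Qed.

Lemma rank1_tr_sqr : \tr (K *m K) = \sum_p \sum_q c p * c q * dotp (w p) (w q) ^+ 2.
Proof.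
rewrite {2}/K mulmx_sumr raddf_sum; apply: eq_bigr => p _ /=.
rewrite -scalemxAr mxtraceZ mulmxA mxtrace_rank1 rank1_mulmx dotpC dotp_suml mulr_sumr.
by apply: eq_bigr => q _; rewrite dotpZl (dotpC (w q)); ring.
Qed.

End Rank1Sum.
End DotProduct.

Section PolyBounded.
Variables (R : realType) (T : choiceType) (X : T -> R).
Hypothesis X0 : forall z, 0 <= X z.

Definition polyb (F : T -> R) : Prop :=
  exists (C : R) (k : nat), 0 <= C /\ forall z, `|F z| <= C * (1 + X z) ^+ k.

Let X1 z : 1 <= 1 + X z. Proof. by rewrite lerDl. Qed.
Let X1' z : 0 <= 1 + X z. Proof. exact: le_trans ler01 (X1 z). Qed.

Lemma polyb_le F G : (forall z, `|F z| <= `|G z|) -> polyb G -> polyb F.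
Proof. by move=> FG [C [k [C0 h]]]; exists C, k; split=> // z; exact: le_trans (h z). Qed.

Lemma polyb_cst (c : R) : polyb (fun=> c).
Proof. by exists `|c|, 0%N; split=> // z; rewrite expr0 mulr1. Qed.

Lemma polyb_X : polyb X.
Proof. by exists 1, 1%N; split=> // z; rewrite mul1r expr1 ger0_norm// lerDr. Qed.

Lemma polybD F G : polyb F -> polyb G -> polyb (fun z => F z + G z).
Proof.
move=> [C [k [C0 h]]] [D [l [D0 h']]]; exists (C + D), (k + l)%N; split; first exact: addr_ge0.
move=> z; apply: le_trans (ler_normD _ _) _; rewrite mulrDl exprD; apply: lerD.
  apply: le_trans (h z) _; rewrite mulrA ler_peMr ?exprn_ege1//.
  by rewrite mulr_ge0 ?exprn_ge0.
apply: le_trans (h' z) _; rewrite mulrCA ler_peMl ?exprn_ege1//.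
by rewrite mulr_ge0 ?exprn_ge0.
Qed.

Lemma polybM F G : polyb F -> polyb G -> polyb (fun z => F z * G z).
Proof.
move=> [C [k [C0 h]]] [D [l [D0 h']]]; exists (C * D), (k + l)%N; split; first exact: mulr_ge0.
by move=> z; rewrite normrM exprD mulrACA ler_pM.
Qed.

Lemma polybZ c F : polyb F -> polyb (fun z => c * F z).
Proof. by move=> h; apply: polybM => //; exact: polyb_cst. Qed.

Lemma polybN F : polyb F -> polyb (fun z => - F z).
Proof. by apply: polyb_le => z; rewrite normrN. Qed.

Lemma polybB F G : polyb F -> polyb G -> polyb (fun z => F z - G z).
Proof. by move=> h h'; apply: polybD => //; exact: polybN. Qed.

Lemma polybXn F k : polyb F -> polyb (fun z => F z ^+ k).
Proof.
move=> h; elim: k => [|k IH]; first exact: (polyb_cst 1).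
by under [X in polyb X]eq_fun do rewrite exprS; exact: polybM.
Qed.

Lemma polyb_sum (I : Type) (r : seq I) (F : I -> T -> R) : (forall i, polyb (F i)) ->
  polyb (fun z => \sum_(i <- r) F i z).
Proof.
move=> h; elim: r => [|i r IH].
  by under [X in polyb X]eq_fun do rewrite big_nil; exact: polyb_cst.
by under [X in polyb X]eq_fun do rewrite big_cons; exact: polybD.
Qed.

Lemma polyb_horner (p : {poly R}) : polyb (fun z => p.[X z]).
Proof.
under [X in polyb X]eq_fun do rewrite horner_coef.
by apply: polyb_sum => i; apply: polybZ; apply: polybXn; exact: polyb_X.
Qed.

Lemma polyb_norm F : polyb F -> polyb (fun z => `|F z|).
Proof. by apply: polyb_le => z; rewrite normr_id. Qed.

Hypothesis sX : forall c, 0 < c -> rsummable (fun z => expR (- (c * X z))).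

Lemma polyb_summable F c : polyb F -> 0 < c -> rsummable (fun z => F z * expR (- (c * X z))).
Proof.
move=> [C [k [C0 h]]] c0; have c2 : 0 < c / 2 by rewrite divr_gt0.
apply: (@rsummable_le _ _ _ (fun z => C * (k`!%:R / (c / 2) ^+ k * expR (c / 2)) * expR (- (c / 2 * X z)))).
  move=> z; rewrite normrM (ger0_norm (expR_ge0 _)).
  have := @Xn_le_expR _ (1 + X z) (c / 2) k (X1' z) c2 => hk.
  apply: le_trans (ler_wpM2r (expR_ge0 _) (le_trans (h z) (ler_wpM2l C0 hk))) _.
  rewrite -!mulrA; do 3![rewrite ler_wpM2l ?invr_ge0 ?exprn_ge0 ?(ltW c2)//].
  by rewrite -!expRD ler_expR; lra.
by apply: rsummableZ; exact: sX.
Qed.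

Definition gsum (F : T -> R) : R := rsum (fun z => F z * expR (- X z)).

Lemma gsummable F : polyb F -> rsummable (fun z => F z * expR (- X z)).
Proof.
move=> h; have := polyb_summable h ltr01.
by under [X in rsummable X -> _]eq_fun do rewrite mul1r.
Qed.

Lemma gsumD F G : polyb F -> polyb G -> gsum (fun z => F z + G z) = gsum F + gsum G.
Proof.
move=> hF hG; rewrite /gsum -rsumD; [|exact: gsummable|exact: gsummable].
by congr rsum; apply/funext => z; rewrite mulrDl.
Qed.

Lemma gsumZ c F : polyb F -> gsum (fun z => c * F z) = c * gsum F.
Proof.
move=> hF; rewrite /gsum -rsumZ; last exact: gsummable.
by congr rsum; apply/funext => z; rewrite mulrA.
Qed.

Lemma gsumB F G : polyb F -> polyb G -> gsum (fun z => F z - G z) = gsum F - gsum G.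
Proof.
move=> hF hG; rewrite (gsumD hF (polybN hG)); congr (_ + _).
by rewrite /gsum -rsumN; congr rsum; apply/funext => z; rewrite mulNr.
Qed.

Lemma gsum_sum (I : Type) (r : seq I) (F : I -> T -> R) : (forall i, polyb (F i)) ->
  gsum (fun z => \sum_(i <- r) F i z) = \sum_(i <- r) gsum (F i).
Proof.
move=> hF; have [_ <-] := rsum_sum r (fun i => gsummable (hF i)).
by congr rsum; apply/funext => z; rewrite mulr_suml.
Qed.

Lemma ler_gsum F G : polyb F -> polyb G -> (forall z, F z <= G z) -> gsum F <= gsum G.
Proof.
move=> hF hG FG; apply: ler_rsum; [exact: gsummable|exact: gsummable|].
by move=> z; rewrite ler_wpM2r// expR_ge0.
Qed.

Lemma ler_norm_gsum F : polyb F -> `|gsum F| <= gsum (fun z => `|F z|).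
Proof.
move=> hF; apply: le_trans (ler_norm_rsum (gsummable hF)) _.
rewrite le_eqVlt; apply/orP; left; apply/eqP; congr rsum; apply/funext => z.
by rewrite normrM (ger0_norm (expR_ge0 _)).
Qed.

Section Polarization.
Variables (n : nat) (lam : T -> 'cV[R]_n).
Hypothesis polyb_lam : forall v, polyb (fun z => dotp v (lam z)).

Lemma polyb_qform (K : 'M[R]_n) : polyb (fun z => qform K (lam z)).
Proof.
under [X in polyb X]eq_fun do rewrite qformE dotpE.
apply: polyb_sum => i; apply: polybM.
  have := polyb_lam (delta_mx i ord0); congr polyb; apply/funext => z.
  rewrite dotpE (bigD1 i)//= big1 ?addr0 ?mxE ?eqxx ?mul1r// => j ji.
  by rewrite mxE (negbTE ji) mul0r.
have := polyb_lam (row i K)^T; congr polyb; apply/funext => z.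
by rewrite dotpE mxE; apply: eq_bigr => j _; rewrite !mxE.
Qed.

Lemma polyb_norm_mul (K : 'M[R]_n) : polyb (fun z => dotp (K *m lam z) (K *m lam z)).
Proof.
have := polyb_qform (K^T *m K); congr polyb; apply/funext => z.
by rewrite qformE -mulmxA dotp_mulmx trmxK.
Qed.

Variables (K : 'M[R]_n).
Hypothesis sK : K^T = K.
Let hh z := qform K (lam z).
Let kk z := dotp (K *m lam z) (K *m lam z).
Let tau := \tr (K *m K).

Lemma polarize2 (al ga : T -> R) : polyb al -> polyb ga ->
  (forall v, gsum (fun z => al z * dotp v (lam z) ^+ 2 - ga z * dotp v v) = 0) ->
  gsum (fun z => al z * hh z - ga z * \tr K) = 0.
Proof.
move=> pa pg H; have [I [c [w KE]]] := sym_rank1 sK.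
have -> : (fun z => al z * hh z - ga z * \tr K) = (fun z => \sum_p
   c p * (al z * dotp (w p) (lam z) ^+ 2 - ga z * dotp (w p) (w p))).
  apply/funext => z; rewrite /hh KE rank1_qform rank1_tr !mulr_sumr -sumrB.
  by apply: eq_bigr => p _; ring.
have pF v : polyb (fun z => al z * dotp v (lam z) ^+ 2 - ga z * dotp v v).
  apply: polybB; apply: polybM => //; last exact: polyb_cst.
  exact: polybXn.
rewrite gsum_sum; last by move=> p; exact: polybZ.
by rewrite big1// => p _; rewrite gsumZ// H mulr0.
Qed.

Lemma polarize4 (al be ga : T -> R) : polyb al -> polyb be -> polyb ga ->
  (forall v, gsum (fun z => al z * dotp v (lam z) ^+ 4
     - be z * (dotp v v * dotp v (lam z) ^+ 2) + ga z * dotp v v ^+ 2) = 0) ->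
  gsum (fun z => al z * hh z ^+ 2 - be z * ((4 * kk z + 2 * \tr K * hh z) / 6)
     + ga z * ((2 * tau + \tr K ^+ 2) / 3)) = 0.
Proof.
move=> pa pb pg H; have [I [c [w KE]]] := sym_rank1 sK.
pose Q v z := al z * dotp v (lam z) ^+ 4
     - be z * (dotp v v * dotp v (lam z) ^+ 2) + ga z * dotp v v ^+ 2.
have pQ v : polyb (Q v).
  apply: polybD; last by apply: polybM => //; exact: polyb_cst.
  apply: polybB; apply: polybM => //; first exact: polybXn.
  by apply: polybZ; exact: polybXn.
pose P u v z := 1 / 12 * (Q (u + v) z + Q (u - v) z - 2 * Q u z - 2 * Q v z).
have pP u v : polyb (P u v).
  by apply: polybZ; apply: polybB; [apply: polybB; [exact: polybD|exact: polybZ]|exact: polybZ].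
have P0 u v : gsum (P u v) = 0.
  have p1 := polybD (pQ (u + v)) (pQ (u - v)); have p2 := polybB p1 (polybZ 2 (pQ u)).
  rewrite /P gsumZ; last by apply: polybB => //; exact: polybZ.
  rewrite (gsumB p2 (polybZ 2 (pQ v))) (gsumB p1 (polybZ 2 (pQ u))) (gsumD (pQ _) (pQ _)).
  by rewrite (gsumZ _ (pQ u)) (gsumZ _ (pQ v)) !H; ring.
have PE u v z : P u v z = al z * (dotp u (lam z) ^+ 2 * dotp v (lam z) ^+ 2)
    - be z / 6 * (dotp u u * dotp v (lam z) ^+ 2 + dotp v v * dotp u (lam z) ^+ 2
      + 4 * (dotp u v * dotp u (lam z) * dotp v (lam z)))
    + ga z / 3 * (dotp u u * dotp v v + 2 * dotp u v ^+ 2).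
  rewrite /P /Q !(dotpDl, dotpDr, dotpNl, dotpNr) (dotpC v u).
  move: (al z) (be z) (ga z) (dotp u (lam z)) (dotp v (lam z)) (dotp u u) (dotp v v) (dotp u v).
  by move=> A B C a b p q m; field.
have dsum (f g : I -> R) : (\sum_p c p * f p) * (\sum_p c p * g p) =
    \sum_p \sum_q c p * c q * (f p * g q).
  rewrite mulr_suml; apply: eq_bigr => p _; rewrite mulr_sumr.
  by apply: eq_bigr => q _; ring.
have -> : (fun z => al z * hh z ^+ 2 - be z * ((4 * kk z + 2 * \tr K * hh z) / 6)
     + ga z * ((2 * tau + \tr K ^+ 2) / 3)) =
   (fun z => \sum_p \sum_q c p * c q * P (w p) (w q) z).
  apply/funext => z.
  have e1 : hh z ^+ 2 = \sum_p \sum_q c p * c q * (dotp (w p) (lam z) ^+ 2 * dotp (w q) (lam z) ^+ 2).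
    by rewrite /hh KE rank1_qform [LHS]expr2 dsum.
  have e2 : \tr K * hh z = \sum_p \sum_q c p * c q * (dotp (w p) (w p) * dotp (w q) (lam z) ^+ 2).
    by rewrite /hh KE rank1_qform rank1_tr dsum.
  have e2' : \tr K * hh z = \sum_p \sum_q c p * c q * (dotp (w q) (w q) * dotp (w p) (lam z) ^+ 2).
    rewrite e2 exchange_big; apply: eq_bigr => p _; apply: eq_bigr => q _ /=; ring.
  have e3 : kk z = \sum_p \sum_q c p * c q *
      (dotp (w p) (w q) * dotp (w p) (lam z) * dotp (w q) (lam z)).
    by rewrite /kk KE rank1_norm.
  have e4 : tau = \sum_p \sum_q c p * c q * dotp (w p) (w q) ^+ 2 by rewrite /tau KE rank1_tr_sqr.
  have e5 : \tr K ^+ 2 = \sum_p \sum_q c p * c q * (dotp (w p) (w p) * dotp (w q) (w q)).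
    by rewrite KE rank1_tr [LHS]expr2 dsum.
  rewrite (_ : _ / 6 = 1 / 6 * (\tr K * hh z + \tr K * hh z + 4 * kk z)); last by field.
  rewrite {1}e2 e2' e1 e3 e4 e5.
  rewrite (_ : (2 * _ + _) / 3 = 1 / 3 * (\sum_p \sum_q c p * c q * (dotp (w p) (w p) * dotp (w q) (w q))
     + 2 * \sum_p \sum_q c p * c q * dotp (w p) (w q) ^+ 2)); last by field.
  rewrite !mulr_sumr -!big_split /= !mulr_sumr -sumrB -big_split /=; apply: eq_bigr => p _.
  rewrite !mulr_sumr -!big_split /= !mulr_sumr -sumrB -big_split /=; apply: eq_bigr => q _.
  by rewrite PE; field.
rewrite gsum_sum; last by move=> p; apply: polyb_sum => q; exact: polybZ.
rewrite big1// => p _; rewrite gsum_sum; last by move=> q; exact: polybZ.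
by rewrite big1// => q _; rewrite gsumZ// P0 mulr0.
Qed.

End Polarization.
End PolyBounded.

Section LatticeTheta.
Variables (R : realType) (h : nat) (B : 'M[R]_(h.*2)) (N M : 'M[int]_(h.*2)).
Local Notation n := h.*2.
Local Notation pi := (@pi R).
Hypothesis BN : B^T *m B = map_mx intr N.
Hypothesis NM : N *m M = 1%:M.
Hypothesis MN : M *m N = 1%:M.
Hypothesis detB : (\det B) ^+ 2 = 1.
Hypothesis uB : B \in unitmx.

Definition latv (z : 'cV[int]_n) : 'cV[R]_n := B *m zr R z.
Definition lX (z : 'cV[int]_n) : R := pi * dotp (latv z) (latv z).

Lemma lX_ge0 z : 0 <= lX z.
Proof. by rewrite mulr_ge0 ?pi_ge0 ?dotp_ge0. Qed.

Lemma qform_gram c x : qform (c *: (B^T *m B)) x = c * dotp (B *m x) (B *m x).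
Proof. by rewrite qformE -scalemxAl dotpZr -mulmxA dotp_mulmx trmxK. Qed.

Lemma posdef_gram c : 0 < c -> posdef (c *: (B^T *m B)).
Proof.
move=> c0; split; first by rewrite linearZ /= trmx_mul trmxK.
move=> x x0; rewrite qform_gram mulr_gt0// lt_def dotp_ge0 dotp_eq0 andbT.
by apply: contraNneq x0 => e; rewrite -(mulKmx uB x) e mulmx0.
Qed.

Lemma lX_summable c : 0 < c -> rsummable (fun z => expR (- (c * lX z))).
Proof.
move=> c0; have := rsummable_gauss 0 (posdef_gram c0); congr rsummable; apply/funext => z.
by rewrite /gauss addr0 qform_gram /lX mulrCA.
Qed.

Lemma dot_lam_le v z : dotp v (latv z) ^+ 2 <= (dotp v v + 1) / pi * lX z.
Proof.
have p0 := @pi_gt0 R; apply: le_trans (dotp_CS _ _) _.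
by rewrite /lX mulrA divfK ?gt_eqF// ler_wpM2r ?dotp_ge0// lerDl.
Qed.

Lemma polyb_dot_lam v : polyb lX (fun z => dotp v (latv z)).
Proof.
have p0 := @pi_gt0 R; exists ((dotp v v + 1) / pi + 1), 1%N.
have G0 : 0 <= (dotp v v + 1) / pi.
  by apply: divr_ge0; [rewrite addr_ge0 ?dotp_ge0|exact: pi_ge0].
split; first by rewrite addr_ge0.
move=> z; rewrite expr1; have := dot_lam_le v z; have X0 := lX_ge0 z.
rewrite -real_normK ?num_real//; set a := `| _ |; set G := _ / pi in G0 *.
have : 0 <= G * lX z by rewrite mulr_ge0.
have := sqr_ge0 (a - 1); rewrite !expr2; lra.
Qed.

Lemma inv_gram_bij : bijective (fun z : 'cV[int]_n => N *m z).
Proof.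
by exists (fun z => M *m z) => z; rewrite mulmxA ?MN ?NM mul1mx.
Qed.

Lemma zr_mulN z : zr R (N *m z) = B^T *m latv z.
Proof. by rewrite /zr map_mxM -BN mulmxA. Qed.

Lemma lattice_inversion v t b : 0 < t ->
  t ^+ h * rsum (fun z => expR (- (t * lX z)) * cos (2 * pi * b * dotp v (latv z))) =
  rsum (fun z => expR (- (lX z / t) + 2 * pi * b * dotp v (latv z) / t
    - pi * b ^+ 2 * dotp v v / t)).
Proof.
move=> t0; have pA := posdef_gram t0; have tN : t != 0 by rewrite gt_eqF.
have := poisson 0 (b *: (B^T *m v)) 0 pA.
have dA : \det (t *: (B^T *m B)) = (t ^+ h) ^+ 2.
  by rewrite detZ det_mulmx det_tr -expr2 detB mulr1 -exprM muln2.
rewrite dA sqrtr_sqr ger0_norm ?exprn_ge0 ?(ltW t0)// => P.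
have -> : (fun z => expR (- (t * lX z)) * cos (2 * pi * b * dotp v (latv z))) =
   (fun x => expR (- (pi * qform (t *: (B^T *m B)) (zr R x + 0))) *
      cos (2 * pi * (dotp (b *: (B^T *m v)) (zr R x + 0) + 0))).
  apply/funext => z; rewrite !addr0 qform_gram dotpZl -[B^T *m v]trmxK.
  rewrite trmxK -dotp_mulmx /lX -/(latv z).
  by congr (expR (- _) * cos _); ring.
rewrite P mulrA mulfV ?expf_neq0// mul1r (rsum_bij _ inv_gram_bij).
congr rsum; apply/funext => z /=.
have -> : dotp (zr R (N *m z)) 0 = 0 by rewrite dotpE big1// => i _; rewrite [X in _ * X]mxE mulr0.
rewrite addr0 mulr0 cos0 mulr1; congr expR.
have -> : invmx (t *: (B^T *m B)) = t^-1 *: (invmx B *m (invmx B)^T).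
  have uA := posdef_unit pA; rewrite -[RHS]mulmx1 -(mulmxV uA) mulmxA.
  rewrite -[LHS]mul1mx; congr (_ *m _).
  rewrite -scalemxAl -scalemxAr scalerA mulVf// scale1r trmx_inv.
  by rewrite mulmxA mulmxKV ?unitmx_tr// mulVmx.
have -> : zr R (N *m z) - b *: (B^T *m v) = B^T *m (latv z - b *: v).
  by rewrite zr_mulN mulmxBr scalemxAr.
rewrite qformE -scalemxAl dotpZr trmx_inv mulmxA -[_ *m _ *m B^T *m _]mulmxA.
rewrite -(mulmxA (invmx B)) mulKmx ?unitmx_tr//.
rewrite dotp_mulmx trmx_inv mulKmx ?unitmx_tr//.
rewrite !(dotpDl, dotpDr, dotpNl, dotpNr, dotpZl, dotpZr) (dotpC (latv z) v) /lX.
by move: (pi) => p; field.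
Qed.

Definition rp (k j : nat) : {poly R} := rpoly (h%:R / 2 + k%:R / 2) j.

Lemma gsum_psij v k j : psij lX (fun z => dotp v (latv z)) h k j 0 =
  gsum lX (fun z => dotp v (latv z) ^+ k * (rp k j).[lX z]).
Proof.
rewrite /psij /psi /gsum; congr rsum; apply/funext => z.
by rewrite expR0 mulr1 mulr0 sub0r mulrA.
Qed.

Section Relations.
Variable v : 'cV[R]_n.
Let p0 := @pi_gt0 R.
Let G0 : 0 < (dotp v v + 1) / pi.
Proof. by rewrite divr_gt0 ?pi_gt0// ltr_wpDl ?dotp_ge0. Qed.
Let sgb : bijective (fun z : 'cV[int]_n => - z).
Proof. by exists (fun z => - z) => z; rewrite opprK. Qed.
Let lamN z : latv (- z) = - latv z.
Proof. by rewrite /latv /zr raddfN mulmxN. Qed.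
Let X_sg z : lX (- z) = lX z.
Proof. by rewrite /lX lamN dotpNl dotpNr opprK. Qed.
Let y_sg z : dotp v (latv (- z)) = - dotp v (latv z).
Proof. by rewrite lamN dotpNr. Qed.

Lemma lat_rel0v j : odd j -> psij lX (fun z => dotp v (latv z)) h 0 j 0 = 0.
Proof.
exact: (theta_rel0 lX_ge0 lX_summable G0 (dot_lam_le v) (dotp_ge0 v) sgb X_sg y_sg (fun t b => @lattice_inversion v t b)).
Qed.

Lemma lat_rel2v j : ~~ odd j ->
  gsum lX (fun z => 2 * pi ^+ 2 * (rp 2 j).[lX z] * dotp v (latv z) ^+ 2
     - pi / 2 * (rp 0 j).[lX z] * dotp v v) = 0.
Proof.
move=> oj; have := theta_rel2 lX_ge0 lX_summable G0 (dot_lam_le v) (dotp_ge0 v) sgb X_sg y_sg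
  (fun t b => @lattice_inversion v t b) oj.
have pb k j' : polyb lX (fun z => dotp v (latv z) ^+ k * (rp k j').[lX z]).
  apply: polybM; last exact: (polyb_horner lX_ge0).
  by apply: polybXn; exact: polyb_dot_lam.
rewrite !gsum_psij -(gsumZ lX_ge0 lX_summable _ (pb 2%N j)) -(gsumZ lX_ge0 lX_summable _ (pb 0%N j)).
rewrite -(gsumB lX_ge0 lX_summable (polybZ _ (pb 2%N j)) (polybZ _ (pb 0%N j))).
move=> <-; congr gsum; apply/funext => z; ring.
Qed.

Lemma lat_rel4v j : odd j ->
  gsum lX (fun z => 2 / 3 * pi ^+ 4 * (rp 4 j).[lX z] * dotp v (latv z) ^+ 4
     - pi ^+ 3 * (rp 2 j).[lX z] * (dotp v v * dotp v (latv z) ^+ 2)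
     + pi ^+ 2 / 4 * (rp 0 j).[lX z] * dotp v v ^+ 2) = 0.
Proof.
move=> oj; have := theta_rel4 lX_ge0 lX_summable G0 (dot_lam_le v) (dotp_ge0 v) sgb X_sg y_sg
  (fun t b => @lattice_inversion v t b) oj.
have pb k j' c : polyb lX (fun z => c * (dotp v (latv z) ^+ k * (rp k j').[lX z])).
  apply: polybZ.
  apply: polybM; last exact: (polyb_horner lX_ge0).
  by apply: polybXn; exact: polyb_dot_lam.
have pb1 k j' : polyb lX (fun z => dotp v (latv z) ^+ k * (rp k j').[lX z]).
  by have := pb k j' 1; congr polyb; apply/funext => z; rewrite mul1r.
rewrite !gsum_psij -!(gsumZ lX_ge0 lX_summable _ (pb1 _ j)).
rewrite -(gsumB lX_ge0 lX_summable (pb _ _ _) (pb _ _ _)).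
rewrite -(gsumD lX_ge0 lX_summable (polybB lX_ge0 (pb _ _ _) (pb _ _ _)) (pb _ _ _)).
move=> <-; congr gsum; apply/funext => z; ring.
Qed.

End Relations.

Lemma lat_rel0 j : odd j -> gsum lX (fun z => (rp 0 j).[lX z]) = 0.
Proof.
move=> oj; have := lat_rel0v 0 oj; rewrite gsum_psij => <-; congr gsum; apply/funext => z.
by rewrite expr0 mul1r.
Qed.

Let pbh (c : R) p : polyb lX (fun z => c * p.[lX z]).
Proof. by apply: polybZ; exact: (polyb_horner lX_ge0). Qed.

Lemma lat_rel2 (K : 'M[R]_n) j : K^T = K -> ~~ odd j ->
  gsum lX (fun z => 2 * pi ^+ 2 * (rp 2 j).[lX z] * qform K (latv z)
     - pi / 2 * (rp 0 j).[lX z] * \tr K) = 0.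
Proof.
move=> sK oj; apply: (polarize2 lX_ge0 lX_summable polyb_dot_lam sK (pbh _ _) (pbh _ _)) => v.
exact: lat_rel2v.
Qed.

Lemma lat_rel4 (K : 'M[R]_n) j : K^T = K -> odd j ->
  gsum lX (fun z => 2 / 3 * pi ^+ 4 * (rp 4 j).[lX z] * qform K (latv z) ^+ 2
     - pi ^+ 3 * (rp 2 j).[lX z] *
        ((4 * dotp (K *m latv z) (K *m latv z) + 2 * \tr K * qform K (latv z)) / 6)
     + pi ^+ 2 / 4 * (rp 0 j).[lX z] * ((2 * \tr (K *m K) + \tr K ^+ 2) / 3)) = 0.
Proof.
move=> sK oj; apply: (polarize4 lX_ge0 lX_summable polyb_dot_lam sK (pbh _ _) (pbh _ _) (pbh _ _)) => v.
exact: lat_rel4v.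
Qed.

End LatticeTheta.

(** * The linear programming certificate *)

(* The key Z delimits int_scope in MathComp. *)
Local Delimit Scope Z_scope with ZZ.

Section IntPolynomials.
Variable R : realType.

Definition zR (c : Z) : R := (int_of_Z c)%:~R.

Lemma zRD a b : zR (Z.add a b) = zR a + zR b.
Proof. by rewrite /zR (rmorphD int_of_Z a b) intrD. Qed.

Lemma zRM a b : zR (Z.mul a b) = zR a * zR b.
Proof. by rewrite /zR (rmorphM int_of_Z a b) intrM. Qed.

Lemma zRN a : zR (Z.opp a) = - zR a.
Proof. by rewrite /zR (rmorphN int_of_Z a) rmorphN. Qed.

Lemma zR_nat n : zR (Z.of_nat n) = n%:R.
Proof.
elim: n => [|n IH]; first by [].
by rewrite Nat2Z.inj_succ -Z.add_1_r zRD IH -natr1.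
Qed.

Lemma zR_le0 c : Z.leb c 0 -> zR c <= 0.
Proof. by case: c => //= p _; rewrite /zR /= NegzE rmorphN /= oppr_le0 ler0z. Qed.

Lemma zR_lt0 c : Z.ltb c 0 -> zR c < 0.
Proof. by case: c => //= p _; rewrite /zR /= NegzE rmorphN /= oppr_lt0 ltr0z. Qed.

Lemma zR_abs c : `|zR c| <= zR (Z.abs c).
Proof.
case: c => [|p|p] /=; first by rewrite /zR /= normr0.
  by rewrite /zR /= ger0_norm ?ler0z.
by rewrite -[Zneg p]/(Z.opp (Zpos p)) zRN normrN /zR /= ger0_norm ?ler0z.
Qed.

Fixpoint addl (p q : seq Z) : seq Z :=
  match p, q with
  | [::], _ => q
  | _, [::] => p
  | a :: p', b :: q' => Z.add a b :: addl p' q'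
  end.

Definition scalel (c : Z) (p : seq Z) : seq Z := map (Z.mul c) p.

Definition evl (p : seq Z) (x : R) : R := foldr (fun c acc => zR c + x * acc) 0 p.

Lemma evl_addl p q x : evl (addl p q) x = evl p x + evl q x.
Proof.
elim: p q => [|a p IH] [|b q] /=; rewrite ?add0r ?addr0//.
by rewrite IH zRD; ring.
Qed.

Lemma evl_scalel c p x : evl (scalel c p) x = zR c * evl p x.
Proof. by elim: p => [|a p IH] /=; rewrite ?mulr0// IH zRM; ring. Qed.

Fixpoint Dl_rec (k prev : Z) (p : seq Z) : seq Z :=
  match p with
  | [::] => [:: Z.opp prev]
  | c :: p' => Z.add (Z.mul k c) (Z.opp prev) :: Dl_rec (Z.add k 1) c p'
  end.

Definition Dl (k : Z) (p : seq Z) : seq Z := Dl_rec k 0 p.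

Definition toP (p : seq Z) : {poly R} := foldr (fun c acc => (zR c)%:P + 'X * acc) 0 p.

Lemma horner_toP p x : (toP p).[x] = evl p x.
Proof. by elim: p => [|a p IH] /=; rewrite ?horner0// !hornerE IH. Qed.

Lemma toP_Dl_rec k prev p : toP (Dl_rec k prev p) = Dpoly (zR k) (toP p) - (zR prev)%:P.
Proof.
rewrite /Dpoly; elim: p k prev => [|c p IH] k prev /=.
  by rewrite ?(mulr0, addr0, zRN, polyCN, scaler0, deriv0, subr0, sub0r).
rewrite IH zRD zRM zRN zRD derivD derivC derivM derivX.
rewrite -!mul_polyC !polyCD polyCM polyCN (_ : zR 1 = 1)//; ring.
Qed.

Lemma toP_rpoly k j : rpoly (zR k) j = toP (iter j (Dl k) [:: 1%ZZ]).
Proof.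
elim: j => [|j IH]; first by rewrite /= mulr0 addr0 (_ : zR 1 = 1).
rewrite /rpoly /= -/(rpoly _ j) IH /Dl toP_Dl_rec (_ : zR 0 = 0)// polyC0 subr0//.
Qed.

Definition lincomb (k : Z) (s : seq (Z * nat)) : seq Z :=
  foldr (fun cj acc => addl (scalel cj.1 (iter cj.2 (Dl k) [:: 1%ZZ])) acc) [::] s.

Lemma evl_lincomb k s x :
  evl (lincomb k s) x = \sum_(cj <- s) zR cj.1 * (rpoly (zR k) cj.2).[x].
Proof.
elim: s => [|cj s IH]; first by rewrite big_nil.
by rewrite /= evl_addl evl_scalel IH big_cons toP_rpoly horner_toP.
Qed.

Fixpoint shiftl (a : Z) (p : seq Z) : seq Z :=
  match p with
  | [::] => [::]
  | c :: p' => let q := shiftl a p' in addl (c :: q) (scalel a q)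
  end.

Lemma evl_shiftl a p u : evl (shiftl a p) u = evl p (zR a + u).
Proof.
elim: p => [|c p IH] //.
rewrite -[shiftl a _]/(addl (c :: shiftl a p) (scalel a (shiftl a p))).
by rewrite evl_addl evl_scalel /= IH; ring.
Qed.

Fixpoint homl (d : Z) (p : seq Z) : seq Z :=
  match p with
  | [::] => [::]
  | c :: p' => Z.mul (Z.pow d (Z.of_nat (size p'))) c :: homl d p'
  end.

Lemma evl_homl d p x : zR d * evl (homl d p) (zR d * x) = zR d ^+ size p * evl p x.
Proof.
have dn m : zR (Z.pow d (Z.of_nat m)) = zR d ^+ m.
  elim: m => [|m IH]; first by rewrite expr0.
  by rewrite Nat2Z.inj_succ Z.pow_succ_r ?zRM ?IH -?exprS //; exact: Nat2Z.is_nonneg.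
elim: p => [|c p IH] /=; first by rewrite !mulr0.
rewrite zRM dn exprS.
have -> : zR d * (zR d ^+ size p * zR c + zR d * x * evl (homl d p) (zR d * x)) =
  zR d * zR d ^+ size p * zR c + zR d * x * (zR d * evl (homl d p) (zR d * x)) by ring.
by rewrite IH; ring.
Qed.

Definition absl (e : Z) (p : seq Z) : Z := foldr (fun c acc => Z.add (Z.abs c) (Z.mul e acc)) Z0 p.

Lemma evl_absl e p u : `|u| <= zR e -> `|evl p u| <= zR (absl e p).
Proof.
move=> ue; have e0 : 0 <= zR e by exact: le_trans (normr_ge0 _) ue.
elim: p => [|c p IH] /=; first by rewrite normr0.
rewrite zRD zRM; apply: le_trans (ler_normD _ _) _; apply: lerD; first exact: zR_abs.
by rewrite normrM ler_pM.
Qed.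

Definition neg_near (e : Z) (p : seq Z) : bool :=
  match p with [::] => true | c :: p' => Z.ltb (Z.add c (Z.mul e (absl e p'))) 0 end.

Lemma neg_nearP e p u : neg_near e p -> `|u| <= zR e -> evl p u <= 0.
Proof.
case: p => [|c p] //= /zR_lt0; rewrite zRD zRM => H ue.
have e0 : 0 <= zR e by exact: le_trans (normr_ge0 _) ue.
have h1 : u * evl p u <= zR e * zR (absl e p).
  by apply: le_trans (ler_norm _) _; rewrite normrM ler_pM// evl_absl.
lra.
Qed.

Definition npos_coef (p : seq Z) : bool := all (fun c => Z.leb c 0) p.

Lemma npos_coefP p u : npos_coef p -> 0 <= u -> evl p u <= 0.
Proof.
move=> + u0; elim: p => [|c p IH] //= /andP[/zR_le0 c0 /IH h].
by rewrite -[leRHS]addr0 lerD// mulr_ge0_le0.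
Qed.

(* V is evaluated at 10^4 s, with s = 2 pi m and |10^4 pi - 31416| <= 1 *)
Definition neg_check (V : seq Z) : bool :=
  let W := homl 10000 V in
  all (fun m => neg_near (Z.of_nat (2 * m)) (shiftl (Z.mul (Z.of_nat (2 * m)) 31416) W)) (iota 2 8)
  && npos_coef (shiftl (Z.mul (Z.of_nat 20) 31415) W).

Lemma neg_checkP V (m : nat) : neg_check V -> (2 <= m)%N -> evl V (2 * pi * m%:R) <= 0.
Proof.
move=> /andP[/allP c1 c2] m2; have /andP[pl pu] := @pi_bounds R.
have d0 : 0 < zR 10000 by [].
have dE : zR 10000 = 100 * 100.
  by rewrite -[10000%ZZ]/(Z.mul 100 100) zRM.
suff : evl (homl 10000 V) (zR 10000 * (2 * pi * m%:R)) <= 0.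
  move=> h; have : zR 10000 * evl (homl 10000 V) (zR 10000 * (2 * pi * m%:R)) <= 0.
    by rewrite mulr_ge0_le0// ltW.
  by rewrite evl_homl pmulr_rle0 ?exprn_gt0.
have [m10|m10] := ltnP m 10.
  have im : m \in iota 2 8 by rewrite mem_iota m2.
  have := c1 _ im => h; set a := Z.mul _ 31416 in h.
  have -> : zR 10000 * (2 * pi * m%:R) = zR a + (zR 10000 * (2 * pi * m%:R) - zR a) by ring.
  rewrite -evl_shiftl; apply: (neg_nearP h).
  have -> : zR a = 2 * m%:R * (24 * (77 * 17)).
    rewrite /a zRM zR_nat natrM; congr (_ * _).
    by rewrite -[31416%ZZ]/(Z.mul 24 (Z.mul 77 17)) !zRM.
  rewrite zR_nat natrM dE.
  have -> : 100 * 100 * (2 * pi * m%:R) - 2 * m%:R * (24 * (77 * 17)) =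
    2 * m%:R * (100 * 100 * pi - 24 * (77 * 17)) :> R by ring.
  rewrite normrM ger0_norm ?mulr_ge0// ler_piMr ?mulr_ge0// ler_norml.
  by apply/andP; split; lra.
set a := Z.mul _ 31415 in c2.
have -> : zR 10000 * (2 * pi * m%:R) = zR a + (zR 10000 * (2 * pi * m%:R) - zR a) by ring.
rewrite -evl_shiftl; apply: (npos_coefP c2).
have -> : zR a = 20 * (305 * 103).
  rewrite /a zRM zR_nat; congr (_ * _).
  by rewrite -[31415%ZZ]/(Z.mul 305 103) !zRM.
have m10' : 10 <= m%:R :> R by rewrite ler_nat.
rewrite dE; have : 0 <= (m%:R - 10) * pi :> R by rewrite mulr_ge0 ?subr_ge0 ?pi_ge0.
lra.
Qed.

End IntPolynomials.

(* A pair (c, j) stands for c times the relation obtained from j derivatives in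
   log t; the coefficients are scaled by lp_W = 10^29.  The lists belong to the
   relations of degree 4, 2 and 0 in x, of weights 10, 9 and 8. *)
Definition lp_a : seq (Z * nat) :=
  [:: (26318080700000000000000000000, 1%N); (-325268915000000000000000000, 3%N);
      (2430718300000000000000000, 5%N); (-10443893400000000000000, 7%N);
      (27318680400000000000, 9%N); (-43408059600000000, 11%N); (42112607500000, 13%N)]%ZZ.

Definition lp_b : seq (Z * nat) :=
  [:: (-131257597000000000000000000000, 0%N); (947437046000000000000000000, 2%N);
      (-9201171930000000000000000, 4%N); (38524955700000000000000, 6%N);
      (-62779680300000000000, 8%N); (-62038285100000000, 10%N); (390636977000000, 12%N);
      (-918012079000, 14%N)]%ZZ.

Definition lp_c : seq (Z * nat) :=
  [:: (-5939318940000000000000000000, 1%N); (62456437000000000000000000, 3%N);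
      (-409450627000000000000000, 5%N); (1574569130000000000000, 7%N);
      (-3760626520000000000, 9%N); (5731821140000000, 11%N); (-5431866590000, 13%N);
      (2815824700, 15%N)]%ZZ.

Definition lp_W : Z := 100000000000000000000000000000.

Definition lp_A : seq Z := addl [:: Z.mul 4 lp_W] (scalel 4 (lincomb 10 lp_a)).
Definition lp_B : seq Z := addl (scalel (-4) (lincomb 9 lp_a)) (scalel 4 (lincomb 9 lp_b)).
Definition lp_C : seq Z := addl [:: Z.opp lp_W]
  (addl (lincomb 8 lp_a) (addl (scalel (-1) (lincomb 8 lp_b)) (scalel 4 (lincomb 8 lp_c)))).

Lemma lp_check : [&& neg_check lp_C, neg_check (addl (scalel 2 lp_C) (Z0 :: lp_B)),
  neg_check (addl lp_C (Z0 :: addl lp_B (Z0 :: lp_A))) &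
  Z.ltb (head Z0 lp_C) 0].
Proof. by vm_compute. Qed.

(** * Second-order expansion of the determinant *)

Section BigO.
Variables (R : realType) (I : Type) (F : set_system I) (d : I -> R).
Hypothesis FF : Filter F.
Hypothesis d0 : forall i, 0 <= d i.
Hypothesis dF : forall e, 0 < e -> \forall i \near F, d i < e.

Definition dO (k : nat) (f : I -> R) : Prop :=
  exists2 C, 0 <= C & \forall i \near F, `|f i| <= C * d i ^+ k.

Lemma dO_near k f g : (\forall i \near F, f i = g i) -> dO k g -> dO k f.
Proof.
move=> fg [C C0 h]; exists C => //.
by apply: filterS2 fg h => i ->.
Qed.

Lemma dO_eq k f g : f =1 g -> dO k g -> dO k f.
Proof. by move=> fg; apply: dO_near; exact: nearW. Qed.

Lemma dO_cst c : dO 0 (fun=> c).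
Proof. by exists `|c| => //; apply: nearW => i; rewrite mulr1. Qed.

Lemma dO0 k : dO k (fun=> 0).
Proof. by exists 0 => //; apply: nearW => i; rewrite normr0 mul0r. Qed.

Lemma dOD k f g : dO k f -> dO k g -> dO k (fun i => f i + g i).
Proof.
move=> [C C0 hf] [D D0 hg]; exists (C + D); first exact: addr_ge0.
apply: filterS2 hf hg => i hf hg; rewrite mulrDl.
by apply: le_trans (ler_normD _ _) _; exact: lerD.
Qed.

Lemma dON k f : dO k f -> dO k (fun i => - f i).
Proof.
by move=> [C C0 hf]; exists C => //; apply: filterS hf => i; rewrite normrN.
Qed.

Lemma dOB k f g : dO k f -> dO k g -> dO k (fun i => f i - g i).
Proof. by move=> hf hg; apply: dOD => //; exact: dON. Qed.

Lemma dOM k l f g : dO k f -> dO l g -> dO (k + l) (fun i => f i * g i).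
Proof.
move=> [C C0 hf] [D D0 hg]; exists (C * D); first exact: mulr_ge0.
apply: filterS2 hf hg => i hf hg; rewrite normrM exprD mulrACA.
by apply: ler_pM.
Qed.

Lemma dOZ k c f : dO k f -> dO k (fun i => c * f i).
Proof. exact: (dOM (dO_cst c)). Qed.

Lemma dOS k f : dO k.+1 f -> dO k f.
Proof.
move=> [C C0 hf]; exists C => //; apply: filterS2 hf (dF ltr01) => i hf d1.
apply: le_trans hf _; rewrite ler_wpM2l// exprS ler_piMl ?exprn_ge0//; exact: ltW.
Qed.

Lemma dO_sum k (J : Type) (r : seq J) (f : J -> I -> R) : (forall j, dO k (f j)) ->
  dO k (fun i => \sum_(j <- r) f j i).
Proof.
move=> hf; elim: r => [|j r IH]; first by apply: dO_eq (dO0 k) => i; rewrite big_nil.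
by apply: dO_eq (dOD (hf j) IH) => i; rewrite big_cons.
Qed.

Lemma dO1_lt f e : dO 1 f -> 0 < e -> \forall i \near F, `|f i| < e.
Proof.
move=> [C C0 hf] e0; have e1 : 0 < e / (C + 1) by rewrite divr_gt0// ltr_wpDl.
apply: filterS2 hf (dF e1) => i hf; rewrite ltr_pdivlMr ?ltr_wpDl// => h.
apply: le_lt_trans hf _; apply: le_lt_trans h; rewrite expr1 mulrC ler_wpM2l//.
by rewrite lerDl.
Qed.

Lemma dO1_neq0 f : dO 1 f -> \forall i \near F, 1 + f i != 0.
Proof.
move=> hf; apply: filterS (dO1_lt hf ltr01) => i; rewrite ltr_norml => /andP[h _].
by rewrite gt_eqF//; lra.
Qed.

Lemma dO_inv f : dO 1 f -> dO 0 (fun i => (1 + f i)^-1).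
Proof.
move=> hf; exists 2 => //; have h2 : 0 < 2^-1 :> R by rewrite invr_gt0.
apply: filterS (dO1_lt hf h2) => i; rewrite ltr_norml => /andP[h _].
have p : 2^-1 < 1 + f i by lra.
have p0 : 0 < 1 + f i by exact: lt_trans p.
by rewrite expr0 mulr1 normfV gtr0_norm// -[leRHS]invrK lef_pV2 ?posrE// ltW.
Qed.

Lemma det1D_block n (a : R) (b : 'rV[R]_n) (c : 'cV[R]_n) (D : 'M[R]_n) : 1 + a != 0 ->
  \det (1%:M + block_mx a%:M b c D : 'M[R]_(1 + n)) =
  (1 + a) * \det (1%:M + (D - (1 + a)^-1 *: (c *m b))).
Proof.
move=> a0; set S := D - _.
have -> : 1%:M + block_mx a%:M b c D =
    block_mx 1%:M 0 ((1 + a)^-1 *: c) 1%:M *m block_mx (1 + a)%:M b 0 (1%:M + S) :> 'M[R]_(1 + n).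
  rewrite mulmx_block !mul1mx !mul0mx !addr0 mul_mx_scalar scalerA divff// scale1r.
  rewrite -scalemxAl /S addrCA (addrCA _ D) subrr addr0.
  by rewrite (@scalar_mx_block _ 1 n) add_block_mx !add0r raddfD.
by rewrite det_mulmx det_lblock det_ublock !det1 det_scalar1 mul1r mul1r.
Qed.

(* Induction on the dimension: eliminating the first row and column replaces the
   lower block D by D - c b / (1 + a), whose entries are again O(d). *)
Lemma det1D_expansion n (K : I -> 'M[R]_n) : (forall i j, dO 1 (fun x => K x i j)) ->
  dO 3 (fun x => \det (1%:M + K x) - 1 - \tr (K x)
                 - (\tr (K x) ^+ 2 - \tr (K x *m K x)) / 2).
Proof.
elim: n K => [|n IH] K hK.
  apply: dO_eq (dO0 3) => x; rewrite det_mx00 /mxtrace !big_ord0; ring.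
pose a x : R := ulsubmx (K x : 'M[R]_(1 + n)) ord0 ord0.
pose b x : 'rV[R]_n := ursubmx (K x : 'M[R]_(1 + n)).
pose c x : 'cV[R]_n := dlsubmx (K x : 'M[R]_(1 + n)).
pose D x : 'M[R]_n := drsubmx (K x : 'M[R]_(1 + n)).
have KE x : K x = block_mx (a x)%:M (b x) (c x) (D x) :> 'M[R]_(1 + n).
  by rewrite -[LHS](@submxK _ 1 n 1 n) /b /c /D /a -mx11_scalar.
have ha : dO 1 a.
  by apply: dO_eq (hK (@lshift 1 n ord0) (@lshift 1 n ord0)) => x; rewrite /a !mxE.
have hb j : dO 1 (fun x => b x ord0 j).
  by apply: dO_eq (hK (@lshift 1 n ord0) (@rshift 1 n j)) => x; rewrite /b !mxE.
have hc j : dO 1 (fun x => c x j ord0).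
  by apply: dO_eq (hK (@rshift 1 n j) (@lshift 1 n ord0)) => x; rewrite /c !mxE.
have hD i j : dO 1 (fun x => D x i j).
  by apply: dO_eq (hK (@rshift 1 n i) (@rshift 1 n j)) => x; rewrite /D !mxE.
pose S x : 'M[R]_n := D x - (1 + a x)^-1 *: (c x *m b x).
have hS i j : dO 1 (fun x => S x i j).
  have h : dO 1 (fun x => D x i j - (1 + a x)^-1 * (c x i ord0 * b x ord0 j)).
    apply: dOB => //; apply: (dOM (dO_inv ha)); apply: dOS.
    exact: (dOM (hc i) (hb j)).
  by apply: dO_eq h => x; rewrite /S /b /c /D !mxE big_ord1 !mxE.
have := IH _ hS; set T := fun x => \det _ - 1 - _ - _ => hT.
pose be x := (b x *m c x) ord0 ord0.
pose om x := (b x *m (D x *m c x)) ord0 ord0.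
have hbe : dO 2 be.
  apply: (@dO_eq _ _ (fun x => \sum_j b x ord0 j * c x j ord0)) => [x|]; first by rewrite /be mxE.
  by apply: dO_sum => j; exact: (dOM (hb j) (hc j)).
have hom : dO 3 om.
  apply: (@dO_eq _ _ (fun x => \sum_j b x ord0 j * \sum_k D x j k * c x k ord0)) => [x|].
    by rewrite /om mxE; apply: eq_bigr => j _; congr (_ * _); rewrite mxE.
  apply: dO_sum => j; apply: (dOM (hb j)); apply: dO_sum => k; exact: (dOM (hD j k) (hc k)).
have htr : dO 1 (fun x => \tr (D x)) by apply: dO_sum => j.
have htt : dO 2 (fun x => \tr (D x *m D x)).
  apply: (@dO_eq _ _ (fun x => \sum_i \sum_j D x i j * D x j i)) => [x|].
    by apply: eq_bigr => i _; rewrite mxE.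
  by apply: dO_sum => i; apply: dO_sum => j; exact: (dOM (hD i j) (hD j i)).
have hfin : dO 3 (fun x => (1 + a x) * T x + (a x * ((\tr (D x) ^+ 2 - \tr (D x *m D x)) / 2)
    - be x * \tr (D x) + om x)).
  apply: dOD.
    by apply: (@dOM 0 3) => //; apply: dOD; [exact: dO_cst|exact: dOS].
  apply: dOD => //; apply: dOB; last exact: (dOM hbe htr).
  apply: (dOM ha); apply: dO_eq (dOZ 2^-1 (dOB (dOM htr htr) htt)) => x.
  by rewrite expr2 mulrC.
apply: dO_near hfin; apply: filterS (dO1_neq0 ha) => x a0.
rewrite {1}KE det1D_block// -/(S x).
have -> : \tr (K x) = a x + \tr (D x).
  by rewrite KE (@mxtrace_block _ 1 n) mxtrace_scalar mulr1n.
have -> : \tr (K x *m K x) = a x ^+ 2 + 2 * be x + \tr (D x *m D x).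
  rewrite KE (@mulmx_block _ 1 n 1 n 1 n) (@mxtrace_block _ 1 n) !mxtraceD (mxtrace_mulC (c x)).
  rewrite -scalar_mxM mxtrace_scalar mulr1n (trace_mx11 (b x *m c x)) -/(be x); ring.
have tS : \tr (S x) = \tr (D x) - (1 + a x)^-1 * be x.
  by rewrite /S raddfB /= mxtraceZ mxtrace_mulC trace_mx11.
have tSS : \tr (S x *m S x) = \tr (D x *m D x) - 2 * ((1 + a x)^-1 * om x)
    + ((1 + a x)^-1 * be x) ^+ 2.
  rewrite /S mulmxBl !mulmxBr !raddfB /= -!scalemxAl -!scalemxAr !mxtraceZ.
  rewrite -!mulmxA !(mxtrace_mulC (c x)) -!mulmxA.
  have e1 : \tr (b x *m (D x *m c x)) = om x.
    by rewrite trace_mx11.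
  have e2 : \tr (b x *m (c x *m (b x *m c x))) = be x ^+ 2.
    rewrite mulmxA [b x *m c x]mx11_scalar -scalar_mxM mxtrace_scalar mulr1n.
    by rewrite -/(be x) expr2.
  have e3 : \tr (D x *m (c x *m b x)) = om x.
    by rewrite mulmxA mxtrace_mulC trace_mx11.
  by rewrite e1 e2 e3; ring.
rewrite /T tS tSS; move: (\det _) (\tr _) (\tr _) (be x) (om x) => p q r s t.
by field.
Qed.

End BigO.

(** * The quadratic part of the energy *)

Section SymmetricTrace.
Variables (R : realType) (n : nat).
Implicit Types (K : 'M[R]_n) (x : 'cV[R]_n).

Lemma sym_trE K : K^T = K -> \tr (K *m K) = \sum_i \sum_j K i j ^+ 2.
Proof.
move=> sK; apply: eq_bigr => i _; rewrite mxE; apply: eq_bigr => j _.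
by rewrite -{2}sK mxE expr2.
Qed.

Lemma sym_tr_ge0 K : K^T = K -> 0 <= \tr (K *m K).
Proof.
by move=> /sym_trE ->; apply: sumr_ge0 => i _; apply: sumr_ge0 => j _; exact: sqr_ge0.
Qed.

Lemma sym_tr_entry K i j : K^T = K -> K i j ^+ 2 <= \tr (K *m K).
Proof.
move=> /sym_trE ->; rewrite (bigD1 i)//= (bigD1 j)//= -addrA lerDl addr_ge0//.
  by apply: sumr_ge0 => k _; exact: sqr_ge0.
by apply: sumr_ge0 => k _; apply: sumr_ge0 => l _; exact: sqr_ge0.
Qed.

Lemma sym_tr_le K e : K^T = K -> (forall i j, `|K i j| <= e) -> \tr (K *m K) <= n%:R ^+ 2 * e ^+ 2.
Proof.
move=> /sym_trE -> h; have -> : n%:R ^+ 2 * e ^+ 2 = \sum_(i < n) \sum_(j < n) e ^+ 2.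
  by rewrite !sumr_const card_ord -mulrnA -[RHS]mulr_natl natrM -expr2.
apply: ler_sum => i _; apply: ler_sum => j _; rewrite -real_normK ?num_real//.
by rewrite lerXn2r ?nnegrE// (le_trans (normr_ge0 _) (h i j)).
Qed.

Lemma sym_qform_norm K x : K^T = K -> qform (K *m K) x = dotp (K *m x) (K *m x).
Proof. by move=> sK; rewrite qformE -mulmxA dotp_mulmx sK. Qed.

(* The trace of (P K P)^2 is nonnegative, P = q - x x^T being a multiple of
   the orthogonal projection off x. *)
Lemma sym_norm_ineq K x : K^T = K ->
  2 * dotp x x * dotp (K *m x) (K *m x) <= \tr (K *m K) * dotp x x ^+ 2 + qform K x ^+ 2.
Proof.
move=> sK; set q := dotp x x; set y := K *m x; set k := dotp y y.
have [q0|q0] := eqVneq q 0.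
  by rewrite q0 expr0n /= mulr0 mul0r mulr0 add0r sqr_ge0.
have hE : qform K x = dotp y x by rewrite qformE dotpC.
pose P := q%:M - x *m x^T.
have PT : P^T = P by rewrite /P linearB /= tr_scalar_mx trmx_mul trmxK.
have xx : x^T *m x = q%:M by rewrite [LHS]mx11_scalar.
have PP : P *m P = q *: P.
  rewrite {1}/P mulmxBl mul_scalar_mx -mulmxA {2}/P mulmxBr mul_mx_scalar mulmxA xx.
  by rewrite mul_scalar_mx subrr mulmx0 subr0.
have := @sym_tr_ge0 (P *m K *m P); rewrite !trmx_mul PT sK mulmxA => /(_ erefl).
have -> : P *m K *m P *m (P *m K *m P) = q *: (P *m K *m P *m K *m P).
  by rewrite -!mulmxA (mulmxA P P) PP -!scalemxAl -!scalemxAr.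
rewrite mxtraceZ mxtrace_mulC !mulmxA PP -!scalemxAl mxtraceZ mulrA.
have PK : P *m K = q *: K - x *m y^T.
  by rewrite /P mulmxBl mul_scalar_mx -mulmxA /y trmx_mul sK.
have -> : \tr (P *m K *m P *m K) = q ^+ 2 * \tr (K *m K) - 2 * q * k + dotp y x ^+ 2.
  rewrite -mulmxA PK mulmxBl !mulmxBr !raddfB /= -!scalemxAl -!scalemxAr !mxtraceZ.
  have -> : \tr (K *m (x *m y^T)) = k by rewrite mulmxA mxtrace_rank1.
  have -> : \tr (x *m y^T *m K) = k by rewrite mxtrace_mulC mulmxA mxtrace_rank1.
  have -> : \tr (x *m y^T *m (x *m y^T)) = dotp y x ^+ 2.
    by rewrite mulmxA mul_rank1 -scalemxAl mxtraceZ mxtrace_rank1.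
  ring.
by rewrite pmulr_rge0 -?expr2 ?exprn_even_gt0//= hE => h; lra.
Qed.

Lemma sym_norm_le K x : K^T = K -> dotp (K *m x) (K *m x) <= \tr (K *m K) * dotp x x.
Proof.
move=> sK; have := sym_norm_ineq x sK; have := dotp_CS x (K *m x); rewrite -qformE.
have [/eqP|x0] := boolP (dotp x x == 0).
  move/eqP; rewrite dotp_eq0 => /eqP -> _ _; rewrite mulmx0.
  by have /eqP -> : dotp (0 : 'cV[R]_n) 0 == 0; rewrite ?dotp_eq0 ?mulr0.
have q0 : 0 < dotp x x by rewrite lt_def x0 dotp_ge0.
move: (dotp x x) (dotp _ _) (\tr _) (qform _ _) q0 => q k t h q0 h1 h2.
rewrite -(ler_pM2l q0); move: h1 h2; rewrite !expr2; nra.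
Qed.

Lemma sym_qform_le K x : K^T = K -> qform K x ^+ 2 <= \tr (K *m K) * dotp x x ^+ 2.
Proof.
move=> sK; rewrite qformE; apply: le_trans (dotp_CS _ _) _.
rewrite expr2 mulrCA ler_wpM2l ?dotp_ge0//; exact: sym_norm_le.
Qed.

Lemma sym_qform_abs_le K x : K^T = K ->
  `|pi * qform K x| <= Num.sqrt (\tr (K *m K)) * (pi * dotp x x).
Proof.
move=> sK; rewrite normrM (ger0_norm (pi_ge0 R)) mulrCA ler_wpM2l ?pi_ge0//.
rewrite -ler_sqr ?nnegrE ?mulr_ge0 ?sqrtr_ge0 ?dotp_ge0//.
by rewrite real_normK ?num_real// exprMn sqr_sqrtr ?sym_tr_ge0// sym_qform_le.
Qed.

End SymmetricTrace.

Lemma cone_le0 (R : realFieldType) (s e k t A B C : R) : 0 < s ->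
  0 <= e -> e <= s * k -> 2 * s * k <= t * s ^+ 2 + e ->
  C <= 0 -> 2 * C + s * B <= 0 -> C + s * (B + s * A) <= 0 ->
  e * A + k * B + t * C <= 0.
Proof.
move=> s0 e0 ek kt C0 B0 A0; have s2 : 0 < s ^+ 2 by rewrite exprn_gt0.
rewrite -(pmulr_rle0 _ s2).
have -> : s ^+ 2 * (e * A + k * B + t * C) = e * (C + s * (B + s * A))
  + (s * k - e) * (2 * C + s * B) + (t * s ^+ 2 + e - 2 * s * k) * C by ring.
have h1 := mulr_ge0_le0 e0 A0.
have h2 : (s * k - e) * (2 * C + s * B) <= 0 by rewrite mulr_ge0_le0// subr_ge0.
have h3 : (t * s ^+ 2 + e - 2 * s * k) * C <= 0 by rewrite mulr_ge0_le0// subr_ge0.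
by rewrite -[leRHS]addr0 lerD// -[leRHS]addr0 lerD.
Qed.

Section KeyInequality.
Variables (R : realType) (B : 'M[R]_(16.*2)) (N M : 'M[int]_(16.*2)).
Local Notation pi := (@pi R).
Hypothesis BN : B^T *m B = map_mx intr N.
Hypothesis NM : N *m M = 1%:M.
Hypothesis MN : M *m N = 1%:M.
Hypothesis detB : (\det B) ^+ 2 = 1.
Hypothesis uB : B \in unitmx.
Hypothesis minB : forall z, z != 0 -> exists2 m : nat, (2 <= m)%N & lX B z = 2 * pi * m%:R.

Local Notation X := (lX B).
Local Notation lam := (latv B).
Let X0 := lX_ge0 B.
Let sX c := @lX_summable R 16 B uB c.

Let hh (K : 'M[R]_(16.*2)) z := qform K (lam z).
Let kk (K : 'M[R]_(16.*2)) z := dotp (K *m lam z) (K *m lam z).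
Let eta K z := pi ^+ 2 * hh K z ^+ 2.
Let kap K z := pi * kk K z.

Let ph K : polyb X (hh K). Proof. exact: (polyb_qform X0 (polyb_dot_lam B)). Qed.
Let pk K : polyb X (kk K). Proof. exact: (polyb_norm_mul X0 (polyb_dot_lam B)). Qed.
Let pe K : polyb X (eta K). Proof. by apply: polybZ; apply: polybXn; exact: ph. Qed.
Let pkp K : polyb X (kap K). Proof. by apply: polybZ; exact: pk. Qed.
Let pr (p : {poly R}) : polyb X (fun z => p.[X z]). Proof. exact: (polyb_horner X0). Qed.
Let pv V : polyb X (fun z => evl V (X z)).
Proof. by under [F in polyb _ F]eq_fun do rewrite -horner_toP; exact: pr. Qed.

Let gsum_eqZ0 c F G : polyb X F -> gsum X F = 0 -> (forall z, G z = c * F z) -> gsum X G = 0.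
Proof.
move=> pF F0 GF; have -> : G = (fun z => c * F z) by exact/funext.
by rewrite (gsumZ X0 sX c pF) F0 mulr0.
Qed.

Let rel4 (K : 'M[R]_(16.*2)) j : K^T = K -> odd j ->
  gsum X (fun z => (eta K z * (rp R 16 4 j).[X z] - kap K z * (rp R 16 2 j).[X z]
     + \tr (K *m K) / 4 * (rp R 16 0 j).[X z])
   - (pi * \tr K / 2 * hh K z * (rp R 16 2 j).[X z] - \tr K ^+ 2 / 8 * (rp R 16 0 j).[X z])) = 0.
Proof.
move=> sK oj; apply: (gsum_eqZ0 _ (lat_rel4 BN NM MN detB uB sK oj) (c := 3 / 2 / pi ^+ 2)).
  apply: (polybD X0); last first.
    by apply: polybM; [apply: polybZ; exact: pr|exact: polyb_cst].
  apply: (polybB X0).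
    apply: polybM; [by apply: polybZ; exact: pr|apply: polybXn; exact: ph].
  apply: polybM; [by apply: polybZ; exact: pr|apply: polybM; last exact: polyb_cst].
  by apply: (polybD X0); apply: polybZ; [exact: pk|exact: ph].
move=> z; rewrite /eta /kap -/(kk K z) -/(hh K z); have := @pi_gt0 R.
by move: pi => P P0; field; rewrite gt_eqF.
Qed.

Let rel2 (K : 'M[R]_(16.*2)) j : K^T = K -> ~~ odd j ->
  gsum X (fun z => kap K z * (rp R 16 2 j).[X z] - \tr (K *m K) / 4 * (rp R 16 0 j).[X z]) = 0.
Proof.
move=> sK oj; have sK2 : (K *m K)^T = K *m K by rewrite trmx_mul sK.
apply: (gsum_eqZ0 _ (lat_rel2 BN NM MN detB uB sK2 oj) (c := (2 * pi)^-1)).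
  apply: (polybB X0); apply: polybM; try by apply: polybZ; exact: pr.
    exact: ph.
  exact: polyb_cst.
move=> z; rewrite (sym_qform_norm _ sK) /kap -/(kk K z); have := @pi_gt0 R.
by move: pi => P P0; field; rewrite gt_eqF.
Qed.

Lemma gsum_qform (K : 'M[R]_(16.*2)) : K^T = K ->
  pi * gsum X (fun z => qform K (lam z)) = \tr K / 4 * gsum X (fun=> 1).
Proof.
move=> sK; have := lat_rel2 BN NM MN detB uB sK (isT : ~~ odd 0).
set F := fun z => _ => F0.
have : gsum X (fun z => pi * hh K z - \tr K / 4 * 1) = 0.
  apply: (gsum_eqZ0 _ F0 (c := (2 * pi)^-1)).
    apply: (polybB X0); apply: polybM; try by apply: polybZ; exact: pr.
      exact: ph.
    exact: polyb_cst.
  have r1 k : rp R 16 k 0 = 1 by [].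
  move=> z; rewrite /F !r1 hornerC -/(hh K z); have := @pi_gt0 R.
  by move: pi => P P0; field; rewrite gt_eqF.
rewrite (gsumB X0 sX (polybZ _ (ph K)) (polybZ _ (polyb_cst _ _))).
rewrite (gsumZ X0 sX _ (ph K)) (gsumZ X0 sX _ (polyb_cst _ _)).
by move/eqP; rewrite subr_eq0 => /eqP.
Qed.

Let evl1 c (x : R) : evl [:: c] x = zR R c. Proof. by rewrite /evl /= mulr0 addr0. Qed.
Let evl_cons c V (x : R) : evl (c :: V) x = zR R c + x * evl V x. Proof. by []. Qed.

Let z4 : zR R 4 = 4. Proof. by []. Qed.
Let zN4 : zR R (-4) = -4. Proof. by []. Qed.
Let zN1 : zR R (-1) = -1. Proof. by []. Qed.

Let lp_AE x : evl lp_A x = 4 * zR R lp_W + 4 * evl (lincomb 10 lp_a) x :> R.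
Proof.
rewrite /lp_A; move: lp_W (lincomb 10 lp_a) => W a.
by rewrite evl_addl evl_scalel evl1 zRM z4.
Qed.

Let lp_BE x : evl lp_B x = - 4 * evl (lincomb 9 lp_a) x + 4 * evl (lincomb 9 lp_b) x :> R.
Proof.
rewrite /lp_B; move: (lincomb 9 lp_a) (lincomb 9 lp_b) => a b.
by rewrite evl_addl !evl_scalel z4 zN4.
Qed.

Let lp_CE x : evl lp_C x = - zR R lp_W + evl (lincomb 8 lp_a) x
  - evl (lincomb 8 lp_b) x + 4 * evl (lincomb 8 lp_c) x :> R.
Proof.
rewrite /lp_C; move: lp_W (lincomb 8 lp_a) (lincomb 8 lp_b) (lincomb 8 lp_c) => W a b c.
by rewrite !evl_addl !evl_scalel evl1 zRN z4 zN1 mulN1r !addrA.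
Qed.

Let lp_V1 x : evl (addl (scalel 2 lp_C) (Z0 :: lp_B)) x = 2 * evl lp_C x + x * evl lp_B x :> R.
Proof. by rewrite evl_addl evl_scalel evl_cons add0r. Qed.

Let lp_V2 x : evl (addl lp_C (Z0 :: addl lp_B (Z0 :: lp_A))) x =
  evl lp_C x + x * (evl lp_B x + x * evl lp_A x) :> R.
Proof. by rewrite evl_addl evl_cons evl_addl evl_cons !add0r. Qed.

Let lp0 : evl lp_C 0 = zR R (head Z0 lp_C).
Proof. by case: lp_C => [|c V] //=; rewrite mul0r addr0. Qed.

(* The region of admissible (eta, kap) is the triangle with vertices (0, 0),
   (0, s tau / 2), (s^2 tau, s tau), s = X z, so the certificate need only be
   checked there. *)
Lemma lp_pointwise (K : 'M[R]_(16.*2)) z : K^T = K ->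
  eta K z * evl lp_A (X z) + kap K z * evl lp_B (X z) + \tr (K *m K) * evl lp_C (X z) <=
  if z == 0 then \tr (K *m K) * zR R (head Z0 lp_C) else 0.
Proof.
move=> sK; have [->|z0] := eqVneq z 0.
  have l0 : lam 0 = 0 by rewrite /latv /zr map_mx0 mulmx0.
  have d0 : dotp (0 : 'cV[R]_(16.*2)) 0 = 0 by apply/eqP; rewrite dotp_eq0.
  have q0 : qform K (0 : 'cV[R]_(16.*2)) = 0 by rewrite qformE mulmx0.
  have h0 : hh K 0 = 0 by rewrite /hh l0.
  have k0 : kk K 0 = 0 by rewrite /kk l0 mulmx0.
  have X00 : X 0 = 0 by rewrite /lX l0 d0 mulr0.
  have e0 : eta K 0 = 0 by rewrite /eta h0 expr0n mulr0.
  have kp0 : kap K 0 = 0 by rewrite /kap k0 mulr0.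
  by rewrite e0 kp0 X00 lp0 !mul0r !add0r.
have [m m2 Xm] := minB z0.
have /and4P[c0 c1 c2 _] := lp_check.
have := neg_checkP R c0 m2; have := neg_checkP R c1 m2; have := neg_checkP R c2 m2.
rewrite lp_V1 lp_V2 -Xm; set A := evl lp_A _; set A' := evl lp_B _; set C := evl lp_C _ => h2 h1 h0.
have s0 : 0 < X z.
  rewrite Xm; apply: mulr_gt0; first by apply: mulr_gt0; [exact: ltr0Sn|exact: pi_gt0].
  by rewrite ltr0n; case: (m) m2.
have e1 := sym_norm_ineq (lam z) sK.
have e2 : hh K z ^+ 2 <= dotp (lam z) (lam z) * kk K z by rewrite /hh qformE; exact: dotp_CS.
apply: (cone_le0 s0) h0 h1 h2.
- by apply: mulr_ge0; exact: sqr_ge0.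
- by rewrite /eta /kap /lX [leRHS]mulrACA; apply: ler_wpM2l e2; exact: sqr_ge0.
rewrite -subr_ge0; apply: (le_trans (mulr_ge0 (sqr_ge0 pi) (etrans (subr_ge0 _ _) e1))).
rewrite le_eqVlt; apply/orP; left; apply/eqP; rewrite /kap /eta /lX -/(kk K z) -/(hh K z).
move: (dotp _ _) (hh K z) (kk K z) (\tr _) pi => q h k t P; ring.
Qed.

Let zRn n : zR R (Z.of_nat n) = n%:R. Proof. exact: zR_nat. Qed.

Let rpE k j : rp R 16 (k.*2) j = rpoly (zR R (Z.of_nat (8 + k))) j.
Proof.
rewrite /rp zRn natrD; congr rpoly.
have -> : 16%:R = 2 * 8%:R :> R by rewrite -natrM.
by rewrite -muln2 natrM; field.
Qed.

Let rpE4 j : rp R 16 4 j = rpoly (zR R 10) j. Proof. exact: (rpE 2). Qed.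
Let rpE2 j : rp R 16 2 j = rpoly (zR R 9) j. Proof. exact: (rpE 1). Qed.
Let rpE0 j : rp R 16 0 j = rpoly (zR R 8) j. Proof. exact: (rpE 0). Qed.

Let fA K j z := eta K z * (rp R 16 4 j).[X z] - kap K z * (rp R 16 2 j).[X z]
     + \tr (K *m K) / 4 * (rp R 16 0 j).[X z].
Let fB K j z := kap K z * (rp R 16 2 j).[X z] - \tr (K *m K) / 4 * (rp R 16 0 j).[X z].
Let fE (K : 'M[R]_(16.*2)) j z := pi * \tr K / 2 * hh K z * (rp R 16 2 j).[X z] - \tr K ^+ 2 / 8 * (rp R 16 0 j).[X z].

Let zsum s (f : nat -> 'cV[int]_(16.*2) -> R) z := \sum_(cj <- s) zR R cj.1 * f cj.2 z.

Let lp_identity K z :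
  eta K z * evl lp_A (X z) + kap K z * evl lp_B (X z) + \tr (K *m K) * evl lp_C (X z) =
  4 * zR R lp_W * (eta K z - \tr (K *m K) / 4) + 4 * zsum lp_a (fA K) z + 4 * zsum lp_b (fB K) z
  + 4 * \tr (K *m K) * zsum lp_c (fun j z => (rp R 16 0 j).[X z]) z.
Proof.
have -> : zsum lp_a (fA K) z = eta K z * evl (lincomb 10 lp_a) (X z)
   - kap K z * evl (lincomb 9 lp_a) (X z) + \tr (K *m K) / 4 * evl (lincomb 8 lp_a) (X z).
  rewrite !evl_lincomb !mulr_sumr -sumrB -big_split /=; apply: eq_bigr => cj _.
  by rewrite /fA rpE4 rpE2 rpE0; ring.
have -> : zsum lp_b (fB K) z = kap K z * evl (lincomb 9 lp_b) (X z)
   - \tr (K *m K) / 4 * evl (lincomb 8 lp_b) (X z).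
  rewrite !evl_lincomb !mulr_sumr -sumrB; apply: eq_bigr => cj _.
  by rewrite /fB rpE2 rpE0; ring.
have -> : zsum lp_c (fun j z => (rp R 16 0 j).[X z]) z = evl (lincomb 8 lp_c) (X z).
  by rewrite evl_lincomb; apply: eq_bigr => cj _; rewrite rpE0.
rewrite lp_AE lp_BE lp_CE.
generalize (evl (lincomb 10 lp_a) (X z)) (evl (lincomb 9 lp_a) (X z)) (evl (lincomb 8 lp_a) (X z)).
generalize (evl (lincomb 9 lp_b) (X z)) (evl (lincomb 8 lp_b) (X z)) (evl (lincomb 8 lp_c) (X z)).
generalize (zR R lp_W) (eta K z) (kap K z) (\tr (K *m K)) => W e k t a b c d f g.
by field.
Qed.

Let pfA K j : polyb X (fA K j).
Proof.
apply: (polybD X0); last by apply: polybZ; exact: pr.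
by apply: (polybB X0); apply: polybM; try exact: pr; [exact: pe|exact: pkp].
Qed.

Let pfB K j : polyb X (fB K j).
Proof.
apply: (polybB X0); last by apply: polybZ; exact: pr.
by apply: polybM; [exact: pkp|exact: pr].
Qed.

Let pfE K j : polyb X (fE K j).
Proof.
apply: (polybB X0); last by apply: polybZ; exact: pr.
by apply: polybM; [apply: polybZ; exact: ph|exact: pr].
Qed.

Let p_zsum s f : (forall j, polyb X (f j)) -> polyb X (zsum s f).
Proof. by move=> pf; apply: (polyb_sum X0) => cj; apply: polybZ; exact: pf. Qed.

Let gsum_zsum s f : (forall j, polyb X (f j)) ->
  gsum X (zsum s f) = \sum_(cj <- s) zR R cj.1 * gsum X (f cj.2).
Proof.
move=> pf; have /(gsum_sum X0 sX s) -> : forall cj : Z * nat, polyb X (fun z => zR R cj.1 * f cj.2 z).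
  by move=> cj; apply: polybZ; exact: pf.
by apply: eq_bigr => cj _; rewrite (gsumZ X0 sX _ (pf _)).
Qed.

Let gsum_zsum_eq s f g (P : pred nat) : (forall j, polyb X (f j)) -> (forall j, polyb X (g j)) ->
  all (fun cj => P cj.2) s -> (forall j, P j -> gsum X (f j) = gsum X (g j)) ->
  gsum X (zsum s f) = gsum X (zsum s g).
Proof.
move=> pf pg /allP Ps fg; rewrite !gsum_zsum// !big_seq.
by apply: eq_bigr => cj /Ps /fg ->.
Qed.

Let gsumA K : K^T = K -> gsum X (zsum lp_a (fA K)) = gsum X (zsum lp_a (fE K)).
Proof.
move=> sK; apply: (gsum_zsum_eq (P := odd)) => // j oj; have := rel4 sK oj.
by rewrite (gsumB X0 sX (pfA K j) (pfE K j)) => /eqP; rewrite subr_eq0 => /eqP.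
Qed.

Let gsum_zsum0 s f (P : pred nat) : (forall j, polyb X (f j)) ->
  all (fun cj => P cj.2) s -> (forall j, P j -> gsum X (f j) = 0) -> gsum X (zsum s f) = 0.
Proof.
move=> pf /allP Ps f0; rewrite gsum_zsum// big_seq big1// => cj /Ps /f0 ->.
by rewrite mulr0.
Qed.

Let gsumB0 K : K^T = K -> gsum X (zsum lp_b (fB K)) = 0.
Proof.
by move=> sK; apply: (gsum_zsum0 (P := fun j => ~~ odd j)) => // j; exact: rel2.
Qed.

Let gsumC0 : gsum X (zsum lp_c (fun j z => (rp R 16 0 j).[X z])) = 0.
Proof.
by apply: (gsum_zsum0 (P := odd)) => // j; exact: (lat_rel0 BN NM MN detB uB).
Qed.

Let E9 z := evl (lincomb 9 lp_a) (X z).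
Let E8 z := evl (lincomb 8 lp_a) (X z).

Let zsumE K z : zsum lp_a (fE K) z = pi * \tr K / 2 * (hh K z * E9 z) - \tr K ^+ 2 / 8 * E8 z.
Proof.
rewrite /zsum /fE; move: (\tr K) => t.
rewrite /E9 /E8 !evl_lincomb !mulr_sumr -sumrB; apply: eq_bigr => cj _.
by rewrite rpE2 rpE0; ring.
Qed.

Let gsum_lin a b F G : polyb X F -> polyb X G ->
  gsum X (fun z => a * F z + b * G z) = a * gsum X F + b * gsum X G.
Proof.
move=> pF pG; rewrite (gsumD X0 sX (polybZ a pF) (polybZ b pG)).
by rewrite (gsumZ X0 sX a pF) (gsumZ X0 sX b pG).
Qed.

Lemma gsum_fE_le : exists C1 C2, [/\ 0 <= C1, 0 <= C2 & forall K : 'M[R]_(16.*2), K^T = K ->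
  `|gsum X (zsum lp_a (fE K))| <= C1 * (Num.sqrt (\tr (K *m K)) * `|\tr K|) + C2 * \tr K ^+ 2].
Proof.
have p9 : polyb X (fun z => X z * `|E9 z|).
  by apply: polybM; [exact: (polyb_X X0)|apply: polyb_norm; exact: pv].
have p8 : polyb X (fun z => `|E8 z|) by apply: polyb_norm; exact: pv.
have ge0 G : (forall z, 0 <= G z) -> 0 <= gsum X G.
  by move=> G0; apply: rsum_ge0 => z; rewrite mulr_ge0 ?expR_ge0.
exists (gsum X (fun z => X z * `|E9 z|) / 2), (gsum X (fun z => `|E8 z|) / 8); split.
- by rewrite divr_ge0// ge0// => z; rewrite mulr_ge0 ?X0.
- by rewrite divr_ge0// ge0.
move=> K sK; have pE : polyb X (zsum lp_a (fE K)) by exact: p_zsum.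
apply: le_trans (ler_norm_gsum X0 sX pE) _.
set r := Num.sqrt _; have r0 : 0 <= r := sqrtr_ge0 _.
have -> : gsum X (fun z => X z * `|E9 z|) / 2 * (r * `|\tr K|) + gsum X (fun z => `|E8 z|) / 8 * \tr K ^+ 2
   = gsum X (fun z => r * `|\tr K| / 2 * (X z * `|E9 z|) + \tr K ^+ 2 / 8 * `|E8 z|).
  apply: (etrans _ (esym (gsum_lin (r * `|\tr K| / 2) (\tr K ^+ 2 / 8) p9 p8))).
  generalize (gsum X (fun z => X z * `|E9 z|)) (gsum X (fun z => `|E8 z|)) => u v.
  by move: (`|_|) => t; ring.
apply: (ler_gsum X0 sX (polyb_norm pE) (polybD X0 (polybZ _ p9) (polybZ _ p8))) => z.
rewrite zsumE; apply: le_trans (ler_normB _ _) _; apply: lerD; last first.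
  by rewrite normrM ger0_norm// divr_ge0 ?sqr_ge0.
have -> : pi * \tr K / 2 * (hh K z * E9 z) = \tr K / 2 * ((pi * hh K z) * E9 z) by ring.
rewrite !normrM normfV (ger0_norm (ler0n R 2)).
have -> : r * `|\tr K| / 2 * (X z * `|E9 z|) = `|\tr K| / 2 * (r * X z * `|E9 z|) by ring.
rewrite -normrM ler_wpM2l ?divr_ge0// ler_wpM2r//; exact: sym_qform_abs_le.
Qed.

Let lp_bound : exists W c, [/\ 0 < W, c < 0 & forall (K : 'M[R]_(16.*2)) z, K^T = K ->
  4 * W * (eta K z - \tr (K *m K) / 4) + 4 * zsum lp_a (fA K) z + 4 * zsum lp_b (fB K) z
  + 4 * \tr (K *m K) * zsum lp_c (fun j z => (rp R 16 0 j).[X z]) z <=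
  if z == 0 then \tr (K *m K) * c else 0].
Proof.
exists (zR R lp_W), (zR R (head Z0 lp_C)); split.
- by rewrite /zR ltr0z.
- by have /and4P[_ _ _ h] := lp_check; exact: zR_lt0 h.
by move=> K z sK; rewrite -lp_identity; exact: lp_pointwise.
Qed.

Lemma key_inequality : exists c C1 C2, [/\ 0 < c, 0 <= C1, 0 <= C2 &
  forall K : 'M[R]_(16.*2), K^T = K ->
  gsum X (fun z => pi ^+ 2 * qform K (lam z) ^+ 2 - \tr (K *m K) / 4) <=
  - c * \tr (K *m K) + C1 * (Num.sqrt (\tr (K *m K)) * `|\tr K|) + C2 * \tr K ^+ 2].
Proof.
have [C1 [C2 [C10 C20 hC]]] := gsum_fE_le.
have [W [c [W0 c0 hp]]] := lp_bound.
exists (- c / (4 * W)), (C1 / W), (C2 / W).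
split; [by rewrite divr_gt0 ?mulr_gt0// oppr_gt0|by rewrite divr_ge0// ltW|by rewrite divr_ge0// ltW|].
move=> K sK; set G := gsum _ _; set t := \tr (K *m K).
have pt : polyb X (fun z => eta K z - t / 4) by apply: (polybB X0); [exact: pe|exact: polyb_cst].
have pA := p_zsum lp_a (pfA K); have pB := p_zsum lp_b (pfB K).
have pC : polyb X (zsum lp_c (fun j z => (rp R 16 0 j).[X z])) by apply: p_zsum => j; exact: pr.
have pif : polyb X (fun z => if z == 0 then t * c else 0).
  apply: polyb_le (polyb_cst X (t * c)) => z.
  by case: ifP => // _; rewrite normr0.
have pL : polyb X (fun z => 4 * W * (eta K z - t / 4) + 4 * zsum lp_a (fA K) z
    + 4 * zsum lp_b (fB K) z + 4 * t * zsum lp_c (fun j z => (rp R 16 0 j).[X z]) z).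
  by do !(apply: (polybD X0)); apply: polybZ.
have : 4 * W * G + 4 * gsum X (zsum lp_a (fE K)) <= t * c.
  have -> : t * c = gsum X (fun z => if z == 0 then t * c else 0).
    rewrite /gsum (@rsum_fin _ _ [:: 0])//; last first.
      by move=> z; rewrite inE => /negPf ->; rewrite mul0r.
    have l0 : lam 0 = 0 by rewrite /latv /zr map_mx0 mulmx0.
    have d0 : dotp (0 : 'cV[R]_(16.*2)) 0 = 0 by apply/eqP; rewrite dotp_eq0.
    by rewrite big_seq1 eqxx /lX l0 d0 mulr0 oppr0 expR0 mulr1.
  apply: le_trans (ler_gsum X0 sX pL pif _).
    rewrite (gsumD X0 sX); [|by do !(apply: (polybD X0)); apply: polybZ|by apply: polybZ].
    rewrite (gsumD X0 sX); [|by do !(apply: (polybD X0)); apply: polybZ|by apply: polybZ].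
    rewrite (gsumD X0 sX (polybZ _ pt) (polybZ _ pA)).
    rewrite (gsumZ X0 sX _ pt) (gsumZ X0 sX _ pA) (gsumZ X0 sX _ pB) (gsumZ X0 sX _ pC).
    by rewrite gsumC0 (gsumB0 sK) (gsumA sK) !mulr0 !addr0.
  by move=> z; exact: hp.
have := hC K sK; rewrite ler_norml => /andP[+ _].
set r := Num.sqrt _ * _; set g := gsum X (zsum _ _); clearbody g G r.
move=> e2 e1; rewrite -subr_ge0.
have -> : - (- c / (4 * W)) * t + C1 / W * r + C2 / W * \tr K ^+ 2 - G =
   W^-1 / 4 * ((t * c - (4 * W * G + 4 * g)) + 4 * (g + (C1 * r + C2 * \tr K ^+ 2))).
  by field; rewrite gt_eqF.
apply: mulr_ge0; last lra.
by rewrite divr_ge0// invr_ge0 ltW.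
Qed.

End KeyInequality.

(** * The energy near the lattice *)

Section GaussianSums.
Variables (R : realType) (n : nat) (T : choiceType) (lam : T -> 'cV[R]_n.+1) (X : T -> R).
Local Notation pi := (@pi R).
Hypothesis XE : forall z, X z = pi * dotp (lam z) (lam z).
Hypothesis sX : forall c, 0 < c -> rsummable (fun z => expR (- (c * X z))).
Hypothesis pl : forall v, polyb X (fun z => dotp v (lam z)).

Let X0 z : 0 <= X z. Proof. by rewrite XE mulr_ge0 ?pi_ge0 ?dotp_ge0. Qed.
Let ph K : polyb X (fun z => qform K (lam z)). Proof. exact: (polyb_qform X0 pl). Qed.

Lemma gauss_taylor : exists2 C, 0 <= C & forall K : 'M[R]_n.+1, K^T = K ->
  Num.sqrt (\tr (K *m K)) <= 2^-1 ->
  rsummable (fun z => expR (- (X z + pi * qform K (lam z)))) /\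
  rsum (fun z => expR (- (X z + pi * qform K (lam z)))) <=
    gsum X (fun=> 1) - pi * gsum X (fun z => qform K (lam z))
    + 2^-1 * gsum X (fun z => pi ^+ 2 * qform K (lam z) ^+ 2)
    + C * (\tr (K *m K) * Num.sqrt (\tr (K *m K))).
Proof.
have c4 : 0 < 4^-1 :> R by rewrite invr_gt0.
have s4 := sX c4; pose D : R := 3`!%:R / 4^-1 ^+ 3.
have D0 : 0 <= D by rewrite divr_ge0 ?exprn_ge0// ltW.
exists (D * rsum (fun z => expR (- (4^-1 * X z)))).
  by rewrite mulr_ge0// rsum_ge0// => z; exact: expR_ge0.
move=> K sK; have := sym_tr_ge0 sK; set t := \tr (K *m K) => t0.
set r := Num.sqrt t => r2; have r0 : 0 <= r := sqrtr_ge0 _.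
have rr : r ^+ 2 = t by rewrite sqr_sqrtr.
pose u z := pi * qform K (lam z).
have uX z : `|u z| <= r * X z by rewrite XE; exact: sym_qform_abs_le.
have sP : polyb X (fun z => 1 - u z + 2^-1 * (pi ^+ 2 * qform K (lam z) ^+ 2)).
  apply: (polybD X0).
    by apply: (polybB X0); [exact: polyb_cst|apply: polybZ].
  by do 2 apply: polybZ; exact: polybXn.
have sP' := gsummable X0 sX sP.
have sr := rsummableZ (D * (t * r)) s4.
have bnd z : expR (- (X z + u z)) <=
   (1 - u z + 2^-1 * (pi ^+ 2 * qform K (lam z) ^+ 2)) * expR (- X z)
   + D * (t * r) * expR (- (4^-1 * X z)).
  have e3 : exp_poly 3 (- u z) = 1 - u z + 2^-1 * (pi ^+ 2 * qform K (lam z) ^+ 2).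
    by rewrite exp_poly3 /u; ring.
  have /ler_normlP[_] := expR_taylor 3 (- u z); rewrite normrN e3 => h.
  have h1 : expR (- (X z + u z)) = expR (- u z) * expR (- X z).
    by rewrite -expRD; congr expR; ring.
  have h2 : `|u z| ^+ 3 * expR `|u z| * expR (- X z) <= D * (t * r) * expR (- (4^-1 * X z)).
    have -> : t * r = r ^+ 3 by rewrite -rr; ring.
    have a1 : `|u z| ^+ 3 <= r ^+ 3 * (D * expR (4^-1 * X z)).
      apply: (@le_trans _ _ ((r * X z) ^+ 3)).
        by rewrite lerXn2r ?nnegrE ?normr_ge0 ?mulr_ge0 ?X0.
      by rewrite exprMn ler_wpM2l ?exprn_ge0//; exact: Xn_le_expR.
    have a2 : expR `|u z| <= expR (2^-1 * X z).
      by rewrite ler_expR (le_trans (uX z))// ler_wpM2r ?X0.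
    have a3 : `|u z| ^+ 3 * expR `|u z| <= r ^+ 3 * (D * expR (4^-1 * X z)) * expR (2^-1 * X z).
      by apply: ler_pM; rewrite ?exprn_ge0 ?normr_ge0 ?expR_ge0.
    apply: le_trans (ler_wpM2r (expR_ge0 _) a3) _.
    rewrite le_eqVlt; apply/orP; left; apply/eqP.
    have -> : - (4^-1 * X z) = 4^-1 * X z + 2^-1 * X z - X z by field.
    by rewrite !expRD; ring.
  rewrite h1; have := ler_wpM2r (expR_ge0 (- X z)) h; move: h2.
  by rewrite mulrBl; lra.
have sF : rsummable (fun z => expR (- (X z + u z))).
  apply: rsummable_le (rsummableD sP' sr) => z.
  by rewrite ger0_norm ?expR_ge0//; exact: bnd.
split=> //; apply: le_trans (ler_rsum sF (rsummableD sP' sr) bnd) _.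
rewrite (rsumD sP' sr) (rsumZ (D * (t * r)) s4) -/(gsum X _).
have p2 : polyb X (fun z => pi ^+ 2 * qform K (lam z) ^+ 2) by apply: polybZ; exact: polybXn.
have pu : polyb X u by exact: polybZ.
have p1 : polyb X (fun z => 1 - u z) by apply: (polybB X0) => //; exact: polyb_cst.
rewrite (gsumD X0 sX p1 (polybZ 2^-1 p2)) (gsumB X0 sX (polyb_cst X 1) pu).
rewrite (gsumZ X0 sX 2^-1 p2) (gsumZ X0 sX pi (ph K)).
rewrite le_eqVlt; apply/orP; left; apply/eqP; ring.
Qed.

Lemma local_max_arith (c C1 C2 C3 C S nu d r t tau : R) :
  0 <= C1 -> 0 <= C2 -> 0 <= C3 -> 0 <= C -> 0 <= S -> 0 <= nu ->
  0 <= d -> d <= 1 -> nu * d <= 1 -> d ^+ 2 <= tau -> tau <= nu ^+ 2 * d ^+ 2 ->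
  0 <= r -> r <= nu * d -> `|t| <= nu * d -> `|t + (t ^+ 2 - tau) / 2| <= C * d ^+ 3 ->
  (C1 / 2 * nu * (1 + 2 * C) + C2 / 2 * ((1 + 2 * C) ^+ 2 * nu ^+ 2)
    + S / 4 * ((1 + 2 * C) ^+ 2 * nu ^+ 2 / 2 + C) + C3 * nu) * d <= c / 2 ->
  2^-1 * (- c * tau + C1 * (r * `|t|) + C2 * t ^+ 2) + S * (tau / 8 - t / 4)
    + C3 * (tau * r) <= 0.
Proof.
move=> C10 C20 C30 C0 S0 nu0 d0 d1 nd dt tn r0 rn tnd h hc.
have tau0 : 0 <= tau by exact: le_trans (sqr_ge0 d) dt.
have Cd : C * d ^+ 3 <= C * (d * tau).
  by rewrite ler_wpM2l// exprS ler_wpM2l.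
have t2 : t ^+ 2 <= nu * d * `|t|.
  by rewrite -real_normK ?num_real// expr2 ler_wpM2r.
have tt : `|t| <= (1 + 2 * C) * tau.
  have : `|t| <= `|t + (t ^+ 2 - tau) / 2| + (t ^+ 2 + tau) / 2.
    have := ler_norm (t + (t ^+ 2 - tau) / 2); have := ler_norm (- (t + (t ^+ 2 - tau) / 2)).
    rewrite normrN; have := sqr_ge0 t => e1 e2 e3.
    by rewrite ler_norml; apply/andP; split; lra.
  have e1 : nu * d * `|t| <= `|t| by rewrite ler_piMl.
  have e2 : C * (d * tau) <= C * tau by rewrite ler_wpM2l// ler_piMl.
  lra.
have q0 : 0 <= 1 + 2 * C by rewrite addr_ge0// mulr_ge0.
have h1 : r * `|t| <= nu * d * ((1 + 2 * C) * tau) by apply: ler_pM.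
have h2 : t ^+ 2 <= (1 + 2 * C) ^+ 2 * nu ^+ 2 * d * tau.
  apply: (@le_trans _ _ (((1 + 2 * C) * tau) ^+ 2)).
    by rewrite -real_normK ?num_real// lerXn2r ?nnegrE ?mulr_ge0.
  have h5 : tau <= nu ^+ 2 * d.
    by apply: le_trans tn _; rewrite ler_wpM2l ?sqr_ge0// expr2 ler_piMl.
  have h6 : tau ^+ 2 <= nu ^+ 2 * d * tau by rewrite [leLHS]expr2 ler_wpM2r.
  have := ler_wpM2l (sqr_ge0 (1 + 2 * C)) h6; rewrite exprMn => h7.
  apply: le_trans h7 _; rewrite le_eqVlt; apply/orP; left; apply/eqP; ring.
have h3 : tau * r <= tau * (nu * d) by rewrite ler_wpM2l.
have h4 : tau / 8 - t / 4 <= (t ^+ 2 / 2 + C * (d * tau)) / 4.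
  move: h; rewrite ler_norml => /andP[h _]; lra.
set q := 1 + 2 * C in h1 h2 tt q0 hc *.
have g1 := ler_wpM2l C10 h1; have g2 := ler_wpM2l C20 h2; have g3 := ler_wpM2l C30 h3.
have g4 : S * (tau / 8 - t / 4) <= S * ((q ^+ 2 * nu ^+ 2 * d * tau / 2 + C * (d * tau)) / 4).
  by rewrite ler_wpM2l//; lra.
have := ler_wpM2r tau0 hc.
set A := _ * d * tau; have AE : A = 2^-1 * (C1 * (nu * d * (q * tau)))
  + 2^-1 * (C2 * (q ^+ 2 * nu ^+ 2 * d * tau))
  + S * ((q ^+ 2 * nu ^+ 2 * d * tau / 2 + C * (d * tau)) / 4) + C3 * (tau * (nu * d)).
  by rewrite /A; field.
clearbody A; lra.
Qed.

Lemma mx_entry_le_norm (A : 'M[R]_n.+1) i j : `|A i j| <= `|A|.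
Proof.
rewrite [leRHS]mx_normrE.
exact: (le_bigmax _ (fun i : 'I_n.+1 * 'I_n.+1 => `|A i.1 i.2|) (i, j)).
Qed.

Lemma sym_norm_sqr_le (A : 'M[R]_n.+1) : A^T = A -> `|A| ^+ 2 <= \tr (A *m A).
Proof.
move=> sA; have [/eqP|n0] := boolP (mx_norm A == 0).
  by rewrite -[mx_norm A]/(`|A|) => ->; rewrite expr0n sym_tr_ge0.
have [[i j] Aij] := mx_norm_neq0 n0.
by rewrite -[`|A|]/(mx_norm A) Aij real_normK ?num_real// sym_tr_entry.
Qed.

Lemma near_norm_lt (A : 'M[R]_n.+1) e : 0 < e -> \forall Y \near nbhs A, `|Y - A| < e.
Proof.
by move=> e0; rewrite nearE -nbhs_ballE; exists e => //= Y; rewrite -ball_normE /= distrC.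
Qed.

Lemma gauss_sum_local_max (c C1 C2 : R) : 0 < c -> 0 <= C1 -> 0 <= C2 ->
  (forall K : 'M[R]_n.+1, K^T = K ->
    pi * gsum X (fun z => qform K (lam z)) = \tr K / 4 * gsum X (fun=> 1)) ->
  (forall K : 'M[R]_n.+1, K^T = K ->
    gsum X (fun z => pi ^+ 2 * qform K (lam z) ^+ 2 - \tr (K *m K) / 4) <=
    - c * \tr (K *m K) + C1 * (Num.sqrt (\tr (K *m K)) * `|\tr K|) + C2 * \tr K ^+ 2) ->
  \forall Y \near nbhs (1%:M : 'M[R]_n.+1), posdef_det1 Y ->
    rsummable (fun z => expR (- (pi * qform Y (lam z)))) /\
    rsum (fun z => expR (- (pi * qform Y (lam z)))) <= rsum (fun z => expR (- X z)).
Proof.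
move=> c0 C10 C20 gq key.
have [C3 C30 hT] := gauss_taylor.
pose d (Y : 'M[R]_n.+1) := `|Y - 1%:M|.
have d0 Y : 0 <= d Y by exact: normr_ge0.
have dF e : 0 < e -> \forall Y \near nbhs (1%:M : 'M[R]_n.+1), d Y < e by exact: near_norm_lt.
have hK i j : dO (nbhs (1%:M : 'M[R]_n.+1)) d 1 (fun Y => (Y - 1%:M) i j).
  by exists 1 => //; apply: nearW => Y; rewrite mul1r; exact: mx_entry_le_norm.
have [C C0 hdet] := det1D_expansion _ d0 dF hK.
pose nu : R := n.+1%:R; pose S := gsum X (fun=> 1).
have nu0 : 0 < nu by rewrite ltr0n.
have S0 : 0 <= S by apply: rsum_ge0 => z; rewrite mul1r expR_ge0.
pose C6 := C1 / 2 * nu * (1 + 2 * C) + C2 / 2 * ((1 + 2 * C) ^+ 2 * nu ^+ 2)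
    + S / 4 * ((1 + 2 * C) ^+ 2 * nu ^+ 2 / 2 + C) + C3 * nu.
have C60 : 0 <= C6.
  have q0 : 0 <= 1 + 2 * C by rewrite addr_ge0// mulr_ge0.
  have q2 := sqr_ge0 (1 + 2 * C); have n2 := sqr_ge0 nu; have nu1 := ltW nu0.
  by rewrite !addr_ge0 ?mulr_ge0 ?divr_ge0 ?addr_ge0 ?mulr_ge0 ?divr_ge0.
have e1 : 0 < (2 * nu)^-1 by rewrite invr_gt0 mulr_gt0.
have e2 : 0 < c / 2 / (C6 + 1) by rewrite !divr_gt0// ltr_wpDl.
near=> Y => -[sY _ dY].
have sK : (Y - 1%:M)^T = Y - 1%:M by rewrite linearB /= sY tr_scalar_mx.
have d1 : d Y < 1 by near: Y; exact: dF.
have dn : d Y < (2 * nu)^-1 by near: Y; exact: dF.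
have dc : d Y < c / 2 / (C6 + 1) by near: Y; exact: dF.
have hd : `|\det (1%:M + (Y - 1%:M)) - 1 - \tr (Y - 1%:M)
    - (\tr (Y - 1%:M) ^+ 2 - \tr ((Y - 1%:M) *m (Y - 1%:M))) / 2| <= C * d Y ^+ 3.
  by near: Y.
have n2 : nu * d Y <= 2^-1.
  have -> : 2^-1 = nu * (2 * nu)^-1 by field; rewrite gt_eqF.
  by rewrite ler_wpM2l ?(ltW nu0) ?(ltW dn).
set K := Y - 1%:M in sK hd *; set tau := \tr (K *m K) in hd *.
have {}hd : `|\tr K + (\tr K ^+ 2 - tau) / 2| <= C * d Y ^+ 3.
  have YE : 1%:M + K = Y by rewrite addrC subrK.
  move: hd; rewrite YE dY subrr sub0r -normrN => hd; apply: le_trans hd.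
  by rewrite le_eqVlt; apply/orP; left; apply/eqP; congr `| _ |; rewrite opprD !opprK.
have trd : `|\tr K| <= nu * d Y.
  apply: le_trans (ler_norm_sum _ _ _) _.
  apply: (@le_trans _ _ (\sum_(i < n.+1) d Y)); last by rewrite sumr_const card_ord mulr_natl.
  by apply: ler_sum => i _; exact: mx_entry_le_norm.
have td : tau <= nu ^+ 2 * d Y ^+ 2.
  by apply: sym_tr_le => // i j; exact: mx_entry_le_norm.
have dt : d Y ^+ 2 <= tau by exact: sym_norm_sqr_le.
have rd : Num.sqrt (tau) <= nu * d Y.
  by rewrite -(ger0_norm (mulr_ge0 (ltW nu0) (d0 Y))) -sqrtr_sqr exprMn ler_wsqrtr.
have [sF hF] := hT _ sK (le_trans rd n2).
have := key _ sK; have := gq _ sK.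
have hcc : C6 * d Y <= c / 2.
  move: (ltW dc); rewrite ler_pdivlMr ?ltr_wpDl// mulrC => h; apply: le_trans h.
  by rewrite ler_wpM2r// lerDl.
have nd1 : nu * d Y <= 1 by lra.
have := local_max_arith C10 C20 C30 C0 S0 (ltW nu0) (d0 Y) (ltW d1) nd1 dt td
  (sqrtr_ge0 _) rd trd hd hcc.
have p2 : polyb X (fun z => pi ^+ 2 * qform K (lam z) ^+ 2).
  by apply: polybZ; exact: polybXn.
rewrite (gsumB X0 sX p2 (polyb_cst X _)).
have -> : gsum X (fun=> tau / 4) = tau / 4 * S.
  rewrite -(gsumZ X0 sX _ (polyb_cst X 1)); congr gsum; apply/funext => z.
  by rewrite mulr1.
have FE : (fun z => expR (- (X z + pi * qform K (lam z)))) =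
    (fun z => expR (- (pi * qform Y (lam z)))).
  apply/funext => z; congr (expR (- _)).
  rewrite XE -mulrDr; congr (_ * _).
  by rewrite !qformE /K mulmxBl mul1mx dotpDr dotpNr addrC subrK.
rewrite FE in sF hF; move=> a1 a2 a3; split=> //; apply: le_trans hF _.
have -> : rsum (fun z => expR (- X z)) = S.
  by congr rsum; apply/funext => z; rewrite mul1r.
rewrite -/S a2; move: a1 a3; rewrite -/S; lra.
Unshelve. all: by end_near.
Qed.

End GaussianSums.

Lemma lattice_energyE (R : realType) (n : nat) (L : set 'cV[R]_n) (B Y : 'M[R]_n) :
  B \in unitmx -> L = range (fun z => B *m zr R z) ->
  rsummable (fun z => expR (- (pi * qform Y (B *m zr R z)))) ->
  gaussian_energy pi L Y = (rsum (fun z => expR (- (pi * qform Y (B *m zr R z)))) - 1)%:E.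
Proof.
move=> uB -> sF; pose lam (z : 'cV[int]_n) := B *m zr R z.
pose F z := expR (- (pi * qform Y (lam z))).
change (gaussian_energy pi (range lam) Y = (rsum F - 1)%:E).
have {}sF : rsummable F := sF.
have lam0 : lam 0 = 0 by rewrite /lam /zr map_mx0 mulmx0.
have lamI : injective lam.
  move=> x y /(congr1 (mulmx (invmx B))); rewrite /lam !mulKmx// => /matrixP h.
  by apply/matrixP => i j; have := h i j; rewrite !mxE => /intr_inj.
have F0 : F 0 = 1 by rewrite /F -/(lam 0) lam0 qformE mulmx0 /dotp mulmx0 mxE mulr0 oppr0 expR0.
have LE : range lam `\ 0 = lam @` [set z | z != 0].
  apply/seteqP; split => [_ [[z _ <-] z0]|_ [z /= z0 <-]].
    by exists z => //=; apply: contra_not_neq z0 => ->.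
  by split; [exists z|rewrite /= -lam0 => /lamI /eqP; exact/negP].
rewrite /gaussian_energy LE esum_image; last by move=> x y _ _; exact: lamI.
have sd : rsummable (fun z : 'cV[int]_n => (z == 0)%:R : R).
  by apply: (@rsummable_fin _ _ [:: 0]) => z; rewrite inE => /negPf ->.
have -> : 1 = rsum (fun z : 'cV[int]_n => (z == 0)%:R : R).
  rewrite (@rsum_fin _ _ [:: 0])//; first by rewrite big_seq1 eqxx.
  by move=> z; rewrite inE => /negPf ->.
rewrite -rsumB// rsum_esum; last 2 first.
- by move=> z; have [->|_] := eqVneq z 0; rewrite ?F0 ?subrr// subr0 expR_ge0.
- exact: rsummableB.
rewrite esum_mkcond; apply: eq_esum => z _.
rewrite /gaussian -[qform Y (lam z)]/(qform Y (B *m zr R z)).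
have [zE|zN] := boolP (z \in _); last first.
  have -> : z = 0 by apply/eqP; apply: contraNT zN => z0; rewrite inE.
  by rewrite F0 eqxx subrr.
by move: zE; rewrite inE /= => /negPf ->; rewrite subr0.
Qed.

Lemma even_rootless_norm (R : realType) (n : nat) (L : set 'cV[R]_n) x :
  even_lattice L -> lattice_roots L = set0 -> L x -> x != 0 ->
  exists2 m : nat, (2 <= m)%N & dotp x x = 2 * m%:R.
Proof.
move=> eL rL Lx x0; have [k kE] := eL x Lx.
have : 0 < dotp x x by rewrite lt_def dotp_ge0 dotp_eq0 x0.
case: k kE => m kE; last first.
  by rewrite kE ltr0z pmulr_rgt0.
move=> p; exists m; last by rewrite kE intrM.
case: m kE p => [|[|m]]//= kE; first by rewrite kE mulr0 ltxx.
have : lattice_roots L x by split.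
by rewrite rL.
Qed.

Theorem mainTheorem5 (R : realType) (L : set 'cV[R]_32)
    (L_lattice : is_lattice L) (L_unimodular : unimodular L)
    (L_even : even_lattice L) (L_rootless : lattice_roots L = set0) :
  energy_local_max pi L.
Proof.
have [B uB LE] := lattice_basis L_lattice L_unimodular.
have [N [M [BN NM MN detB]]] := unimodular_gram L_unimodular uB LE.
have LB z : L (B *m zr R z) by rewrite LE; exists z.
have minB z : z != 0 -> exists2 m : nat, (2 <= m)%N & @lX R 16 B z = 2 * pi * m%:R.
  move=> z0; have x0 : B *m zr R z != 0.
    apply: contraNneq z0 => /(congr1 (mulmx (invmx B))); rewrite mulKmx// mulmx0 => /matrixP h.
    by apply/eqP/matrixP => i j; have := h i j; rewrite !mxE => /eqP; rewrite intr_eq0 => /eqP.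
  have [m m2 mE] := even_rootless_norm L_even L_rootless (LB z) x0.
  by exists m => //; rewrite /lX [dotp _ _]mE; ring.
have [c [C1 [C2 [c0 C10 C20 key]]]] := @key_inequality R B N M BN NM MN detB uB minB.
have gq := @gsum_qform R B N M BN NM MN detB uB.
have sX e := @lX_summable R 16 B uB e.
have := @gauss_sum_local_max R 31 _ (fun z => B *m zr R z) (@lX R 16 B) (fun=> erefl) sX
  (@polyb_dot_lam R 16 B) c C1 C2 c0 C10 C20 gq key.
rewrite /energy_local_max => h; rewrite near_withinE; apply: filterS h => Y hY pY.
have [sF leF] := hY pY.
have E1 : (fun z => expR (- (pi * qform 1%:M (B *m zr R z)))) = (fun z => expR (- @lX R 16 B z)).
  by apply/funext => z; rewrite qformE mul1mx.
have s1 : rsummable (fun z => expR (- (pi * qform 1%:M (B *m zr R z)))).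
  by rewrite E1; have := sX 1 ltr01; congr rsummable; apply/funext => z; rewrite mul1r.
rewrite !(lattice_energyE uB LE)// lee_fin lerB// E1; exact: leF.
Qed.
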